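(* Let $(M,\mathcal F)$ be a foliated manifold of dimension $n=p+q$, $\dim\mathcal F=p$, codimension $q\ge 2$, let $\nabla_{\mathcal F}$ be an adapted connection and $\nabla(\mathcal F)$ the induced foliated connection. Let $S\in C^\infty(P_{\mathcal F},S^k\mathbb R^n)$ be an equivariant function representing an adapted symbol of degree $k$, and let $f\in C^\infty(P_{\mathcal F},\mathbb R)$ be an equivariant function representing a basic function. Then, for $0\le l\le k$, $$\langle (\mathrm{Div}^{\omega_{\mathcal F}})^{l}S,\ (\nabla^{\omega_{\mathcal F}})^{k-l}f\rangle=({}^{\mathcal F}\mathfrak p^2)^{*}\langle (\mathrm{Div}^{\omega(\mathcal F)})^{l}({}^{\mathcal F}\hat\pi S),\ (\nabla^{\omega(\mathcal F)})^{k-l}({}^{\mathcal F}\hat\pi f)\rangle .$$ Consequently quantization commutes with reduction: for every adapted symbol $S\in\mathcal S^k_{\mathcal F}(M)$ and every basic function $f$, $$Q_{\mathcal F}(\nabla_{\mathcal F})(S)(f)=Q(\mathcal F)(\nabla(\mathcal F))({}^{\mathcal F}\pi S)({}^{\mathcal F}\pi f).$$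
   Context: Foliations. $T\mathcal F\subset TM$ is the tangent bundle of the foliation and $N=TM/T\mathcal F$. Adapted coordinates $X=(X^1,\dots,X^n)=(x^1,\dots,x^p,y^1,\dots,y^q)$ are coordinates in which the leaves are locally $y=$ const. Adapted vector fields: $\mathrm{Vect}_{\mathcal F}(M)=\{X:[X,Y]\in\Gamma(T\mathcal F)\ \forall Y\in\Gamma(T\mathcal F)\}$; foliated vector fields: $\mathrm{Vect}(M,\mathcal F)=\mathrm{Vect}_{\mathcal F}(M)/\Gamma(T\mathcal F)$. Basic (= foliated = adapted) functions are those locally constant along the leaves. An adapted connection $\nabla_{\mathcal F}$ is a torsion-free linear connection on $M$ mapping $\mathrm{Vect}_{\mathcal F}(M)\times\Gamma(T\mathcal F)$ into $\Gamma(T\mathcal F)$ and $\mathrm{Vect}_{\mathcal F}(M)\times\mathrm{Vect}_{\mathcal F}(M)$ into $\mathrm{Vect}_{\mathcal F}(M)$; it induces the foliated connection $\nabla(\mathcal F)_{[X]}[Y]=[\nabla_{\mathcal F,X}Y]$. Christoffel symbols: $\nabla_{\mathcal F,\partial_k}\partial_l=\Gamma^i_{kl}\partial_i$ and $\nabla(\mathcal F)_{[\partial_{y^a}]}[\partial_{y^b}]=\Gamma(\mathcal F)^c_{ab}[\partial_{y^c}]$. Adapted frames. $\mathcal F_0$ is the foliation of $\mathbb R^n=\mathbb R^p\times\mathbb R^q$ by the $\mathbb R^p\times\{z''\}$. $P^r_{\mathcal F}M$ is the bundle of $r$-jets $j^r_0(f)$ of local diffeomorphisms $f$ from a neighbourhood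 of $0\in\mathbb R^n$ into $M$ mapping $T\mathcal F_0$ to $T\mathcal F$; its group $G^r_{n,\mathcal F_0}$ consists of the jets $j^r_0(\varphi)$ of such maps with $M=\mathbb R^n$, $\varphi(0)=0$. $L_{\mathcal F}M=P^1_{\mathcal F}M$ has group $\mathrm{GL}(n,q,\mathbb R)=\{\begin{pmatrix}A&B\\0&D\end{pmatrix}:A\in\mathrm{GL}(p,\mathbb R),D\in\mathrm{GL}(q,\mathbb R)\}$. $H(n+1,q+1,\mathbb R)$ is the group, modulo nonzero scalars, of invertible matrices $\begin{pmatrix}\mathcal A&0\\ \alpha&a\end{pmatrix}$ with $\mathcal A\in\mathrm{GL}(n,q,\mathbb R)$, $\alpha=(0,\alpha'')\in\mathbb R^{p*}\oplus\mathbb R^{q*}$, $a\neq0$, embedded in $G^2_{n,\mathcal F_0}$ by taking the 2-jet at $0$ of $Z\mapsto \mathcal AZ/(\alpha Z+a)$. $P_{\mathcal F}\subset P^2_{\mathcal F}M$ is the reduction whose fibre at $m$ is $j^2_0(f)\cdot H(n+1,q+1,\mathbb R)$, where $X^i(f(Z))=X^i(m)+Z^i-\tfrac12\Gamma^i_{kl}(m)Z^kZ^l$ in adapted coordinates. $p^2_{\mathcal F}:P_{\mathcal F}\to L_{\mathcal F}M$, $j^2_0(f)\mapsto j^1_0(f)$. Normal frames. $P^r(M,\mathcal F)$ is the principal bundle, with group $G^r_q$ of $r$-jets at $0$ of local diffeomorphisms of $(\mathbb R^q,0)$, of classes $J^r_0(f)$ of smooth maps $f$ from a neighbourhood of $0\in\mathbb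 R^q$ into $M$ with $\mathrm{im}\,Tf\oplus T\mathcal F=TM$; $J^r_0(f)$ is determined by $f(0)$ and the $r$-jet at $0$ of $y\circ f$. $L(M,\mathcal F)=P^1(M,\mathcal F)$ is the bundle of frames of $N$. $H(q+1,\mathbb R)$ is the group, modulo nonzero scalars, of matrices $\begin{pmatrix}\mathcal A&0\\ \alpha&a\end{pmatrix}$, $\mathcal A\in\mathrm{GL}(q,\mathbb R)$, $\alpha\in\mathbb R^{q*}$, $a\ne0$, embedded in $G^2_q$ likewise. $P(\mathcal F)\subset P^2(M,\mathcal F)$ is the reduction to $H(q+1,\mathbb R)$ whose fibre at $m$ is $J^2_0(f)\cdot H(q+1,\mathbb R)$ with $f(0)=m$, $y^c(f(z))=y^c(m)+z^c-\tfrac12\Gamma(\mathcal F)^c_{ab}(m)z^az^b$. $p^2(\mathcal F):P(\mathcal F)\to L(M,\mathcal F)$, $J^2_0(f)\mapsto J^1_0(f)$. With $i_q(z'')=(0,z'')$, ${}^{\mathcal F}\mathfrak p^2:P_{\mathcal F}\to P(\mathcal F)$ is $j^2_0(f)\mapsto J^2_0(f\circ i_q)$. $\mathcal F_{P^2N}$ is the foliation of $P(\mathcal F)$ whose leaves are locally the fibres of $J^2_0(f)\mapsto j^2_0(f_i\circ f)$, for a cocycle $(U_i,f_i,g_{ij})$ of submersions $f_i:U_i\to N_i$ defining $\mathcal F$. Functions on $P(\mathcal F)$ locally constant along its leaves are called foliated. Symbols. $p_{n,q}$ denotes the canonical projections $\mathbb R^n\to\mathbb R^q$, $S^k\mathbb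 R^n\to S^k\mathbb R^q$. $\mathcal S^k_{\mathcal F}(M)$ is the space of sections $s$ of $S^kTM$ whose purely transverse components $s^{p+a_1\dots p+a_k}$ in adapted coordinates depend only on $y$; $\mathcal S^k(M,\mathcal F)$ is the space of sections of $S^kN$ whose components in adapted coordinates depend only on $y$. ${}^{\mathcal F}\pi:\mathcal S^k_{\mathcal F}(M)\to\mathcal S^k(M,\mathcal F)$ is induced by $TM\to N$ (the identity on basic functions, $k=0$). A symbol $s$ is represented by the equivariant function $\tilde s$ on $L_{\mathcal F}M$ (resp. $L(M,\mathcal F)$) giving its components in a frame, and by $\hat s=\tilde s\circ p^2_{\mathcal F}$ on $P_{\mathcal F}$ (resp. $\hat s=\tilde s\circ p^2(\mathcal F)$ on $P(\mathcal F)$). ${}^{\mathcal F}\hat\pi$ is ${}^{\mathcal F}\pi$ read through $\hat{\ }$: ${}^{\mathcal F}\hat\pi\hat s=({}^{\mathcal F}\pi s)^{\wedge}$. Cartan connections. Identify the Lie algebra of $\mathrm{PGL}(n+1,q+1,\mathbb R)$ (invertible matrices $\begin{pmatrix}A&B&h'\\0&D&h''\\0&\alpha''&a\end{pmatrix}$ with $A,D$ invertible of sizes $p,q$, $a\neq0$, modulo nonzero scalars) with $\mathbb R^n\oplus\mathrm{gl}(n,q,\mathbb R)\oplus\mathbb R^{q*}$, via $\begin{pmatrix}\mathcal A&v\\ \xi&a\end{pmatrix}\mapsto(v,\mathcal A-a\,\mathrm{Id},\xi)$, where $\mathrm{gl}(n,q,\mathbb R)$ is the Lie algebra of $\mathrm{GL}(n,q,\mathbb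 R)$. A Cartan connection on $P_{\mathcal F}$ is a 1-form $\omega$ with values in this algebra with $R_a^*\omega=\mathrm{Ad}(a^{-1})\omega$, $\omega(k^* )=k$ for fundamental vector fields, and $\omega_u$ bijective for all $u$; its curvature is $\Omega=d\omega+\frac12[\omega,\omega]$. The canonical form is $\theta_{\mathcal F;u}(X)=(P^1f)^{-1}_{*e}(p^2_{\mathcal F*}X)\in\mathbb R^n\oplus\mathrm{gl}(n,q,\mathbb R)$, $u=j^2_0(f)$, $e$ the identity frame at $0\in\mathbb R^n$. $\omega_{\mathcal F}$ is the unique Cartan connection on $P_{\mathcal F}$ whose $\mathbb R^n\oplus\mathrm{gl}(n,q,\mathbb R)$-part is $\theta_{\mathcal F}$, whose curvature has zero $\mathbb R^n$-part, and whose $\mathrm{gl}$-curvature components $\Omega^i_j=\frac12\sum K^i_{jkl}\omega^k\wedge\omega^l$ satisfy $\sum_{i=p+1}^nK^i_{jil}=0$ for $p+1\le j\le n$ and all $l$. $\omega(\mathcal F)$ is the $\mathrm{sl}(q+1,\mathbb R)$-valued form on $P(\mathcal F)$ equal over $U_i$ to the pullback, by $J^2_0(f)\mapsto j^2_0(f_i\circ f)$, of the (classical) normal Cartan connection of the image of $P(\mathcal F)|_{U_i}$, a reduction of $P^2N_i$ to $H(q+1,\mathbb R)$. Operators. $\omega_{\mathcal F}^{-1}(v)$ is the vector field with $\omega_{\mathcal F}(\omega_{\mathcal F}^{-1}(v))=v$, $v\in\mathbb R^n$. $\nabla^{\omega_{\mathcal F}}_vf=L_{\omega_{\mathcal F}^{-1}(v)}f$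 and $(\nabla^{\omega_{\mathcal F}})^kf(v_1,\dots,v_k)=\frac1{k!}\sum_\nu L_{\omega_{\mathcal F}^{-1}(v_{\nu_1})}\cdots L_{\omega_{\mathcal F}^{-1}(v_{\nu_k})}f$ (sum over permutations). For foliated functions on $P(\mathcal F)$, $\nabla^{\omega(\mathcal F)}$ and $(\nabla^{\omega(\mathcal F)})^k$ are defined by the same formulas with $v\in\mathbb R^q$ and $\omega(\mathcal F)^{-1}(v)$ any vector field with $\omega(\mathcal F)(\omega(\mathcal F)^{-1}(v))=v$. $\mathrm{Div}^{\omega_{\mathcal F}}S=\sum_{j=p+1}^ni(\epsilon^j)\nabla^{\omega_{\mathcal F}}_{e_j}S$ for $S\in C^\infty(P_{\mathcal F},S^k\mathbb R^n)$, and $\mathrm{Div}^{\omega(\mathcal F)}S=\sum_{j=1}^qi(\epsilon^j)\nabla^{\omega(\mathcal F)}_{e_j}S$ for foliated $S\in C^\infty(P(\mathcal F),S^k\mathbb R^q)$; here $(e_j),(\epsilon^j)$ are canonical dual bases and $i(\epsilon)$ is insertion into one slot of the symmetric tensor. $\langle\cdot,\cdot\rangle$ is the pairing with $\langle v_1\vee\dots\vee v_k,T\rangle=T(v_1,\dots,v_k)$. Quantizations. With $C_{k,0}=1$ and $C_{k,l}=\frac{(k-1)\cdots(k-l)}{(q+2k-1)\cdots(q+2k-l)}\binom kl$ for $l\ge1$: $Q_{\mathcal F}(\nabla_{\mathcal F})(S)(f)$ is the function on $M$ whose pullback to $P_{\mathcal F}$ is $\sum_{l=0}^kC_{k,l}\langle(\mathrm{Div}^{\omega_{\mathcal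 F}})^l\hat S,(\nabla^{\omega_{\mathcal F}})^{k-l}\hat f\rangle$, for $S\in\mathcal S^k_{\mathcal F}(M)$ and $f$ basic; $Q(\mathcal F)(\nabla(\mathcal F))(S)(f)$ is the function on $M$ whose pullback to $P(\mathcal F)$ is $\sum_{l=0}^kC_{k,l}\langle(\mathrm{Div}^{\omega(\mathcal F)})^l\hat S,(\nabla^{\omega(\mathcal F)})^{k-l}\hat f\rangle$, for $S\in\mathcal S^k(M,\mathcal F)$ and $f$ basic. *)

(* Defs.v *)
From HB Require Import structures.
From mathcomp Require Import all_boot all_order all_algebra all_fingroup.
From mathcomp Require Import all_classical all_reals all_analysis.
Set Implicit Arguments.
Unset Strict Implicit.
Unset Printing Implicit Defensive.
Import Order.TTheory GRing.Theory Num.Theory numFieldNormedType.Exports.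
Local Open Scope classical_set_scope.
Local Open Scope ring_scope.

Section Calculus.
Context {R : realType}.

(* All sets [U] used below are open and all spaces finite-dimensional, so that
   continuity of the iterated directional derivatives is C^k in the usual
   (Frechet) sense. *)
Fixpoint Ck {V W : normedModType R} (k : nat) (U : set V) (F : V -> W) : Prop :=
  (forall x, U x -> {for x, continuous F}) /\
  match k with
  | 0 => True
  | k'.+1 => forall v, (forall x, U x -> derivable F x v) /\
                       Ck k' U (fun x => 'D_v F x)
  end.

Definition smooth_on {V W : normedModType R} (U : set V) (F : V -> W) :=
  forall k, Ck k U F.

Definition iterD {V W : normedModType R} (vs : seq V) (F : V -> W) : V -> W :=
  foldr (fun v G x => 'D_v G x) F vs.

Definition jet_eq {V W : normedModType R} (r : nat) (F G : V -> W) :=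
  forall vs : seq V, (size vs <= r)%N -> iterD vs F 0 = iterD vs G 0.

Definition ev {n : nat} (i : 'I_n) : 'cV[R]_n := delta_mx i 0.

Definition jac {m n : nat} (F : 'cV[R]_m -> 'cV[R]_n) (x : 'cV[R]_m) :
  'M[R]_(n, m) := \matrix_(i, j) ('D_(ev j) F x) i 0.

End Calculus.

(* Charts indexed by [cidx] on the subset \bigcup_c cdom c of the ambient type
   T, modelled on E.  A tangent vector at u is represented by the element of E
   giving its components in the chart [pref u], which is selected among the
   charts around u; vector fields are thus functions T -> E. *)
Record charted (R : realType) (T : Type) (E : normedModType R) := Charted {
  cidx : Type;
  cdom : cidx -> set T;
  ccod : cidx -> set E;
  coord : cidx -> T -> E;
  param : cidx -> E -> T;
  pref : T -> cidx }.

Section Charted.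
Context {R : realType} {T : Type} {E : normedModType R}.
Variable C : charted T E.

(* components in the chart c of a tangent vector v at u *)
Definition tcomp (c : cidx C) (u : T) (v : E) : E :=
  'D_v (coord c \o param (pref C u)) (coord (pref C u) u).

(* the vector field with constant components w in the chart c *)
Definition cvec (c : cidx C) (w : E) (u : T) : E :=
  'D_w (coord (pref C u) \o param c) (coord c u).

Definition vrep (c : cidx C) (X : T -> E) (e : E) : E :=
  tcomp c (param c e) (X (param c e)).

Definition bracket (X Y : T -> E) (u : T) : E :=
  let c := pref C u in
  'D_(X u) (vrep c Y) (coord c u) - 'D_(Y u) (vrep c X) (coord c u).

Definition lie {W : normedModType R} (X : T -> E) (F : T -> W) (u : T) : W :=
  'D_(X u) (F \o param (pref C u)) (coord (pref C u) u).

Definition smooth_fun {W : normedModType R} (U : set T) (F : T -> W) :=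
  forall c : cidx C,
    smooth_on [set e | ccod c e /\ U (param c e)] (F \o param c).

Definition smooth_field (U : set T) (X : T -> E) :=
  forall c : cidx C,
    smooth_on [set e | ccod c e /\ U (param c e)] (vrep c X).

Definition smooth_form {W : normedModType R} (w : T -> E -> W) :=
  forall (c : cidx C) (v : E),
    smooth_on (ccod c) (fun e => w (param c e) (cvec c v (param c e))).

(* exterior derivative: dw(X,Y) = X.w(Y) - Y.w(X) for the fields X, Y with
   constant components in the chart [pref u] *)
Definition dext {W : normedModType R} (w : T -> E -> W) (u : T) (X Y : E) : W :=
  let c := pref C u in
  'D_X (fun e => w (param c e) (cvec c Y (param c e))) (coord c u) -
  'D_Y (fun e => w (param c e) (cvec c X (param c e))) (coord c u).

End Charted.

Definition tmap {R : realType} {T T' : Type} {E E' : normedModType R}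
    (C : charted T E) (C' : charted T' E') (h : T -> T') (u : T) (X : E) : E' :=
  'D_X (coord (pref C' (h u)) \o h \o param (pref C u)) (coord (pref C u) u).

(* R^m, or an open subset D of it, with its identity chart *)
Definition open_charted {R : realType} {m : nat} (D : set 'cV[R]_m) :
    charted 'cV[R]_m 'cV[R]_m :=
  {| cidx := unit; cdom := fun=> D; ccod := fun=> D;
     coord := fun=> id; param := fun=> id; pref := fun=> tt |}.

(* Adapted coordinates: the first p are the x^i (usubmx), the last q the y^a
   (dsubmx).  A foliation is given by an atlas of rectangular charts
   (A x B, A connected) whose changes of coordinates map leaves to leaves. *)
Record foliated_manifold (R : realType) (p q : nat) := FoliatedManifold {
  fm :> ptopologicalType;
  fatlas : charted fm 'cV[R]_(p + q);
  fm_hausdorff : hausdorff_space fm;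
  fm_second_countable : @second_countable fm;
  fdom_open : forall c, open (@cdom _ _ _ fatlas c);
  fcod_open : forall c, open (@ccod _ _ _ fatlas c);
  fcoordK : forall c m, @cdom _ _ _ fatlas c m ->
    @ccod _ _ _ fatlas c (coord c m) /\ param c (coord c m) = m;
  fparamK : forall c e, @ccod _ _ _ fatlas c e ->
    @cdom _ _ _ fatlas c (param c e) /\ coord c (param c e) = e;
  fcoord_continuous : forall c,
    {within @cdom _ _ _ fatlas c, continuous (@coord _ _ _ fatlas c)};
  fparam_continuous : forall c,
    {within @ccod _ _ _ fatlas c, continuous (@param _ _ _ fatlas c)};
  fpref_dom : forall m, @cdom _ _ _ fatlas (pref fatlas m) m;
  ftransition_smooth : forall c c',
    smooth_on [set e | @ccod _ _ _ fatlas c e /\ @cdom _ _ _ fatlas c' (param c e)]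
              (@coord _ _ _ fatlas c' \o @param _ _ _ fatlas c);
  ftransition_foliated : forall c c' e v,
    @ccod _ _ _ fatlas c e -> @cdom _ _ _ fatlas c' (param c e) ->
    dsubmx v = 0 ->
    dsubmx ('D_v (@coord _ _ _ fatlas c' \o @param _ _ _ fatlas c) e) = 0;
  frectangular : forall c,
    exists A : set 'cV[R]_p, exists B : set 'cV[R]_q,
      connected A /\
      @ccod _ _ _ fatlas c = [set e | A (usubmx e) /\ B (dsubmx e)] }.

Section Connections.
Context {R : realType} {p q : nat}.
Variable M : foliated_manifold R p q.
Local Notation E := 'cV[R]_(p + q).
Local Notation A := (fatlas M).

(* A linear connection is a local operator on the vector fields smooth on some
   open subset; its values at other fields are irrelevant. *)
Definition linear_connection (nabla : (M -> E) -> (M -> E) -> M -> E) :=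
  forall U : set M, open U ->
  (forall X X' Y Y', {in U, X =1 X'} -> {in U, Y =1 Y'} ->
     {in U, nabla X Y =1 nabla X' Y'}) /\
  (forall (f : M -> R) X X' Y Y', smooth_fun A U f ->
     smooth_field A U X -> smooth_field A U X' ->
     smooth_field A U Y -> smooth_field A U Y' ->
     [/\ smooth_field A U (nabla X Y),
         {in U, nabla (fun m => f m *: X m + X' m) Y =1
                fun m => f m *: nabla X Y m + nabla X' Y m},
         {in U, nabla X (fun m => Y m + Y' m) =1
                fun m => nabla X Y m + nabla X Y' m} &
         {in U, nabla X (fun m => f m *: Y m) =1
                fun m => lie A X f m *: Y m + f m *: nabla X Y m}]).

Definition torsion_free (nabla : (M -> E) -> (M -> E) -> M -> E) :=
  forall U : set M, open U -> forall X Y,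
    smooth_field A U X -> smooth_field A U Y ->
    {in U, forall m, nabla X Y m - nabla Y X m = bracket A X Y m}.

(* the class in N = TM/TF; the charts being adapted, T_mF is {v | dsubmx v = 0}
   and N_m is R^q *)
Definition cls (X : M -> E) (m : M) : 'cV[R]_q := dsubmx (X m).

Definition leaf_field (U : set M) (X : M -> E) :=
  smooth_field A U X /\ {in U, forall m, cls X m = 0}.

Definition adapted_field (U : set M) (X : M -> E) :=
  smooth_field A U X /\
  (forall Y, leaf_field U Y -> leaf_field U (bracket A X Y)).

Definition adapted_connection (nabla : (M -> E) -> (M -> E) -> M -> E) :=
  [/\ linear_connection nabla, torsion_free nabla &
      forall U : set M, open U ->
        (forall X Y, adapted_field U X -> leaf_field U Y ->
           leaf_field U (nabla X Y)) /\
        (forall X Y, adapted_field U X -> adapted_field U Y ->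
           adapted_field U (nabla X Y))].

Definition induced_connection (nabla : (M -> E) -> (M -> E) -> M -> E)
    (nablaN : (M -> 'cV[R]_q) -> (M -> 'cV[R]_q) -> M -> 'cV[R]_q) :=
  forall U : set M, open U -> forall X Y,
    adapted_field U X -> adapted_field U Y ->
    {in U, nablaN (cls X) (cls Y) =1 cls (nabla X Y)}.

(* the vector with i-th component Gamma^i_{kl}(m) Z^k Z^l in the chart c *)
Definition christoffel (nabla : (M -> E) -> (M -> E) -> M -> E)
    (c : cidx A) (m : M) (Z : E) : E :=
  \sum_(k < p + q) \sum_(l < p + q)
    (Z k 0 * Z l 0) *: tcomp c m (nabla (cvec c (ev k)) (cvec c (ev l)) m).

Definition christoffelN
    (nablaN : (M -> 'cV[R]_q) -> (M -> 'cV[R]_q) -> M -> 'cV[R]_q)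
    (c : cidx A) (m : M) (z : 'cV[R]_q) : 'cV[R]_q :=
  \sum_(a < q) \sum_(b < q)
    (z a 0 * z b 0) *:
      dsubmx (tcomp c m (col_mx 0
        (nablaN (cls (cvec c (ev (rshift p a))))
                (cls (cvec c (ev (rshift p b)))) m))).

End Connections.

(* block upper triangular matrices, by their blocks on and above the diagonal *)
Notation gl R p q := ('M[R]_p * 'M[R]_(p, q) * 'M[R]_q)%type.

(* R^n + gl(n,q,R) + R^{q*}, n = p + q *)
Notation pgl R p q := ('cV[R]_(p + q) * gl R p q * 'rV[R]_q)%type.

Section Groups.
Context {R : realType} {p q : nat}.

Definition glmx (a : gl R p q) : 'M[R]_(p + q) := block_mx a.1.1 a.1.2 0 a.2.

Definition isGL (a : gl R p q) : bool := (a.1.1 \in unitmx) && (a.2 \in unitmx).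

Definition glid : gl R p q := (1%:M, 0, 1%:M).

(* (A, alpha'', a), representing a class modulo nonzero scalars *)
Definition isH (h : gl R p q * 'rV[R]_q * R) : bool := isGL h.1.1 && (h.2 != 0).

Definition Hmx (h : gl R p q * 'rV[R]_q * R) : 'M[R]_(p + q + 1) :=
  block_mx (glmx h.1.1) 0 (row_mx 0 h.1.2) h.2%:M.

Definition homography (h : gl R p q * 'rV[R]_q * R) (Z : 'cV[R]_(p + q)) :
    'cV[R]_(p + q) :=
  ((row_mx 0 h.1.2 *m Z) 0 0 + h.2)^-1 *: (glmx h.1.1 *m Z).

Definition pgl_mx (x : pgl R p q) : 'M[R]_(p + q + 1) :=
  block_mx (glmx x.1.2) x.1.1 (row_mx 0 x.2) 0.

Definition mx_pgl (X : 'M[R]_(p + q + 1)) : pgl R p q :=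
  let B : 'M[R]_(p + q) := ulsubmx X - (drsubmx X 0 0)%:M in
  (ursubmx X, (ulsubmx B, ursubmx B, drsubmx B), rsubmx (dlsubmx X)).

Definition pgl_bracket (x y : pgl R p q) : pgl R p q :=
  mx_pgl (pgl_mx x *m pgl_mx y - pgl_mx y *m pgl_mx x).

(* Ad(h^-1) *)
Definition AdV (h : gl R p q * 'rV[R]_q * R) (x : pgl R p q) : pgl R p q :=
  mx_pgl (invmx (Hmx h) *m pgl_mx x *m Hmx h).

End Groups.

(* For p = 0 the adapted frames of a q-manifold are its frames, H is H(q+1,R)
   and pgl R 0 q is sl(q+1,R); the next section is then the classical theory of
   normal projective Cartan connections. *)
Section AdaptedFrames.
Context {R : realType} {p q : nat} {T : pointedType}.
Local Notation E := 'cV[R]_(p + q).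
Variable A : charted T E.

(* f is a local diffeomorphism from a neighbourhood of 0 mapping TF_0 to TF *)
Definition adapted_germ (f : E -> T) : Prop :=
  let c := pref A (f 0) in
  exists U : set E,
    [/\ open U, U 0, forall z, U z -> cdom c (f z), smooth_on U (coord c \o f) &
      forall z, U z ->
        bijective (fun v : E => 'D_v (coord c \o f) z : E) /\
        (forall v : E, dsubmx v = 0 -> dsubmx ('D_v (coord c \o f) z : E) = 0)].

(* j^r_0(f), as an equivalence class *)
Definition jet (r : nat) (f : E -> T) : set (E -> T) :=
  [set g | [/\ adapted_germ g, g 0 = f 0 &
    let c := pref A (f 0) in jet_eq r (coord c \o f) (coord c \o g)]].

Definition jbase {V : normedModType R} (u : set (V -> T)) : T := (get u) 0.

Definition lin_frame (c : cidx A) (x : E) (a : gl R p q) (Z : E) : T :=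
  param c (x + glmx a *m Z).

Definition LF_param (c : cidx A) (e : E * gl R p q) : set (E -> T) :=
  jet 1 (lin_frame c e.1 e.2).

Definition LF_cod (c : cidx A) : set (E * gl R p q) :=
  [set e | ccod c e.1 /\ isGL e.2].

Definition LF : charted (set (E -> T)) (E * gl R p q)%type :=
  {| cdom := fun c => LF_param c @` LF_cod c;
     ccod := LF_cod;
     coord := fun c u => get [set e | LF_cod c e /\ LF_param c e = u];
     param := LF_param;
     pref := fun u => pref A (jbase u) |}.

(* G c m Z is the vector Gamma^i_{kl}(m) Z^k Z^l in the chart c *)
Variable G : cidx A -> T -> E -> E.

Definition proj_frame (c : cidx A) (x : E) (Z : E) : T :=
  param c (x + Z - 2^-1 *: G c (param c x) Z).

Definition PF : set (set (E -> T)) :=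
  [set u | exists c m h, [/\ cdom c m, isH h &
    u = jet 2 (proj_frame c (coord c m) \o homography h)]].

(* local trivialization of PF by the section x |-> j^2_0(proj_frame c x) *)
Definition PF_param (c : cidx A) (e : pgl R p q) : set (E -> T) :=
  jet 2 (proj_frame c e.1.1 \o homography (e.1.2, e.2, 1)).

Definition PF_cod (c : cidx A) : set (pgl R p q) :=
  [set e | ccod c e.1.1 /\ isGL e.1.2].

Definition PFc : charted (set (E -> T)) (pgl R p q) :=
  {| cdom := fun c => PF_param c @` PF_cod c;
     ccod := PF_cod;
     coord := fun c u => get [set e | PF_cod c e /\ PF_param c e = u];
     param := PF_param;
     pref := fun u => pref A (jbase u) |}.

Definition ract (u : set (E -> T)) (h : gl R p q * 'rV[R]_q * R) :
  set (E -> T) := jet 2 (get u \o homography h).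

(* the fundamental field k^*, i.e. the differential at the identity of
   h |-> u.h *)
Definition fundamental (u : set (E -> T)) (k : gl R p q * 'rV[R]_q) :
    pgl R p q :=
  'D_k (fun h : gl R p q * 'rV[R]_q =>
          coord (pref PFc u) (ract u (glid + h.1, h.2, 1))) 0.

Implicit Type w : set (E -> T) -> pgl R p q -> pgl R p q.

Definition cartan_connection w : Prop :=
  [/\ smooth_form PFc w,
      forall u, PF u -> bijective (w u) /\
        (forall (a : R) X Y, w u (a *: X + Y) = a *: w u X + w u Y),
      forall u h, PF u -> isH h -> forall X,
        w (ract u h) (tmap PFc PFc (ract^~ h) u X) = AdV h (w u X) &
      forall u k, PF u -> w u (fundamental u k) = ((0, k.1), k.2)].

Definition p2 (u : set (E -> T)) : set (E -> T) := jet 1 (get u).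

Definition curvature w u X Y : pgl R p q :=
  dext PFc w u X Y + pgl_bracket (w u X) (w u Y).

End AdaptedFrames.

Section NormalCartan.
Context {R : realType} {p q : nat} {T : pointedType}.
Local Notation E := 'cV[R]_(p + q).
Variables (A : charted T E) (G : cidx A -> T -> E -> E).

(* R^n with the foliation F_0 *)
Let Rn : charted E E := open_charted [set: E].

(* P^1 f : L_{F_0} R^n -> L_F M *)
Definition P1 (f : E -> T) (v : set (E -> E)) : set (E -> T) :=
  jet A 1 (f \o get v).

(* the R^n + gl(n,q,R) part of w is the canonical form:
   (P^1 f)_* theta(X) = p2_* X for u = j^2_0(f) *)
Definition has_canonical_part
    (w : set (E -> T) -> pgl R p q -> pgl R p q) : Prop :=
  forall u f, PF G u -> u f -> forall X,
    tmap (LF Rn) (LF A) (P1 f) (jet Rn 1 id) (w u X).1 =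
    tmap (PFc G) (LF A) (p2 A) u X.

Definition normal_cartan (w : set (E -> T) -> pgl R p q -> pgl R p q) : Prop :=
  [/\ cartan_connection G w,
      has_canonical_part w,
      forall u, PF G u -> forall X Y, (curvature G w u X Y).1.1 = 0 &
      exists K : set (E -> T) -> 'I_(p + q) -> 'I_(p + q) -> 'I_(p + q) ->
                 'I_(p + q) -> R,
      forall u, PF G u ->
        [/\ forall i j k l, K u i j k l = - K u i j l k,
            forall X Y i j,
              glmx (curvature G w u X Y).1.2 i j =
              2^-1 * \sum_k \sum_l K u i j k l *
                ((w u X).1.1 k 0 * (w u Y).1.1 l 0 -
                 (w u Y).1.1 k 0 * (w u X).1.1 l 0) &
            forall (j : 'I_q) (l : 'I_(p + q)),
              \sum_(i < q) K u (rshift p i) (rshift p j) (rshift p i) l = 0]].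

End NormalCartan.

Section NormalFrames.
Context {R : realType} {p q : nat} {T : pointedType}.
Local Notation E := 'cV[R]_(p + q).
Local Notation Eq := 'cV[R]_(0 + q).
Variable A : charted T E.

(* im Tf + TF = TM (direct sum) on a neighbourhood of 0 *)
Definition transverse_germ (f : Eq -> T) : Prop :=
  let c := pref A (f 0) in
  exists U : set Eq,
    [/\ open U, U 0, forall z, U z -> cdom c (f z), smooth_on U (coord c \o f) &
      forall z, U z -> forall w : E, exists! v : Eq,
        dsubmx (w - 'D_v (coord c \o f) z) = 0].

(* J^r_0(f) *)
Definition njet (r : nat) (f : Eq -> T) : set (Eq -> T) :=
  [set g | [/\ transverse_germ g, g 0 = f 0 &
    let y := dsubmx \o coord (pref A (f 0)) in jet_eq r (y \o f) (y \o g)]].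

(* G c m z is the vector Gamma(F)^c_{ab}(m) z^a z^b in the chart c *)
Variable G : cidx A -> T -> 'cV[R]_q -> 'cV[R]_q.

(* the x-coordinates, irrelevant for J^2_0, are kept constant *)
Definition nproj_frame (c : cidx A) (x : E) (z : Eq) : T :=
  param c (x + col_mx 0 (z - 2^-1 *: G c (param c x) z)).

Definition PN : set (set (Eq -> T)) :=
  [set u | exists c m (h : gl R 0 q * 'rV[R]_q * R), [/\ cdom c m, isH h &
    u = njet 2 (nproj_frame c (coord c m) \o homography h)]].

Local Notation EN := (E * gl R 0 q * 'rV[R]_q)%type.

Definition PN_param (c : cidx A) (e : EN) : set (Eq -> T) :=
  njet 2 (nproj_frame c e.1.1 \o homography (e.1.2, e.2, 1)).

Definition PN_cod (c : cidx A) : set EN := [set e | ccod c e.1.1 /\ isGL e.1.2].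

Definition PNc : charted (set (Eq -> T)) EN :=
  {| cdom := fun c => PN_param c @` PN_cod c;
     ccod := PN_cod;
     coord := fun c u => get [set e | PN_cod c e /\ PN_param c e = u];
     param := PN_param;
     pref := fun u => pref A (jbase u) |}.

(* The submersions of the cocycle are f_c = y o coord c : U_c -> N_c, with N_c
   the open subset y(coord c (U_c)) of R^q. *)
Definition leaf_space (c : cidx A) : charted Eq Eq :=
  open_charted (dsubmx @` @ccod _ _ _ A c : set Eq).

Definition leaf_space_christoffel (c : cidx A) (_ : unit) (y z : Eq) : Eq :=
  G c (get [set m | cdom c m /\ dsubmx (coord c m) = y]) z.

Definition to_leaf_space (c : cidx A) (u : set (Eq -> T)) : set (Eq -> Eq) :=
  jet (leaf_space c) 2 ((dsubmx : E -> Eq) \o coord c \o get u).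

(* By construction the image of PN over U_c in P^2 N_c is the reduction defined
   by the same Christoffel symbols. *)
Definition normal_foliated_form
    (w : set (Eq -> T) -> EN -> pgl R 0 q) : Prop :=
  forall c : cidx A,
    exists wc : set (Eq -> Eq) -> pgl R 0 q -> pgl R 0 q,
      @normal_cartan R 0 q Eq (leaf_space c) (leaf_space_christoffel c) wc /\
      forall u, PN u -> cdom c (jbase u) -> forall X,
        w u X = wc (to_leaf_space c u)
          (tmap PNc (PFc (leaf_space_christoffel c : cidx (leaf_space c) -> _))
             (to_leaf_space c) u X).

(* ^F p^2 : j^2_0(f) |-> J^2_0(f o i_q) *)
Definition pF2 (u : set (E -> T)) : set (Eq -> T) :=
  njet 2 (get u \o (fun z : Eq => col_mx 0 z)).

End NormalFrames.

(* A tensor of degree k is given by its components T t, t : seq 'I_n, which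
   vanish unless size t = k. *)
Section Symbols.
Context {R : realType}.

Definition sym_tensor {n : nat} (k : nat) (S : seq 'I_n -> R) : Prop :=
  (forall t, size t != k -> S t = 0) /\
  (forall t t', perm_eq t t' -> S t = S t').

Definition tensor_act {n : nat} (B : 'M[R]_n) (S : seq 'I_n -> R)
    (t : seq 'I_n) : R :=
  \sum_(t' : (size t).-tuple 'I_n)
    (\prod_(ij <- zip t t') B ij.1 ij.2) * S t'.

Context {p q : nat}.
Local Notation E := 'cV[R]_(p + q).
Variable M : foliated_manifold R p q.
Local Notation A := (fatlas M).

Definition symbol_comp (c : cidx A) (s : M -> seq 'I_(p + q) -> R) (m : M) :=
  let c0 := pref A m in
  tensor_act (jac (coord c \o param c0) (coord c0 m)) (s m).

Definition adapted_symbol (k : nat) (s : M -> seq 'I_(p + q) -> R) : Prop :=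
  [/\ forall m, sym_tensor k (s m),
      forall (c : cidx A) t,
        smooth_on (ccod c) (fun e => symbol_comp c s (param c e) t) &
      forall (c : cidx A) (t : seq 'I_q) m m', cdom c m -> cdom c m' ->
        dsubmx (coord c m) = dsubmx (coord c m') ->
        symbol_comp c s m [seq rshift p a | a <- t] =
        symbol_comp c s m' [seq rshift p a | a <- t]].

Definition basic_function (f : M -> R) : Prop :=
  smooth_fun A setT f /\
  forall (c : cidx A) m m', cdom c m -> cdom c m' ->
    dsubmx (coord c m) = dsubmx (coord c m') -> f m = f m'.

(* on basic functions (k = 0) the projection is the identity *)
Definition piF (s : M -> seq 'I_(p + q) -> R) (m : M) (t : seq 'I_q) : R :=
  s m [seq rshift p a | a <- t].

(* components in the frame u of a symbol *)
Definition hatF (s : M -> seq 'I_(p + q) -> R) (u : set (E -> M)) :=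
  let f := get u in
  tensor_act (invmx (jac (coord (pref A (f 0)) \o f) 0)) (s (f 0)).

Definition hatN (s : M -> seq 'I_q -> R) (u : set ('cV[R]_(0 + q) -> M)) :=
  let f := get u in
  tensor_act (invmx (jac ((dsubmx : E -> 'cV[R]_q) \o
                          coord (pref A (f 0)) \o f) 0)) (s (f 0)).

Definition hat0 {V : normedModType R} (f : M -> R) (u : set (V -> M)) : R :=
  f (jbase u).

End Symbols.

(* The operators of PF; those of PN are obtained for p = 0. *)
Section Operators.
Context {R : realType} {p q : nat} {P : Type} {V : normedModType R}.
Local Notation E := 'cV[R]_(p + q).
Variables (C : charted P V) (w : P -> V -> pgl R p q).

(* On PN the form w has a kernel, along which foliated functions are constant;
   any preimage of v may be chosen. *)
Definition wfield (v : E) (u : P) : V := get [set X | w u X = ((v, 0), 0)].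

Definition nabla (v : E) (f : P -> R) : P -> R := lie C (wfield v) f.

Definition nabla_iter (k : nat) (f : P -> R) (v : k.-tuple E) (u : P) : R :=
  (k`!%:R)^-1 * \sum_(s : 'S_k)
    foldr nabla f [seq tnth v (s i) | i <- enum 'I_k] u.

Definition Div (S : P -> seq 'I_(p + q) -> R) (u : P) (t : seq 'I_(p + q)) : R :=
  \sum_(j < q) nabla (ev (rshift p j)) (fun u' => S u' (rshift p j :: t)) u.

(* S^{i_1...i_k} B(e_{i_1},...,e_{i_k}) *)
Definition pairing {n : nat} (k : nat) (S : seq 'I_n -> R)
    (B : k.-tuple 'cV[R]_n -> R) : R :=
  \sum_(t : k.-tuple 'I_n) S t * B (map_tuple ev t).

Definition div_nabla (k l : nat) (S : P -> seq 'I_(p + q) -> R) (f : P -> R)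
    (u : P) : R :=
  pairing (iter l Div S u) (fun v : (k - l).-tuple E => nabla_iter f v u).

Definition Ckl (k l : nat) : R :=
  (\prod_(1 <= i < l.+1) (k - i)%:R) /
  (\prod_(1 <= i < l.+1) (q + 2 * k - i)%:R) * 'C(k, l)%:R.

Definition quant_sum (k : nat) (S : P -> seq 'I_(p + q) -> R) (f : P -> R)
    (u : P) : R :=
  \sum_(l < k.+1) Ckl k l * div_nabla k l S f u.

End Operators.

(* The quantizations are the functions on M whose pullbacks to the frame bundles
   are the given sums. *)
Section Quantization.
Context {R : realType} {p q : nat}.
Variable M : foliated_manifold R p q.
Local Notation A := (fatlas M).

Definition quantF (G : cidx A -> M -> 'cV[R]_(p + q) -> 'cV[R]_(p + q))
    (w : set ('cV[R]_(p + q) -> M) -> pgl R p q -> pgl R p q) (k : nat)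
    (s : M -> seq 'I_(p + q) -> R) (f : M -> R) : M -> R :=
  get [set g : M -> R | forall u, PF G u ->
    hat0 g u = quant_sum (PFc G) w k (hatF s) (hat0 f) u].

Definition quantN (G : cidx A -> M -> 'cV[R]_q -> 'cV[R]_q)
    (w : set ('cV[R]_(0 + q) -> M) ->
         'cV[R]_(p + q) * gl R 0 q * 'rV[R]_q -> pgl R 0 q) (k : nat)
    (s : M -> seq 'I_q -> R) (f : M -> R) : M -> R :=
  get [set g : M -> R | forall u, PN G u ->
    hat0 g u = quant_sum (PNc G) w k (hatN s) (hat0 f) u].

End Quantization.

(* Main.v *)
(** The form [wF] and the form [wN] read in the leaf space of a chart are compared along
    the linear projection [leaf_projection] that drops the coordinates along the leaves.
    On the solder and linear parts this is a computation with second-order frames and the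
    canonical form.  The difference of the two [R^q*]-parts vanishes on vertical vectors,
    and since the linear parts agree, so do the parts [d omega] of the curvatures; the
    transverse Ricci conditions then give a linear system for this difference whose only
    solution is 0 because [q >= 2].  Hence the projection maps [wF]-horizontal fields to
    [wN]-horizontal ones, so each derivative [nabla_v] of the pullback of a foliated
    function is the pullback of its derivative along the transverse part of [v], and is
    again foliated.  The transverse components of an adapted symbol are pulled back from
    the normal bundle, the other ones are only paired with derivatives along leaf
    directions, which vanish: so all terms of the two quantization sums agree. *)
From HB Require Import structures.
Require Import Defs.
From mathcomp Require Import all_boot all_order all_algebra all_fingroup.
From mathcomp Require Import all_classical all_reals all_analysis.
From mathcomp Require Import ring lra.
Import Defs.
Set Implicit Arguments.
Unset Strict Implicit.
Unset Printing Implicit Defensive.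
Import Order.TTheory GRing.Theory Num.Theory numFieldNormedType.Exports.
Local Open Scope classical_set_scope.
Local Open Scope ring_scope.

(** The obstacle is that [wN] has a kernel and that [wfield] picks preimages point by point with
    [get], so that no smooth field on the normal frame bundle is at hand. Derivatives there are
    computed on the frame bundle of the local leaf space of a chart, which carries a genuine Cartan
    connection. That bundle is the case [p = 0] of the adapted frames, so one formula for the
    canonical form, [theta], serves on both sides. This formula projects for two reasons: the linear
    forms of the homographies in the structure group kill leaf directions, and the transverse part
    of the Christoffel form of an adapted connection depends only on transverse arguments and
    transverse coordinates. The trace conditions determine the remaining part only for [q >= 2]: on
    a lifted basis they read [q * delta_ij = delta_ji], which is empty when [q = 1]. The
    quantizations are chosen by [get] in sets of functions on [M]. They agree because the two sets
    are equal, every normal frame being the restriction of an adapted one. *)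

(** * Differential calculus in finite dimension *)

(* A basis with continuous coordinates: linear maps are then continuous without an
   equivalence-of-norms argument. *)
Class findim (R : realType) (V : normedModType R) : Prop :=
  findimP : exists (I : finType) (b : I -> V) (l : I -> {linear V -> R}),
    (forall i, continuous (l i : V -> R)) /\ forall v, v = \sum_i l i v *: b i.

Section FinDim.
Context {R : realType}.
Implicit Types V W : normedModType R.

Lemma linear_pack V W (f : V -> W) : linear f -> {g : {linear V -> W} | f = g}.
Proof.
move=> l; pose g : {linear V -> W} :=
  HB.pack f (GRing.isLinear.Build _ _ _ _ f l).
by exists g.
Qed.

Lemma findim_linear_continuous V W {fV : findim V} (f : V -> W) :
  linear f -> continuous f.
Proof.
move=> /linear_pack[{}f ->].
have [I [b [l [lc vE]]]] := fV.
have -> : (f : V -> W) = (fun v => \sum_i l i v *: f (b i)).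
  apply/funext => v; rewrite {1}(vE v) linear_sum.
  by apply: eq_bigr => i _; rewrite linearZ.
move=> x; apply: cvg_big => [|i _]; first exact: add_continuous.
by apply: cvgZr_tmp; apply: lc.
Qed.

Global Instance findim_R : findim (R : normedModType R).
Proof.
exists unit, (fun=> 1), (fun=> idfun); split=> [_ x|v]; first exact: cvg_id.
by rewrite (big_pred1 tt) /= ?[_ *: _]mulr1//; case.
Qed.

Global Instance findim_mx m n : findim 'M[R]_(m, n).
Proof.
have h (ij : 'I_m * 'I_n) : {f : {linear 'M[R]_(m, n) -> R} |
    (fun M : 'M[R]_(m, n) => M ij.1 ij.2 : R) = f}.
  by apply: linear_pack => a x y; rewrite !mxE.
exists ('I_m * 'I_n)%type, (fun k => delta_mx k.1 k.2), (fun k => sval (h k)).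
split=> [k|v]; first by rewrite -(svalP (h k)); exact: coord_continuous.
under eq_bigr do rewrite -(svalP (h _)).
rewrite {1}(matrix_sum_delta v).
by rewrite (pair_big xpredT xpredT (fun i j => v i j *: delta_mx i j)).
Qed.

Global Instance findim_prod V W {fV : findim V} {fW : findim W} :
  findim (V * W : normedModType R)%type.
Proof.
have [I [b [l [lc vE]]]] := fV; have [J [c [m [mc wE]]]] := fW.
have h1 (i : I) : {f : {linear (V * W)%type -> R} | (fun p : V * W => l i p.1) = f}.
  by apply: linear_pack => a x y; rewrite linearP.
have h2 (j : J) : {f : {linear (V * W)%type -> R} | (fun p : V * W => m j p.2) = f}.
  by apply: linear_pack => a x y; rewrite linearP.
exists (I + J)%type,
  (fun k => match k with inl i => (b i, 0) | inr j => (0, c j) end),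
  (fun k => match k with inl i => sval (h1 i) | inr j => sval (h2 j) end).
split=> [[i|j]|[v w]].
- rewrite -(svalP (h1 i)) => x.
  by apply: continuous_comp; [exact: cvg_fst|exact: lc].
- rewrite -(svalP (h2 j)) => x.
  by apply: continuous_comp; [exact: cvg_snd|exact: mc].
- rewrite big_sumType /=.
  under eq_bigr do rewrite -(svalP (h1 _)) /=.
  under [X in _ + X]eq_bigr do rewrite -(svalP (h2 _)) /=.
  have -> : \sum_(i : I) l i v *: (b i, 0) = (v, 0) :> (V * W)%type.
    rewrite {2}(vE v); apply/esym; elim/big_ind2: _ => //.
    + by move=> x1 x2 y1 y2 <- <-; rewrite [RHS]surjective_pairing /= addr0.
    + by move=> i _; rewrite [RHS]surjective_pairing /= scaler0.
  have -> : \sum_(j : J) m j w *: (0, c j) = (0, w) :> (V * W)%type.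
    rewrite {2}(wE w); apply/esym; elim/big_ind2: _ => //.
    + by move=> x1 x2 y1 y2 <- <-; rewrite [RHS]surjective_pairing /= addr0.
    + by move=> i _; rewrite [RHS]surjective_pairing /= scaler0.
  by rewrite [RHS]surjective_pairing /= addr0 add0r.
Qed.

End FinDim.

Lemma sum_enum_val (Z : nmodType) (I : finType) (F : I -> Z) :
  \sum_i F i = \sum_(k < #|I|) F (enum_val k).
Proof.
rewrite (reindex (enum_val : 'I_#|I| -> I)) //.
exact: onW_bij (@enum_val_bij I).
Qed.

Section Derivatives.
Context {R : realType}.
Implicit Types V W X : normedModType R.

Lemma linear_diff V W {fV : findim V} (f : V -> W) x :
  linear f -> differentiable f x.
Proof.
move=> lf; have cf : continuous f by exact: findim_linear_continuous.
have [g fg] := linear_pack lf; rewrite fg in cf *.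
exact: linear_differentiable.
Qed.

Lemma linear_derive V W {fV : findim V} (f : V -> W) x v :
  linear f -> 'D_v f x = f v.
Proof.
move=> lf; rewrite deriveE; last exact: linear_diff.
have cf : continuous f by exact: findim_linear_continuous.
by have [g fg] := linear_pack lf; rewrite fg in cf *; rewrite diff_lin.
Qed.

Lemma derive_comp V W X (F : V -> W) (G : W -> X) x v :
  differentiable F x -> differentiable G (F x) ->
  'D_v (G \o F) x = 'D_('D_v F x) G (F x).
Proof.
move=> dF dG; rewrite deriveE; last exact: differentiable_comp.
by rewrite diff_comp //= !deriveE.
Qed.

Lemma derive_linear V W X {fW : findim W} (L : W -> X) (F : V -> W) x v :
  linear L -> differentiable F x -> 'D_v (fun y => L (F y)) x = L ('D_v F x).
Proof.
move=> lL dF; rewrite (derive_comp v dF); first exact: linear_derive.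
exact: linear_diff.
Qed.

Lemma derive_is_linear V W (F : V -> W) x :
  differentiable F x -> linear (fun v => 'D_v F x).
Proof. by move=> dF a u v; rewrite !deriveE// linearP. Qed.

(** The difference quotients of the two sides are the same function of [h], before any limit is
    taken; likewise in [derive_precomp]. *)
Lemma derive_affine V W X (L : V -> W) (c : W) (G : W -> X) x v :
  linear L -> 'D_v (fun y => G (c + L y)) x = 'D_(L v) G (c + L x).
Proof.
move=> lL; rewrite /derive.
have -> // : (fun h : R => h^-1 *: (G (c + L (h *: v + x)) - G (c + L x))) =
    (fun h => h^-1 *: (G (h *: L v + (c + L x)) - G (c + L x))).
by apply/funext => h; rewrite lL addrCA.
Qed.

Lemma derive_precomp V W X (L : V -> W) (G : W -> X) x v :
  linear L -> 'D_v (fun y => G (L y)) x = 'D_(L v) G (L x).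
Proof.
move=> lL; rewrite /derive.
have -> // : (fun h : R => h^-1 *: (G (L (h *: v + x)) - G (L x))) =
    (fun h => h^-1 *: (G (h *: L v + L x) - G (L x))).
by apply/funext => h; rewrite lL.
Qed.

(** Reduces to real values, where the mean value theorem applies: [F] is a finite sum of its
    coordinates times basis vectors. *)
Lemma differentiableE V W (F : V -> W) x {fW : findim W} :
  (forall l : {linear W -> R}, differentiable (fun y => l (F y)) x) ->
  differentiable F x.
Proof.
move=> dF; have [I [b [l [lc vE]]]] := fW.
have -> : F = \sum_(i < #|I|) (fun y => l (enum_val i) (F y) *: b (enum_val i)).
  apply/funext => y; rewrite fct_sumE {1}(vE (F y)) /=.
  by rewrite sum_enum_val.
by apply: differentiable_sum => i; exact: differentiableZl.
Qed.

Lemma differentiable_mx V m n (F : V -> 'M[R]_(m, n)) x :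
  (forall i j, differentiable (fun y => F y i j) x) -> differentiable F x.
Proof.
move=> dF; apply: differentiableE => l.
have -> : (fun y => l (F y)) =
    \sum_(k < #|{: 'I_m * 'I_n}|) (fun y => F y (enum_val k).1 (enum_val k).2 *:
       l (delta_mx (enum_val k).1 (enum_val k).2)).
  apply/funext => y; rewrite fct_sumE {1}(matrix_sum_delta (F y)) pair_bigA /=.
  rewrite linear_sum sum_enum_val.
  by apply: eq_bigr => k _; rewrite linearZ.
by apply: differentiable_sum => i; exact: differentiableZl.
Qed.

Lemma differentiableZlr V W (k : V -> R) (F : V -> W) x {fW : findim W} :
  differentiable k x -> differentiable F x ->
  differentiable (fun y => k y *: F y) x.
Proof.
move=> dk dF; apply: differentiableE => l.
have -> : (fun y => l (k y *: F y)) = k * (fun y => l (F y)).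
  by apply/funext => y; rewrite linearZ.
apply: differentiableM => //; apply: differentiable_comp => //.
exact: linear_diff (linearP l).
Qed.

Lemma derive_mxE V m n (F : V -> 'M[R]_(m, n)) x v i j :
  derivable F x v -> ('D_v F x) i j = 'D_v (fun y => F y i j) x.
Proof. by move=> dF; rewrite derive_mx// mxE. Qed.

Lemma derive_pair V W X (F : V -> W) (G : V -> X) x v :
  differentiable F x -> differentiable G x ->
  'D_v (fun y => (F y, G y)) x = ('D_v F x, 'D_v G x).
Proof.
move=> dF dG; rewrite deriveE; last exact: differentiable_pair.
by rewrite diff_pair// !deriveE.
Qed.

Lemma deriveZlr V W {fW : findim W} (k : V -> R) (F : V -> W) x v :
  differentiable k x -> differentiable F x ->
  'D_v (fun y => k y *: F y) x = 'D_v k x *: F x + k x *: 'D_v F x.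
Proof.
move=> dk dF; have dkF : differentiable (fun y => k y *: F y) x.
  exact: differentiableZlr.
have [I [b [l [lc vE]]]] := fW.
rewrite [LHS]vE [RHS]vE; apply: eq_bigr => i _; congr (_ *: _).
rewrite -(derive_linear _ (linearP (l i)) dkF).
rewrite linearD !linearZ /= -(derive_linear _ (linearP (l i)) dF).
have -> : (fun y => l i (k y *: F y)) = k * (fun y => l i (F y)).
  by apply/funext => y; rewrite linearZ.
have dlF : differentiable (fun y => l i (F y)) x.
  by apply: differentiable_comp => //; exact: linear_diff (linearP _).
rewrite deriveM; [|exact: diff_derivable..].
by rewrite addrC; congr (_ + _); rewrite [LHS]mulrC.
Qed.

Lemma deriveDf V W (F G : V -> W) x v :
  differentiable F x -> differentiable G x ->
  'D_v (fun y => F y + G y) x = 'D_v F x + 'D_v G x.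
Proof. by move=> dF dG; rewrite -deriveD //; exact: diff_derivable. Qed.

Lemma deriveBf V W (F G : V -> W) x v :
  differentiable F x -> differentiable G x ->
  'D_v (fun y => F y - G y) x = 'D_v F x - 'D_v G x.
Proof. by move=> dF dG; rewrite -deriveB //; exact: diff_derivable. Qed.

Lemma derive_sumf V W (I : finType) (F : I -> V -> W) x v :
  (forall i, differentiable (F i) x) ->
  differentiable (fun y => \sum_i F i y) x /\
  'D_v (fun y => \sum_i F i y) x = \sum_i 'D_v (F i) x.
Proof.
move=> dF.
have -> : (fun y => \sum_i F i y) = \sum_(i < #|I|) F (enum_val i).
  apply/funext => y; rewrite fct_sumE.
  by rewrite [LHS]sum_enum_val.
split; first by apply: differentiable_sum => i; exact: dF.
rewrite derive_sum; last by move=> i; exact/diff_derivable/dF.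
by rewrite [RHS]sum_enum_val.
Qed.

(** Either sign of [t] is allowed and [c] is only bounded in absolute value, because the increments
    in [C1_expansion] are coordinates of an arbitrary vector. *)
Lemma line_MVT V (G : V -> R) y b (t : R) :
  (forall s : R, `|s| <= `|t| -> derivable G (y + s *: b) b) ->
  exists2 c, `|c| <= `|t| & G (y + t *: b) - G y = t * 'D_b G (y + c *: b).
Proof.
move=> dG.
have dg (s : R) : `|s| <= `|t| ->
    is_derive s (1 : R) (fun s : R => G (y + s *: b)) ('D_b G (y + s *: b)).
  move=> /dG dGs.
  have E : (fun h : R => h^-1 *: (G (y + (h *: (1:R) + s) *: b) - G (y + s *: b)))
      = (fun h => h^-1 *: (G (h *: b + (y + s *: b)) - G (y + s *: b))).
    apply/funext => h; congr (_ *: (G _ - _)).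
    by rewrite [h *: 1]mulr1 scalerDl addrCA.
  by apply: DeriveDef; [rewrite /derivable E|rewrite /derive E].
have cg (a c : R) : {in `[a, c]%R, forall s, `|s| <= `|t|} ->
    {within `[a, c], continuous (fun s : R => G (y + s *: b))}.
  move=> ac; apply: derivable_within_continuous => s /ac/dg.
  by move=> ?; exact: ex_derive.
have [t0|t0|<-] := ltgtP 0 t; last first.
- by exists 0; rewrite ?normr0// scale0r addr0 subrr mul0r.
- have h s : s \in `[t, 0]%R -> `|s| <= `|t|.
    by rewrite in_itv /= => /andP[h1 h2]; rewrite !ler0_norm//; lra.
  have [s /subset_itv_oo_cc ss] := MVT t0
    (fun x xi => dg x (h x (subset_itv_oo_cc xi))) (cg _ _ h).
  rewrite scale0r addr0 sub0r => E.
  exists s; first exact: h.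
  by rewrite -opprB E mulrN opprK mulrC.
- have h s : s \in `[0, t]%R -> `|s| <= `|t|.
    by rewrite in_itv /= => /andP[h1 h2]; rewrite !ger0_norm//; lra.
  have [s /subset_itv_oo_cc ss] := MVT t0
    (fun x xi => dg x (h x (subset_itv_oo_cc xi))) (cg _ _ h).
  rewrite scale0r addr0 subr0 => E.
  by exists s; [exact: h|rewrite E mulrC].
Qed.

End Derivatives.

(** * Differentiability of maps with continuous directional derivatives *)

Section C1.
Context {R : realType}.
Implicit Types V W X : normedModType R.

Lemma derivable_linear V W X {fW : findim W} (L : W -> X) (F : V -> W) x v :
  linear L -> derivable F x v ->
  derivable (fun y => L (F y)) x v /\
  'D_v (fun y => L (F y)) x = L ('D_v F x).
Proof.
move=> lL dF; have cL : continuous L by exact: findim_linear_continuous.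
have [g Lg] := linear_pack lL.
have -> : (fun y => L (F y)) = g \o F by rewrite Lg.
have E : (fun h : R => h^-1 *: (g (F (h *: v + x)) - g (F x))) =
    g \o (fun h : R => h^-1 *: (F (h *: v + x) - F x)).
  by apply/funext => h; rewrite [RHS]linearZ_LR [in RHS]linearB.
have H : (fun h : R => h^-1 *: (g (F (h *: v + x)) - g (F x))) @ 0^' -->
    g ('D_v F x).
  by rewrite E; apply: continuous_cvg; [rewrite -Lg; exact: cL|exact: dF].
by split; [apply/cvg_ex; eexists; exact: H|rewrite Lg; exact: cvg_lim H].
Qed.

(** One coordinate of [h] is changed at a time, the mean value theorem controlling each change; the
    induction runs over the list of coordinates already changed. *)
Lemma C1_expansion V (U : set V) (F : V -> R) x (I : eqType) (b : I -> V)
    (l : I -> {linear V -> R}) (r : seq I) :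
  open U -> U x -> (forall y v, U y -> derivable F y v) ->
  (forall v, {for x, continuous (fun y => 'D_v F y)}) ->
  (forall i, continuous (l i : V -> R)) ->
  forall eps : R, 0 < eps -> \forall h \near (0 : V),
    `|F (x + \sum_(i <- r) l i h *: b i) - F x
      - \sum_(i <- r) l i h * 'D_(b i) F x| <= eps * `|h|.
Proof.
move=> oU Ux dF cF cl; elim: r => [eps e0|i r IH eps e0].
  near=> h; rewrite !big_nil addr0 subrr subr0 normr0.
  by rewrite mulr_ge0// ltW.
have [K K0 Kl] := linear_lipschitz (cl i).
(* Half of [eps] goes to the induction. The other half is divided by the Lipschitz constant [K] of
   the coordinate [l i], which multiplies the variation of the derivative. *)
have e20 : 0 < eps / 2 by rewrite divr_gt0.
have eK : 0 < eps / 2 / K by rewrite divr_gt0.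
have /nbhs_ballP[d /= d0 dP] : \forall y \near x,
    U y /\ `|'D_(b i) F x - 'D_(b i) F y| <= eps / 2 / K.
  near=> y; split; first by near: y; exact: open_nbhs_nbhs.
  near: y; move/cvgrPdist_le : (cF (b i)); exact.
have csr : continuous (fun h => \sum_(i <- r) l i h *: b i).
  move=> h; apply: cvg_big => [|j _]; first exact: add_continuous.
  by apply: cvgZr_tmp; apply: cl.
have d20 : 0 < d / 2 by rewrite divr_gt0.
(* Adding 1 keeps the factor positive when [b i = 0]. *)
have M0 : 0 < K * (`|b i| + 1) by rewrite mulr_gt0// ltr_wpDl.
near=> h.
have hsr : `|\sum_(i <- r) l i h *: b i| < d / 2.
  near: h; move/cvgrPdist_lt : (csr 0) => /(_ _ d20).
  rewrite big1 => [|j _]; last by rewrite linear0 scale0r.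
  by apply: filterS => h; rewrite sub0r normrN.
have hli (c : R) : `|c| <= `|l i h| -> `|c *: b i| < d / 2.
  move=> ch; rewrite normrZ; apply: (@le_lt_trans _ _ (K * `|h| * (`|b i| + 1))).
    by rewrite ler_pM// ?lerDl// (le_trans ch).
  rewrite mulrAC -ltr_pdivlMl//; near: h.
  have : 0 < (K * (`|b i| + 1))^-1 * (d / 2) by rewrite mulr_gt0// invr_gt0.
  by move=> H; exact: (@nbhs0_lt _ V _ H).
have in_ball (c : R) : `|c| <= `|l i h| ->
    ball x d (x + \sum_(i <- r) l i h *: b i + c *: b i).
  move=> ch; rewrite -ball_normE /ball_ /= -addrA opprD addNKr normrN.
  by rewrite (splitr d) (le_lt_trans (ler_normD _ _))// ltrD// hli.
have [c ch cE] := line_MVT (G := F) (y := x + \sum_(i <- r) l i h *: b i)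
  (b := b i) (t := l i h) (fun s sh => dF _ _ (dP _ (in_ball _ sh)).1).
rewrite !big_cons addrA (addrAC x) opprD.
have -> : F (x + \sum_(j <- r) l j h *: b j + l i h *: b i) - F x +
  (- (l i h * 'D_(b i) F x) - \sum_(j <- r) l j h * 'D_(b j) F x) =
  l i h * ('D_(b i) F (x + \sum_(j <- r) l j h *: b j + c *: b i) - 'D_(b i) F x)
  + (F (x + \sum_(j <- r) l j h *: b j) - F x
     - \sum_(j <- r) l j h * 'D_(b j) F x).
  by rewrite mulrBr -cE; ring.
rewrite (splitr eps) mulrDl (le_trans (ler_normD _ _))// lerD//; last first.
  by near: h; exact: IH.
rewrite normrM distrC (le_trans (ler_pM _ _ (Kl h) (dP _ (in_ball _ ch)).2))//.
by rewrite mulrC mulrA divfK// gt_eqF.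
Unshelve. all: by end_near. Qed.

Lemma C1_differentiable V W {fV : findim V} {fW : findim W} (U : set V)
    (F : V -> W) x :
  open U -> U x -> (forall y v, U y -> derivable F y v) ->
  (forall v, {for x, continuous (fun y => 'D_v F y)}) ->
  differentiable F x.
Proof.
move=> oU Ux dF cF; apply: differentiableE => L.
have dLF y v : U y -> derivable (fun y => L (F y)) y v /\
    'D_v (fun y => L (F y)) y = L ('D_v F y).
  by move=> Uy; exact: derivable_linear (linearP L) (dF _ _ Uy).
have cL : continuous L by apply: findim_linear_continuous; exact: linearP.
have cLF v : {for x, continuous (fun y => 'D_v (fun y => L (F y)) y)}.
  have : {for x, continuous (L \o (fun y => 'D_v F y))}.
    by apply: continuous_comp; [exact: cF|exact: cL].
  rewrite /prop_for /continuous_at /= -(dLF x v Ux).2; apply: cvg_trans.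
  apply: near_eq_cvg; near=> y; apply/esym; apply: (dLF _ _ _).2.
  by near: y; exact: open_nbhs_nbhs.
move: (fun y => L (F y)) dLF cLF => G dG cG.
have [I [b [l [lc vE]]]] := fV.
pose D h := \sum_i l i h * 'D_(b i) G x.
have lD : linear D.
  move=> a u v; rewrite /D scaler_sumr -big_split; apply: eq_bigr => i _ /=.
  by rewrite linearP mulrDl -scalerAl.
have [D' D'E] := linear_pack lD.
have cD : continuous D' by rewrite -D'E; exact: findim_linear_continuous.
have E : G \o shift x = cst (G x) + D' +o_ (0 : V) id.
  apply/eqaddoP => eps e0.
  have := C1_expansion b (index_enum I) oU Ux
    (fun y v Uy => (dG y v Uy).1) cG lc e0.
  apply: filterS => h; rewrite -(vE h) => H.
  have -> : (G \o shift x - (cst (G x) + D')) h = G (x + h) - G x - D h.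
    rewrite D'E -[LHS]/(G (h + x) - (G x + D' h)).
    by rewrite opprD addrA (addrC h).
  exact: H.
by apply/diff_locallyP; rewrite (diff_unique cD E).
Unshelve. all: by end_near. Qed.

End C1.

(** * Maps differentiable to a given order *)

Section Diffk.
Context {R : realType}.
Implicit Types V W X : normedModType R.

(* Frechet differentiability of the iterated directional derivatives is easier to
   propagate than the continuity required by [Ck]; [smooth_onP] shows that for all [k] at
   once both mean the same. *)
Fixpoint diffk {V W} (k : nat) (U : set V) (F : V -> W) : Prop :=
  (forall x, U x -> differentiable F x) /\
  match k with
  | 0 => True
  | k'.+1 => forall v, diffk k' U (fun x => 'D_v F x)
  end.

Definition diff_infty {V W} (U : set V) (F : V -> W) := forall k, diffk k U F.

Lemma diffk_diff V W k (U : set V) (F : V -> W) x :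
  diffk k U F -> U x -> differentiable F x.
Proof. by case: k => [|k] [dF _] Ux; exact: dF. Qed.

Lemma diffoo_diff V W (U : set V) (F : V -> W) x :
  diff_infty U F -> U x -> differentiable F x.
Proof. by move=> /(_ 0%N); exact: diffk_diff. Qed.

Lemma diffoo_D V W (U : set V) (F : V -> W) v :
  diff_infty U F -> diff_infty U (fun x => 'D_v F x).
Proof. by move=> sF k; have [_] := sF k.+1; exact. Qed.

Lemma diffkS V W k (U : set V) (F : V -> W) : diffk k.+1 U F -> diffk k U F.
Proof.
elim: k F => [|k IH] F [dF DF]; first by split.
by split=> // v; apply: IH; exact: DF.
Qed.

Lemma diffk_sub V W k (U U' : set V) (F : V -> W) :
  U' `<=` U -> diffk k U F -> diffk k U' F.
Proof.
move=> sU; elim: k F => [|k IH] F [dF DF]; split=> //; try by move=> x /sU/dF.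
by move=> v; apply: IH; exact: DF.
Qed.

Lemma differentiable_ext V W (U : set V) (F G : V -> W) x :
  open U -> U x -> {in U, F =1 G} -> differentiable F x -> differentiable G x.
Proof.
move=> oU Ux FG /diff_locallyP[cd E].
have FGx : F x = G x by apply: FG; exact: mem_set.
have [d dE] : exists d : {linear V -> W}, d = 'd F x by exists ('d F x).
have E' : G \o shift x = cst (G x) + 'd F x +o_ (0 : V) id.
  apply/eqaddoP => eps e0.
  move/eqaddoP : E => /(_ _ e0) E.
  have : \forall h \near (0 : V), U (h + x).
    have := open_nbhs_nbhs (conj oU Ux); rewrite -[X in nbhs X](add0r x) => Un.
    have : continuous (fun h : V => h + x).
      by move=> h; apply: continuousD; [exact: cvg_id|exact: cvg_cst].
    by move=> /(_ 0); exact.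
  apply: filterS2 E => h + Uh.
  have -> : (F \o shift x - (cst (F x) + 'd F x)) h =
      F (h + x) - (F x + 'd F x h) by [].
  have -> : (G \o shift x - (cst (G x) + 'd F x)) h =
      G (h + x) - (G x + 'd F x h) by [].
  by rewrite FGx (FG (h + x) (mem_set Uh)).
apply/diff_locallyP; rewrite (diff_unique cd E'); split => //.
Qed.

Lemma derive_ext V W (U : set V) (F G : V -> W) x v :
  open U -> U x -> {in U, F =1 G} -> 'D_v F x = 'D_v G x.
Proof.
move=> oU Ux FG; apply: near_eq_derive.
near=> y; apply: FG; apply: mem_set; near: y; exact: open_nbhs_nbhs.
Unshelve. all: by end_near. Qed.

Lemma diffk_ext V W k (U : set V) (F G : V -> W) :
  open U -> {in U, F =1 G} -> diffk k U F -> diffk k U G.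
Proof.
move=> oU; elim: k F G => [|k IH] F G FG [dF DF]; split=> //.
- by move=> x Ux; apply: differentiable_ext FG _; last exact: dF.
- by move=> x Ux; apply: differentiable_ext FG _; last exact: dF.
- move=> v; apply: IH (DF v) => x xU.
  exact: derive_ext oU (set_mem xU) FG.
Qed.

Lemma diffk_cst V W k (U : set V) (a : W) : diffk k U (fun=> a).
Proof.
elim: k a => [|k IH] a; split=> //; try by move=> x _; exact: differentiable_cst.
move=> v; have -> : (fun x : V => 'D_v (fun=> a) x) = (fun=> 0).
  by apply/funext => x; rewrite derive_cst.
exact: IH.
Qed.

Lemma diffk_lin V W {fV : findim V} k (U : set V) (L : V -> W) :
  linear L -> diffk k U L.
Proof.
move=> lL; case: k => [|k]; split=> //; try by move=> x _; exact: linear_diff.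
move=> v; have -> : (fun x : V => 'D_v L x) = (fun=> L v).
  by apply/funext => x; rewrite linear_derive.
exact: diffk_cst.
Qed.

Lemma diffk_linear V W X {fW : findim W} k (U : set V) (L : W -> X) (F : V -> W) :
  open U -> linear L -> diffk k U F -> diffk k U (fun x => L (F x)).
Proof.
move=> oU lL.
have H G : (forall x, U x -> differentiable G x) -> forall x, U x ->
    differentiable (fun x => L (G x)) x.
  by move=> dG x Ux; apply: differentiable_comp (dG _ Ux) _; exact: linear_diff.
elim: k F => [|k IH] F [dF DF]; split; rewrite //; try exact: H.
move=> v; apply: diffk_ext (IH _ (DF v)) => // x xU.
by rewrite derive_linear//; apply: dF; exact: set_mem.
Qed.

Lemma diffkD V W k (U : set V) (F G : V -> W) :
  open U -> diffk k U F -> diffk k U G -> diffk k U (fun x => F x + G x).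
Proof.
move=> oU; elim: k F G => [|k IH] F G [dF DF] [dG DG]; split=> //.
- by move=> x Ux; apply: differentiableD; [exact: dF|exact: dG].
- by move=> x Ux; apply: differentiableD; [exact: dF|exact: dG].
- move=> v; apply: diffk_ext (IH _ _ (DF v) (DG v)) => // x xU.
  by rewrite deriveDf//; [apply: dF|apply: dG]; exact: set_mem.
Qed.

Lemma diffk_sum V W (I : Type) (r : seq I) (P : pred I) k (U : set V)
    (F : I -> V -> W) : open U -> (forall i, P i -> diffk k U (F i)) ->
  diffk k U (fun x => \sum_(i <- r | P i) F i x).
Proof.
move=> oU dF; elim: r => [|i r IH].
  by apply: diffk_ext (diffk_cst k U 0) => // x _; rewrite big_nil.
case Pi : (P i); last first.
  by apply: diffk_ext IH => // x _; rewrite big_cons Pi.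
apply: diffk_ext (diffkD oU (dF i Pi) IH) => // x _.
by rewrite big_cons Pi.
Qed.

Lemma diffk_sumf V W (I : finType) k (U : set V) (F : I -> V -> W) :
  open U -> (forall i, diffk k U (F i)) -> diffk k U (fun x => \sum_i F i x).
Proof. by move=> oU dF; exact: (diffk_sum (index_enum I) oU (fun i _ => dF i)). Qed.

Lemma diffkZ V W {fW : findim W} k (U : set V) (a : V -> R) (F : V -> W) :
  open U -> diffk k U a -> diffk k U F -> diffk k U (fun x => a x *: F x).
Proof.
move=> oU; elim: k a F => [|k IH] a F da dF.
  split=> // x Ux; apply: differentiableZlr; [exact: da.1|exact: dF.1].
split=> [x Ux|v].
  by apply: differentiableZlr; [exact: da.1|exact: dF.1].
have h1 := IH _ _ (da.2 v) (diffkS dF); have h2 := IH _ _ (diffkS da) (dF.2 v).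
apply: diffk_ext (diffkD oU h1 h2) => // x xU.
by rewrite deriveZlr//; [apply: da.1|apply: dF.1]; exact: set_mem.
Qed.

Lemma diffkM V k (U : set V) (a b : V -> R) :
  open U -> diffk k U a -> diffk k U b -> diffk k U (fun x => a x * b x).
Proof. by move=> oU da db; exact: (diffkZ oU da db). Qed.

Lemma diffkN V W {fW : findim W} k (U : set V) (F : V -> W) :
  open U -> diffk k U F -> diffk k U (fun x => - F x).
Proof.
move=> oU dF; apply: diffk_ext (diffkZ oU (diffk_cst k U (-1 : R)) dF) => // x _.
by rewrite scaleN1r.
Qed.

Lemma diffk_prod V (I : Type) (r : seq I) (P : pred I) k (U : set V)
    (F : I -> V -> R) : open U -> (forall i, P i -> diffk k U (F i)) ->
  diffk k U (fun x => \prod_(i <- r | P i) F i x).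
Proof.
move=> oU dF; elim: r => [|i r IH].
  by apply: diffk_ext (diffk_cst k U (1 : R)) => // x _; rewrite big_nil.
case Pi : (P i); last first.
  by apply: diffk_ext IH => // x _; rewrite big_cons Pi.
apply: diffk_ext (diffkM oU (dF i Pi) IH) => // x _.
by rewrite big_cons Pi.
Qed.

Lemma derive_inv V (a : V -> R) x v : a x != 0 -> differentiable a x ->
  differentiable (fun y => (a y)^-1) x /\
  'D_v (fun y => (a y)^-1) x = - ((a x)^-1 * (a x)^-1 * 'D_v a x).
Proof.
move=> ax da; split; first exact: differentiableV.
rewrite deriveV//; last exact: diff_derivable.
by rewrite [LHS]scaleNr expr2 invfM.
Qed.

Lemma diffkV V k (U : set V) (a : V -> R) : open U ->
  (forall x, U x -> a x != 0) -> diffk k U a -> diffk k U (fun x => (a x)^-1).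
Proof.
move=> oU a0; elim: k => [|k IH] da.
  by split=> // x Ux; have [] := derive_inv 0 (a0 _ Ux) (da.1 _ Ux).
split=> [x Ux|v]; first by have [] := derive_inv 0 (a0 _ Ux) (da.1 _ Ux).
have h := IH (diffkS da).
apply: diffk_ext (diffkN oU (diffkM oU (diffkM oU h h) (da.2 v))) => // x xU.
have Ux := set_mem xU.
by have [_ ->] := derive_inv v (a0 _ Ux) (da.1 _ Ux).
Qed.

(** The chain rule differentiates [G] in a direction that varies with [x]. Expanding this direction
    in a basis leaves products of its coordinates with compositions of the fixed derivatives
    ['D_(b i) G], to which the induction applies. *)
Lemma diffk_comp V W X {fW : findim W} {fX : findim X} k (U : set V) (U' : set W)
    (F : V -> W) (G : W -> X) :
  open U -> open U' -> (forall x, U x -> U' (F x)) ->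
  diffk k U F -> diffk k U' G -> diffk k U (fun x => G (F x)).
Proof.
move=> oU oU' FU; have [I [b [l [lc vE]]]] := fW.
have H (G0 : W -> X) : (forall x, U x -> differentiable F x) ->
    (forall y, U' y -> differentiable G0 y) ->
    forall x, U x -> differentiable (fun x => G0 (F x)) x.
  move=> dF dG x Ux; apply: (differentiable_comp (g := G0)); first exact: dF.
  exact/dG/FU.
elim: k G => [|k IH] G dF dG; first by split=> //; apply: H; [exact: dF.1|exact: dG.1].
split=> [|v]; first by apply: H; [exact: dF.1|exact: dG.1].
have h i : diffk k U (fun x => l i ('D_v F x) *: 'D_(b i) G (F x)).
  apply: diffkZ => //; last first.
    by apply: (IH (fun y => 'D_(b i) G y)); [exact: diffkS|exact: dG.2].
  by apply: (diffk_linear oU (linearP (l i))); exact: dF.2.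
apply: diffk_ext (diffk_sum (index_enum I) oU (fun i _ => h i)) => // x xU.
have Ux := set_mem xU.
rewrite [RHS](derive_comp _ (dF.1 _ Ux) (dG.1 _ (FU _ Ux))).
have dGx : differentiable G (F x) by exact/dG.1/FU.
rewrite [in RHS](vE ('D_v F x)) [RHS]deriveE// linear_sum.
by apply: eq_bigr => i _; rewrite linearZ [in LHS](deriveE _ dGx).
Qed.

Lemma diffk_mx V m n k (U : set V) (F : V -> 'M[R]_(m, n)) : open U ->
  (forall i j, diffk k U (fun x => F x i j)) -> diffk k U F.
Proof.
move=> oU; elim: k F => [|k IH] F dF.
  by split=> // x Ux; apply: differentiable_mx => i j; exact: (dF i j).1.
have dF0 x : U x -> differentiable F x.
  by move=> Ux; apply: differentiable_mx => i j; exact: (dF i j).1.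
split=> // v; apply: IH => i j.
apply: diffk_ext ((dF i j).2 v) => // x xU.
by rewrite derive_mxE//; apply: diff_derivable; exact/dF0/set_mem.
Qed.

Lemma linear_mxE m n i j : linear (fun M : 'M[R]_(m, n) => M i j : R).
Proof. by move=> a x y; rewrite !mxE. Qed.

Lemma diffk_mxE V m n k (U : set V) (F : V -> 'M[R]_(m, n)) i j : open U ->
  diffk k U F -> diffk k U (fun x => F x i j).
Proof. by move=> oU dF; exact: (diffk_linear oU (@linear_mxE m n i j) dF). Qed.

Lemma diffk_pair V W X k (U : set V) (F : V -> W) (G : V -> X) : open U ->
  diffk k U F -> diffk k U G -> diffk k U (fun x => (F x, G x)).
Proof.
move=> oU; elim: k F G => [|k IH] F G dF dG.
  by split=> // x Ux; apply: differentiable_pair; [exact: dF.1|exact: dG.1].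
split=> [x Ux|v].
  by apply: differentiable_pair; [exact: dF.1|exact: dG.1].
apply: diffk_ext (IH _ _ (dF.2 v) (dG.2 v)) => // x xU.
by rewrite derive_pair//; [apply: dF.1|apply: dG.1]; exact: set_mem.
Qed.

Lemma diffk_Ck V W k (U : set V) (F : V -> W) : diffk k U F -> Ck k U F.
Proof.
elim: k F => [|k IH] F [dF DF]; split=> //;
  try by move=> x Ux; exact/differentiable_continuous/dF.
by move=> v; split=> [x Ux|]; [exact/diff_derivable/dF|exact/IH/DF].
Qed.

Lemma Ck_cont V W k (U : set V) (F : V -> W) x :
  Ck k U F -> U x -> {for x, continuous F}.
Proof. by case: k => [|k] [cF _]; exact: cF. Qed.

(** One order is lost, since differentiability at each level comes from continuity of the next
    derivatives. *)
Lemma Ck_diffk V W {fV : findim V} {fW : findim W} k (U : set V) (F : V -> W) :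
  open U -> Ck k.+1 U F -> diffk k U F.
Proof.
move=> oU; elim: k F => [|k IH] F CF.
  split=> // x Ux; apply: (C1_differentiable oU Ux) => [y v Uy|v].
    by have [+ _] := CF.2 v; exact.
  by have [_ H] := CF.2 v; exact: (@Ck_cont _ _ 0 _ _ _ H Ux).
split=> [x Ux|v]; last by apply: IH; have [_] := CF.2 v.
apply: (C1_differentiable oU Ux) => [y v Uy|v].
  by have [+ _] := CF.2 v; exact.
by have [_ H] := CF.2 v; exact: (@Ck_cont _ _ k.+1 _ _ _ H Ux).
Qed.

Lemma smooth_onP V W {fV : findim V} {fW : findim W} (U : set V) (F : V -> W) :
  open U -> smooth_on U F <-> diff_infty U F.
Proof.
move=> oU; split=> sF k; first exact: Ck_diffk.
exact: diffk_Ck.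
Qed.

End Diffk.

(** * Symmetry of second derivatives *)

Section Schwarz.
Context {R : realType}.
Implicit Types V W X : normedModType R.

(** The mean value theorem is used twice: along [v] for [F (h w + y) - F y] as a function of [y],
    then along [w] for ['D_v F]. *)
Lemma double_difference V (F : V -> R) (x v w : V) (d h : R) :
  0 < h -> h * (`|v| + `|w|) < d ->
  diffk 1 (ball x d) F ->
  exists2 y, ball x d y &
    F (x + h *: v + h *: w) - F (x + h *: v) - F (x + h *: w) + F x =
    h * h * 'D_w (fun z => 'D_v F z) y.
Proof.
move=> h0 hd dF; have nh : `|h| = h by rewrite gtr0_norm.
have inb (s t : R) : `|s| <= h -> `|t| <= h -> ball x d (x + s *: v + t *: w).
  move=> sh th; rewrite -ball_normE /ball_ /= -addrA opprD addNKr normrN.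
  apply: le_lt_trans (ler_normD _ _) (le_lt_trans _ hd).
  by rewrite !normrZ mulrDr lerD// ler_wpM2r.
have h00 : `|0 : R| <= h by rewrite normr0 ltW.
have inb0 (s : R) : `|s| <= h -> ball x d (x + s *: v).
  by move=> sh; have := inb s 0 sh h00; rewrite scale0r addr0.
pose G y := F (h *: w + y) - F y.
have dFw z : ball x d (h *: w + z) -> differentiable (fun y => F (h *: w + y)) z.
  move=> zb; apply: (differentiable_comp (g := F)); last exact: dF.1.
  by apply: differentiableD; [exact: differentiable_cst|].
have dG (s : R) : `|s| <= h -> differentiable (fun y => F (h *: w + y)) (x + s *: v) /\
    differentiable F (x + s *: v).
  move=> sh; split; last by apply: dF.1; exact: inb0.
  by apply: dFw; rewrite addrC; apply: inb; rewrite ?nh.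
have [|c] := line_MVT (G := G) (y := x) (b := v) (t := h).
  rewrite nh => s /dG[d1 d2]; apply: diff_derivable.
  exact: differentiableB.
rewrite nh => ch.
have [d1 d2] := dG c ch.
rewrite /G deriveBf// (derive_affine _ F) //.
have [|c'] := line_MVT (G := fun z => 'D_v F z) (y := x + c *: v) (b := w) (t := h).
  by rewrite nh => s sh; apply: diff_derivable; apply: (dF.2 v).1; exact: inb.
rewrite nh => ch' E1 E2; exists (x + c *: v + c' *: w); first exact: inb.
rewrite -mulrA -E1 [X in 'D_v F X - _]addrC -E2 [h *: w + (_ + _)]addrC.
by rewrite (addrC _ x); ring.
Qed.

Lemma ler_common_approx (A B C e : R) :
  `|B - C| <= e / 2 -> `|A - C| <= e / 2 -> A <= B + e.
Proof. by rewrite !ler_norml => /andP[+ _] /andP[_ +]; lra. Qed.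

(* Schwarz: both mixed derivatives are limits of the same second difference. *)
Lemma derive_swap V W {fW : findim W} (U : set V) (F : V -> W) x v w :
  open U -> U x -> diffk 2 U F ->
  'D_v (fun z => 'D_w F z) x = 'D_w (fun z => 'D_v F z) x.
Proof.
move=> oU Ux dF; have [I [b [l [lc vE]]]] := fW.
have eqW p p' : (forall i, l i p = l i p') -> p = p'.
  by move=> pp'; rewrite (vE p) (vE p'); apply: eq_bigr => i _; rewrite pp'.
apply: eqW => i.
have DE u u' : l i ('D_u (fun z => 'D_u' F z) x) =
    'D_u (fun z => 'D_u' (fun z => l i (F z)) z) x.
  rewrite -(derive_linear _ (linearP (l i))); last exact: (dF.2 u').1.
  apply: (derive_ext _ oU Ux) => z zU.
  rewrite derive_linear//; first exact: linearP.
  by apply: dF.1; exact: set_mem.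
have : diffk 2 U (fun z => l i (F z)).
  exact: (diffk_linear oU (linearP (l i)) dF).
rewrite (DE v w) (DE w v); move: (fun z => l i (F z)) => {dF DE} G dG.
(* The claim is symmetric in the two directions, so one inequality suffices. *)
apply/eqP; rewrite eq_le; apply/andP.
suff H u u' : 'D_u (fun z => 'D_u' G z) x <= 'D_u' (fun z => 'D_u G z) x.
  by split; exact: H.
apply/ler_addgt0Pr => eps e0.
have e2 : 0 < eps / 2 by rewrite divr_gt0.
have cD a c : \forall y \near x,
    `|'D_a (fun z => 'D_c G z) x - 'D_a (fun z => 'D_c G z) y| <= eps / 2.
  have : {for x, continuous (fun y => 'D_a (fun z => 'D_c G z) y)}.
    by apply: differentiable_continuous; exact: ((dG.2 c).2 a).1.
  by move/cvgrPdist_le/(_ _ e2).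
have /nbhs_ballP[d /= d0 dP] : \forall y \near x,
    [/\ U y, `|'D_u (fun z => 'D_u' G z) x - 'D_u (fun z => 'D_u' G z) y| <= eps / 2
     & `|'D_u' (fun z => 'D_u G z) x - 'D_u' (fun z => 'D_u G z) y| <= eps / 2].
  by apply: filterS3 (open_nbhs_nbhs (conj oU Ux)) (cD u u') (cD u' u) => y *; split.
(* Small enough for the parallelogram spanned by [h u] and [h u'] to stay in the ball; the 1 covers
   the case of two zero directions. *)
pose h := d / 2 / (`|u| + `|u'| + 1).
have N0 : 0 < `|u| + `|u'| + 1 by rewrite ltr_wpDl// addr_ge0.
have h0 : 0 < h by rewrite !divr_gt0.
have hd : h * (`|u| + `|u'|) < d.
  apply: (@le_lt_trans _ _ (h * (`|u| + `|u'| + 1))).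
    by rewrite ler_pM2l// lerDl.
  by rewrite divfK ?gt_eqF//; lra.
have dGb : diffk 1 (ball x d) G.
  by apply: diffk_sub (diffkS dG) => y /dP[].
have [y1 y1b E1] := double_difference h0 hd dGb.
have hd' : h * (`|u'| + `|u|) < d by rewrite addrC.
have [y2 y2b E2] := double_difference h0 hd' dGb.
(* The second difference is the same for both orders of [u] and [u'], up to the order of its
   terms. *)
have E : 'D_u' (fun z => 'D_u G z) y1 = 'D_u (fun z => 'D_u' G z) y2.
  apply: (mulfI (_ : h * h != 0)); first by rewrite mulf_neq0// gt_eqF.
  have alg (g g' r s t d1 d2 : R) : g = g' -> g - s - t + r = d1 ->
    g' - t - s + r = d2 -> d1 = d2 by move=> -> <- <-; ring.
  exact: (alg _ _ _ _ _ _ _ (f_equal G (addrAC x _ _)) E1 E2).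
have [_ h2 _] := dP _ y2b; have [_ _ h1] := dP _ y1b.
rewrite E in h1; exact: ler_common_approx h1 h2.
Qed.

End Schwarz.

(** * Jets and second-order models of frames *)

(* Otherwise unification unfolds derivatives when it compares matrix expressions. *)
Opaque derive.

Section Jets.
Context {R : realType}.
Implicit Types V W X : normedModType R.

Lemma jet_eq_sym V W r (F G : V -> W) : jet_eq r F G -> jet_eq r G F.
Proof. by move=> FG vs vsr; rewrite FG. Qed.

Lemma jet_eq_trans V W r (F G H : V -> W) :
  jet_eq r F G -> jet_eq r G H -> jet_eq r F H.
Proof. by move=> FG GH vs vsr; rewrite FG// GH. Qed.

Lemma jet_eq_local V W (U : set V) r (F G : V -> W) :
  open U -> U 0 -> {in U, F =1 G} -> jet_eq r F G.
Proof.
move=> oU U0 FG vs _.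
suff H : {in U, Defs.iterD vs F =1 Defs.iterD vs G} by apply: H; exact: mem_set.
elim: vs => //= v vs IH x xU.
exact: derive_ext oU (set_mem xU) IH.
Qed.

Lemma jet_eq1P V W (F G : V -> W) :
  jet_eq 1 F G <-> F 0 = G 0 /\ forall v, 'D_v F 0 = 'D_v G 0.
Proof.
split=> [FG|[E0 E1]]; first by split; [exact: (FG [::])|move=> v; exact: (FG [:: v])].
move=> [|v [|w vs]] s; [exact: E0|exact: E1|by case: (notF s)].
Qed.

Lemma jet_eq2P V W (F G : V -> W) :
  jet_eq 2 F G <-> [/\ F 0 = G 0, forall v, 'D_v F 0 = 'D_v G 0 &
    forall v w, 'D_v (fun z => 'D_w F z) 0 = 'D_v (fun z => 'D_w G z) 0].
Proof.
split=> [FG|[E0 E1 E2]].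
  by split; [exact: (FG [::])|move=> v; exact: (FG [:: v])|
    move=> v w; exact: (FG [:: v; w])].
move=> [|v [|w [|u vs]]] s.
- exact: E0.
- exact: E1.
- exact: E2.
- by case: (notF s).
Qed.

(** The inner derivative has a moving direction ['D_w F z]. It is expanded in a basis, so that the
    product rule separates the second derivative of [F] from that of [G]. *)
Lemma derive2_comp V W X {fW : findim W} {fX : findim X} (U : set V)
    (U' : set W) (F : V -> W) (G : W -> X) x v w :
  open U -> open U' -> U x -> (forall x, U x -> U' (F x)) ->
  diffk 1 U F -> diffk 1 U' G ->
  'D_v (fun z => 'D_w (fun z => G (F z)) z) x =
  'D_('D_v (fun z => 'D_w F z) x) G (F x) +
  'D_('D_v F x) (fun y => 'D_('D_w F x) G y) (F x).
Proof.
move=> oU oU' Ux FU dF dG; have [I [b [l [lc vE]]]] := fW.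
have dGb a y : U' y -> 'D_a G y = \sum_i l i a *: 'D_(b i) G y.
  move=> U'y; have dGy := dG.1 _ U'y.
  rewrite deriveE// [in LHS](vE a) linear_sum; apply: eq_bigr => i _.
  by rewrite linearZ deriveE.
have dFx := dF.1 _ Ux; have dDF u := (dF.2 u).1 _ Ux.
have U'Fx := FU _ Ux.
have dDG u := (dG.2 u).1 _ U'Fx.
have dl i : differentiable (fun z => l i ('D_w F z)) x.
  by apply: differentiable_comp (dDF w) _; exact: linear_diff (linearP _).
have dDGF i : differentiable (fun z => 'D_(b i) G (F z)) x.
  exact: (differentiable_comp (g := fun y => 'D_(b i) G y) dFx (dDG _)).
rewrite (derive_ext (G := fun z => \sum_i l i ('D_w F z) *: 'D_(b i) G (F z))
  v oU Ux); last first.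
  move=> z /set_mem Uz.
  rewrite [LHS](derive_comp w (dF.1 _ Uz) (dG.1 _ (FU _ Uz))).
  by rewrite dGb//; exact: FU.
have [_ ->] := derive_sumf v (F := fun i z => l i ('D_w F z) *: 'D_(b i) G (F z))
  (fun i => differentiableZlr (dl i) (dDGF i)).
under eq_bigr => i _.
  rewrite deriveZlr// derive_linear//; last exact: linearP.
  rewrite [X in _ + _ *: X](derive_comp (G := fun y => 'D_(b i) G y) v dFx (dDG _)).
  over.
rewrite big_split /= -dGb//; congr (_ + _).
rewrite [RHS](derive_ext (G := fun y => \sum_i l i ('D_w F x) *: 'D_(b i) G y)
  _ oU' U'Fx); last by move=> y /set_mem U'y; rewrite dGb.
have dZ i : differentiable (fun y => l i ('D_w F x) *: 'D_(b i) G y) (F x).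
  by apply: differentiableZlr => //; exact: differentiable_cst.
have [_ ->] := derive_sumf ('D_v F x) dZ.
apply: eq_bigr => i _; rewrite deriveZlr//.
by rewrite (derive_cst (l i ('D_w F x))) scale0r add0r.
Qed.

(** Frames of order at most two are the only ones that occur, so the chain rules of orders one and
    two cover all cases. *)
Lemma jet_eq_comp V W X {fW : findim W} {fX : findim X} (U1 U2 : set V)
    (U' : set W) (F1 F2 : V -> W) (G1 G2 : W -> X) r :
  (r <= 2)%N -> open U1 -> open U2 -> open U' -> U1 0 -> U2 0 ->
  (forall x, U1 x -> U' (F1 x)) -> (forall x, U2 x -> U' (F2 x)) ->
  diffk 1 U1 F1 -> diffk 1 U2 F2 -> diffk 1 U' G1 -> diffk 1 U' G2 ->
  jet_eq r F1 F2 ->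
  (forall vs, (size vs <= r)%N -> Defs.iterD vs G1 (F1 0) = Defs.iterD vs G2 (F1 0)) ->
  jet_eq r (fun z => G1 (F1 z)) (fun z => G2 (F2 z)).
Proof.
move=> r2 oU1 oU2 oU' U10 U20 FU1 FU2 dF1 dF2 dG1 dG2 FE GE [|v [|w [|u vs]]] sr.
- by have /= E := FE [::] sr; rewrite /= -E; exact: (GE [::] sr).
- have /= E := FE [::] (leq0n _); have /= E1 := FE [:: v] sr; rewrite /=.
  rewrite [LHS](derive_comp v (dF1.1 _ U10) (dG1.1 _ (FU1 _ U10))).
  rewrite [RHS](derive_comp v (dF2.1 _ U20) (dG2.1 _ (FU2 _ U20))).
  by rewrite -E1 -E; exact: (GE [:: _] sr).
- have sr1 : (1 <= r)%N by apply: leq_trans sr.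
  have /= E := FE [::] (leq0n _); have /= E1 u := FE [:: u] sr1.
  have /= E2 := FE [:: v; w] sr; rewrite /=.
  rewrite (derive2_comp v w oU1 oU' U10 FU1 dF1 dG1).
  rewrite (derive2_comp v w oU2 oU' U20 FU2 dF2 dG2).
  rewrite -E2 -!E1 -E; congr (_ + _); first exact: (GE [:: _] sr1).
  exact: (GE [:: _; _] sr).
- by case: (notF (leq_trans sr r2)).
Qed.

End Jets.

Section Model.
Context {R : realType} {n : nat}.
Local Notation E := 'cV[R]_n.
Implicit Types (a : 'M[R]_n) (xi : 'rV[R]_n) (x : E) (Q : E -> E).

Definition hom a xi (Z : E) : E := ((xi *m Z) 0 0 + 1)^-1 *: (a *m Z).

(* Coordinate expression of the frame at [x] with Christoffel form [Q], composed with the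
   homography [Z |-> a Z / (xi Z + 1)]; [hess] is its second derivative at 0. *)
Definition model x Q a xi (Z : E) : E := x + hom a xi Z - 2^-1 *: Q (hom a xi Z).

Definition hom_dom xi : set E := [set Z | (xi *m Z) 0 0 + 1 != 0].

Definition quadratic Q := exists g : 'I_n -> 'I_n -> E,
  forall Z, Q Z = \sum_k \sum_l (Z k 0 * Z l 0) *: g k l.

(** Twice the symmetric bilinear form of [Q], that is its second derivative. *)
Definition polar Q u w := Q (u + w) - Q u - Q w.

Lemma linear_mulmxl m k (A : 'M[R]_(m, n)) :
  linear (fun Z : 'M[R]_(n, k) => A *m Z).
Proof. by move=> c u v; rewrite mulmxDr scalemxAr. Qed.

Lemma linear_form xi : linear (fun Z : E => (xi *m Z) 0 0 : R).
Proof. by move=> c u v; rewrite mulmxDr -scalemxAr !mxE. Qed.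

Arguments linear_mulmxl {m k} A.
Arguments linear_form : clear implicits.

Lemma diffk_form xi k (U : set E) :
  open U -> diffk k U (fun Z => (xi *m Z) 0 0 + 1 : R).
Proof.
move=> oU; apply: diffkD => //; last exact: diffk_cst.
exact: diffk_lin (linear_form xi).
Qed.

Lemma open_hom_dom xi : open (hom_dom xi).
Proof.
have c : continuous (fun Z : E => (xi *m Z) 0 0 + 1 : R).
  move=> Z; apply: differentiable_continuous.
  exact: (diffk_diff (diffk_form xi 0 openT) (I : setT Z)).
rewrite (_ : hom_dom xi = (fun Z : E => (xi *m Z) 0 0 + 1 : R) @^-1` [set x | x != 0])//.
by apply: open_comp => [Z _|]; [exact: c|exact: open_neq].
Qed.

Lemma hom_dom0 xi : hom_dom xi 0.
Proof. by rewrite /hom_dom /= mulmx0 mxE add0r oner_eq0. Qed.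

Arguments open_hom_dom : clear implicits.
Arguments hom_dom0 : clear implicits.

Lemma hom0 a xi : hom a xi 0 = 0.
Proof. by rewrite /hom !mulmx0 scaler0. Qed.

Lemma diffk_hom a xi k : diffk k (hom_dom xi) (hom a xi).
Proof.
have o := open_hom_dom xi; apply: diffkZ => //.
  by apply: diffkV => //; exact: diffk_form.
exact: diffk_lin (linear_mulmxl a).
Qed.

Lemma derive_hom a xi w Z : hom_dom xi Z ->
  'D_w (hom a xi) Z = - (((xi *m Z) 0 0 + 1)^-1 * ((xi *m Z) 0 0 + 1)^-1
     * (xi *m w) 0 0) *: (a *m Z) + ((xi *m Z) 0 0 + 1)^-1 *: (a *m w).
Proof.
move=> Z0; have o := open_hom_dom xi.
have dl := diffk_diff (diffk_form xi 0 o) Z0.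
have [d1 E1] := derive_inv w Z0 dl.
rewrite deriveZlr// ?E1; last exact: linear_diff (linear_mulmxl a).
rewrite (linear_derive _ _ (linear_mulmxl a)).
rewrite deriveDf ?(linear_derive _ _ (linear_form xi)).
- by rewrite (derive_cst (1 : R)) addr0.
- exact: linear_diff (linear_form xi).
- exact: differentiable_cst.
Qed.

Lemma derive_hom0 a xi w : 'D_w (hom a xi) 0 = a *m w.
Proof.
rewrite derive_hom; last exact: hom_dom0.
by rewrite !mulmx0 scaler0 add0r mxE add0r invr1 scale1r.
Qed.

(** This is the quadratic term of [a Z (1 - xi Z + ...)], polarized. *)
Lemma derive2_hom0 a xi v w : 'D_v (fun Z => 'D_w (hom a xi) Z) 0 =
  - ((xi *m v) 0 0 *: (a *m w)) - (xi *m w) 0 0 *: (a *m v).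
Proof.
have o := open_hom_dom xi; have h0 := hom_dom0 xi.
rewrite (derive_ext v o h0 (fun Z ZU => derive_hom a w (set_mem ZU))).
have dV : diffk 0 (hom_dom xi) (fun Z => ((xi *m Z) 0 0 + 1)^-1 : R).
  by apply: diffkV => //; exact: diffk_form.
have dm : diffk 0 (hom_dom xi) (fun Z => a *m Z).
  exact: diffk_lin (linear_mulmxl a).
have dc (y : E) : diffk 0 (hom_dom xi) (fun=> y) by exact: diffk_cst.
have dm2 : diffk 0 (hom_dom xi) (fun Z => - (((xi *m Z) 0 0 + 1)^-1 *
    ((xi *m Z) 0 0 + 1)^-1 * (xi *m w) 0 0) : R).
  by apply: diffkN => //; apply: diffkM; [by []|exact: diffkM|exact: diffk_cst].
rewrite deriveDf; [|exact: ((diffkZ o dm2 dm).1 _ h0)|exact: ((diffkZ o dV (dc _)).1 _ h0)].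
rewrite !deriveZlr; try by [exact: dm2.1|exact: dm.1|exact: dV.1|exact: (dc _).1].
rewrite (linear_derive _ _ (linear_mulmxl a)).
rewrite derive_cst mulmx0 !scaler0 addr0 add0r.
have dl := diffk_diff (diffk_form xi 0 o) h0.
have [_ ->] := derive_inv v h0 dl.
rewrite deriveDf ?(linear_derive _ _ (linear_form xi)).
- rewrite (derive_cst (1 : R)) addr0 mulmx0 !mxE add0r invr1 !mul1r.
  by rewrite !scaleNr addrC.
- exact: linear_diff (linear_form xi).
- exact: differentiable_cst.
Qed.

Lemma linear_mxentry (i : 'I_n) : linear (fun Z : E => Z i 0 : R).
Proof. exact: linear_mxE. Qed.
Arguments linear_mxentry : clear implicits.

Lemma diffk_quadratic Q k (U : set E) : quadratic Q -> open U -> diffk k U Q.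
Proof.
move=> [g QE] oU; have -> : Q = (fun Z => \sum_i \sum_j (Z i 0 * Z j 0) *: g i j).
  by apply/funext => Z; exact: QE.
apply: diffk_sumf => // i; apply: diffk_sumf => // j; apply: diffkZ => //.
  by apply: diffkM; [by []|exact: diffk_lin (linear_mxentry i)|exact: diffk_lin
    (linear_mxentry j)].
exact: diffk_cst.
Qed.

Lemma polarE Q : quadratic Q -> exists g : 'I_n -> 'I_n -> E,
  (forall Z, Q Z = \sum_k \sum_l (Z k 0 * Z l 0) *: g k l) /\
  forall u w, polar Q u w =
    \sum_k \sum_l (u k 0 * w l 0 + w k 0 * u l 0) *: g k l.
Proof.
move=> [g QE]; exists g; split=> // u w; rewrite /polar !QE.
rewrite -!sumrB; apply: eq_bigr => i _; rewrite -!sumrB; apply: eq_bigr => j _.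
by rewrite -!scalerBl !mxE; congr (_ *: _); ring.
Qed.

Lemma polarC Q u w : polar Q u w = polar Q w u.
Proof. by rewrite /polar (addrC u) addrAC. Qed.

Lemma quadratic0 Q : quadratic Q -> Q 0 = 0.
Proof.
move=> [g ->]; apply: big1 => i _; apply: big1 => j _.
by rewrite mxE mul0r scale0r.
Qed.

Lemma polar_linear Q w : quadratic Q -> linear (fun u => polar Q u w).
Proof.
move=> /polarE[g [_ pE]] c u v; rewrite !pE scaler_sumr -big_split.
apply: eq_bigr => i _ /=; rewrite scaler_sumr -big_split; apply: eq_bigr => j _ /=.
by rewrite scalerA -scalerDl !mxE; congr (_ *: _); ring.
Qed.

Lemma derive_quadratic Q u y : quadratic Q -> 'D_u Q y = polar Q y u.
Proof.
move=> /polarE[g [QE ->]]; have -> : Q = (fun Z => \sum_i \sum_j (Z i 0 * Z j 0) *: g i j).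
  by apply/funext => Z; exact: QE.
have dM i j z : differentiable (fun Z : E => Z i 0 * Z j 0 : R) z.
  by apply: differentiableM; exact: linear_diff (linear_mxentry _).
have dZ i j z : differentiable (fun Z : E => (Z i 0 * Z j 0) *: g i j) z.
  by apply: differentiableZlr => //; exact: differentiable_cst.
have [_ ->] := derive_sumf u (fun i =>
  (derive_sumf u (fun j => dZ i j y)).1).
apply: eq_bigr => i _; have [_ ->] := derive_sumf u (fun j => dZ i j y).
apply: eq_bigr => j _.
rewrite deriveZlr; [|exact: dM|exact: differentiable_cst].
rewrite (derive_cst (g i j)) scaler0 addr0; congr (_ *: _).
have d k : derivable (fun Z : E => Z k 0 : R) y u.
  by apply: diff_derivable; exact: linear_diff (linear_mxentry _).
rewrite [LHS](deriveM (d i) (d j)) (linear_derive _ _ (linear_mxentry i)) (linear_derive _ _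
  (linear_mxentry j)).
by rewrite -![_ *: _]/(_ * _); ring.
Qed.

Let Phi Q x (y : E) : E := x + y - 2^-1 *: Q y.

Let diffPhi Q x k : quadratic Q -> diffk k setT (Phi Q x).
Proof.
move=> qQ; have o := @openT E.
apply: diffkD => //; first by apply: diffkD => //; [exact: diffk_cst|exact: diffk_lin].
apply: diffkN => //; apply: diffkZ => //; first exact: diffk_cst.
exact: diffk_quadratic.
Qed.

Let derivePhi Q x u y : quadratic Q -> 'D_u (Phi Q x) y = u - 2^-1 *: polar Q y u.
Proof.
move=> qQ; have dQ z : differentiable Q z.
  exact: (diffk_diff (diffk_quadratic 0 qQ openT) (I : setT z)).
rewrite deriveBf; last 2 first.
- by apply: differentiableD; [exact: differentiable_cst|].
- by apply: differentiableZlr => //; exact: differentiable_cst.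
rewrite deriveDf; [|exact: differentiable_cst|by []].
rewrite derive_cst add0r derive_id deriveZlr; [|exact: differentiable_cst|exact: dQ].
by rewrite (derive_cst (2^-1 : R)) scale0r add0r derive_quadratic.
Qed.

Lemma diffk_model x Q a xi k : quadratic Q -> diffk k (hom_dom xi) (model x Q a xi).
Proof.
move=> qQ; apply: (diffk_comp (F := hom a xi) (G := Phi Q x) (U' := setT)) => //.
- exact: open_hom_dom.
- exact: openT.
- exact: diffk_hom.
- exact: diffPhi.
Qed.

Lemma model0 x Q a xi : quadratic Q -> model x Q a xi 0 = x.
Proof. by move=> qQ; rewrite /model hom0 (quadratic0 qQ) scaler0 subr0 addr0. Qed.

Lemma derive_model x Q a xi w Z : quadratic Q -> hom_dom xi Z ->
  'D_w (model x Q a xi) Z =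
  'D_w (hom a xi) Z - 2^-1 *: polar Q (hom a xi Z) ('D_w (hom a xi) Z).
Proof.
move=> qQ hZ; rewrite [LHS](derive_comp (G := Phi Q x) w (F := hom a xi)).
- by rewrite derivePhi.
- exact: ((diffk_hom a xi 0).1 _ hZ).
- exact: (diffPhi x 0 qQ).1.
Qed.

Lemma polar0 Q w : quadratic Q -> polar Q 0 w = 0.
Proof. by move=> qQ; rewrite /polar add0r (quadratic0 qQ) subr0 subrr. Qed.

Lemma derive_model0 x Q a xi w : quadratic Q -> 'D_w (model x Q a xi) 0 = a *m w.
Proof.
move=> qQ; rewrite derive_model//; last exact: hom_dom0.
by rewrite derive_hom0 hom0 (polar0 _ qQ) scaler0 subr0.
Qed.

Definition hess Q a xi v w : E := - ((xi *m v) 0 0 *: (a *m w)) -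
  (xi *m w) 0 0 *: (a *m v) - 2^-1 *: polar Q (a *m v) (a *m w).

Lemma derive2_model0 x Q a xi v w : quadratic Q ->
  'D_v (fun Z => 'D_w (model x Q a xi) Z) 0 = hess Q a xi v w.
Proof.
move=> qQ.
rewrite (derive2_comp (F := hom a xi) (G := Phi Q x) (U' := setT) v w
  (open_hom_dom xi) openT (hom_dom0 xi) (fun _ _ => I) (diffk_hom a xi 1)
  (diffPhi x 1 qQ)).
rewrite hom0 derivePhi// (polar0 _ qQ) scaler0 subr0 derive2_hom0 !derive_hom0.
rewrite (derive_ext (G := fun y => a *m w - 2^-1 *: polar Q y (a *m w))
  _ openT I); last by move=> y _; rewrite derivePhi.
have dp z : differentiable (fun y => polar Q y (a *m w)) z.
  exact: linear_diff (polar_linear _ qQ).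
rewrite deriveBf ?derive_cst; last 2 first.
- exact: differentiable_cst.
- by apply: differentiableZlr => //; exact: differentiable_cst.
rewrite sub0r deriveZlr; [|exact: differentiable_cst|exact: dp].
rewrite (derive_cst (2^-1 : R)) scale0r add0r.
by rewrite linear_derive//; exact: polar_linear.
Qed.

(** The value gives [x] and the first derivative [a]. The polar terms of the second derivatives are
    then equal, and on the diagonal at a basis vector what remains is a multiple of a nonzero column
    of [a], with factor twice a coordinate of [xi]. *)
Lemma model_inj x x' Q a a' xi xi' : quadratic Q -> a \in unitmx ->
  jet_eq 2 (model x Q a xi) (model x' Q a' xi') -> [/\ x = x', a = a' & xi = xi'].
Proof.
move=> qQ ua /jet_eq2P[]; rewrite !model0// => xx' E1 E2.
have aE (w : E) : a *m w = a' *m w.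
  by have := E1 w; rewrite !derive_model0.
have aa' : a = a'.
  by apply/matrixP => i j; move/matrixP: (aE (delta_mx j 0)) => /(_ i 0);
     rewrite -!colE !mxE.
split=> //; apply/rowP => j; pose d : E := delta_mx j 0.
have := etrans (esym (derive2_model0 x a xi d d qQ))
  (etrans (E2 d d) (derive2_model0 x' a' xi' d d qQ)).
rewrite -aa' /hess => /addIr; rewrite /d => {E1 E2}.
rewrite -!opprD -!scalerDl => /oppr_inj/eqP.
rewrite -subr_eq0 -scalerBl scaler_eq0 => /orP[|].
  rewrite -!colE !mxE subr_eq0 => /eqP; lra.
move=> /eqP/(congr1 (mulmx (invmx a))); rewrite mulmxA mulVmx// mul1mx mulmx0.
by move=> /matrixP/(_ j 0); rewrite !mxE !eqxx => /eqP; rewrite oner_eq0.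
Qed.

(** The transformation law of [Q] is exactly what absorbs the second derivative of [f] in the chain
    rule, so that [xi] stays the same. The second conclusion expresses that derivative by the two
    hessians; it eliminates it from the canonical form in [theta]. *)
Lemma model_transition x Q Q' a xi (J : 'M[R]_n) (U : set E) (f : E -> E) :
  quadratic Q -> quadratic Q' -> open U -> U x -> diffk 2 U f ->
  (forall v, 'D_v f x = J *m v) ->
  (forall Z, Q' (J *m Z) = J *m Q Z - 'D_Z (fun y => 'D_Z f y) x) ->
  jet_eq 2 (f \o model x Q a xi) (model (f x) Q' (J *m a) xi) /\
  forall v w, 'D_(a *m v) (fun y => 'D_(a *m w) f y) x =
    hess Q' (J *m a) xi v w - J *m hess Q a xi v w.
Proof.
move=> qQ qQ' oU Ux dP DP law.
(* The law is given on the diagonal. Polarizing it requires the mixed second derivatives of [f] to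
   be symmetric. *)
have polE u w : polar Q' (J *m u) (J *m w) =
    J *m polar Q u w - 2 *: 'D_u (fun y => 'D_w f y) x.
  have DD s t y : U y -> 'D_(s + t) f y = 'D_s f y + 'D_t f y.
    move=> Uy; have l := derive_is_linear (dP.1 _ Uy).
    by have := l 1 s t; rewrite !scale1r.
  have dD s y : U y -> differentiable (fun y => 'D_s f y) y.
    by move=> Uy; exact: ((dP.2 s).1 _ Uy).
  have E : 'D_(u + w) (fun y => 'D_(u + w) f y) x =
     'D_u (fun y => 'D_u f y) x + 2 *: 'D_u (fun y => 'D_w f y) x +
     'D_w (fun y => 'D_w f y) x.
    have h s : 'D_s (fun y => 'D_(u + w) f y) x =
        'D_s (fun y => 'D_u f y) x + 'D_s (fun y => 'D_w f y) x.
      apply: (etrans (derive_ext (F := fun y => 'D_(u + w) f y) s oU Ux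
        (fun y yU => DD u w y (set_mem yU)))).
      by rewrite deriveDf; [|exact: dD..].
    have l := derive_is_linear (dD (u + w) _ Ux) 1 u w.
    rewrite !scale1r in l.
    apply: (etrans l); apply: (etrans (f_equal2 +%R (h u) (h w))).
    have alg (d1 d2 d2' d3 : E) : d2' = d2 ->
        d1 + d2 + (d2' + d3) = d1 + 2 *: d2 + d3.
      by move=> ->; rewrite scaler_nat mulr2n !addrA.
    exact: alg (derive_swap w u oU Ux dP).
  have alg (A B C d d1 d2 d3 Quw Qu Qw : 'cV[R]_n) : Quw = A - d -> Qu = B - d1 ->
      Qw = C - d3 -> d = d1 + 2 *: d2 + d3 ->
      Quw - Qu - Qw = A - B - C - 2 *: d2.
    by move=> -> -> -> ->; apply/matrixP => i j; rewrite !mxE; ring.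
  rewrite /polar -mulmxDr !mulmxBr.
  exact: (alg _ _ _ _ _ _ _ _ _ _ (law (u + w)) (law u) (law w) E).
have H v w : 'D_(a *m v) (fun y => 'D_(a *m w) f y) x =
    hess Q' (J *m a) xi v w - J *m hess Q a xi v w.
  rewrite /hess !mulmxBr !mulmxN -!scalemxAr -!mulmxA polE.
  rewrite scalerBr scalerA mulVf ?pnatr_eq0// scale1r.
  move: ('D_(a *m v) _ x) (J *m (a *m v)) (J *m (a *m w)) (J *m polar _ _ _).
  by move=> A B C D; apply/matrixP => i j; rewrite !mxE; ring.
split=> //.
(* The chain rule needs a neighbourhood of 0 that the model maps into [U]. *)
have sO : exists O : set E, [/\ open O, O 0, O `<=` hom_dom xi &
    forall z, O z -> U (model x Q a xi z)].
  have c : {for 0, continuous (model x Q a xi)}.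
    apply: differentiable_continuous.
    exact: ((diffk_model x a xi 0 qQ).1 _ (hom_dom0 xi)).
  have /nbhs_interior : nbhs (0 : E) (hom_dom xi `&` (model x Q a xi @^-1` U)).
    apply: filterI; first exact: open_nbhs_nbhs (conj (open_hom_dom xi) (hom_dom0 xi)).
    by apply: c; rewrite model0//; exact: open_nbhs_nbhs.
  move=> H0; exists (interior (hom_dom xi `&` (model x Q a xi @^-1` U))); split.
  - exact: open_interior.
  - exact: nbhs_singleton H0.
  - by move=> z /interior_subset[].
  - by move=> z /interior_subset[].
have [N [oO O0 Oh OU]] := sO.
have dm : diffk 1 N (model x Q a xi).
  exact: diffk_sub Oh (diffk_model x a xi 1 qQ).
apply/jet_eq2P; split=> [|v|v w].
- by rewrite /= !model0.
- rewrite (derive_comp v (dm.1 _ O0)) ?model0//; last exact: dP.1.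
  by rewrite (derive_model0 x a xi v qQ) (derive_model0 _ _ _ v qQ') DP mulmxA.
- rewrite (derive2_comp v w oO oU O0 OU dm (diffkS dP)) model0//.
  rewrite (derive_model0 x a xi v qQ) (derive_model0 x a xi w qQ).
  apply: (etrans _ (esym (derive2_model0 _ _ _ v w qQ'))).
  apply: (etrans (f_equal2 +%R (DP _) (H v w))).
  rewrite (derive2_model0 x a xi v w qQ) addrC; exact: subrK.
Qed.

End Model.

(** * Adapted charts and germs *)

Section Blocks.
Context {R : realType} {p q : nat}.
Local Notation E := 'cV[R]_(p + q).

(** Discards the lower left block: a left inverse of [glmx], and a right inverse on the matrices
    that preserve leaf directions ([glofK]). *)
Definition glof (M : 'M[R]_(p + q)) : gl R p q :=
  (ulsubmx M, ursubmx M, drsubmx M).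

Lemma glmxK (a : gl R p q) : glof (glmx a) = a.
Proof.
by case: a => [[A B] D]; rewrite /glof /glmx block_mxKul block_mxKur block_mxKdr.
Qed.

Lemma glmx_inj : injective (@glmx R p q).
Proof. exact: can_inj glmxK. Qed.

Lemma dsubmx_mul m (M : 'M[R]_(p + q)) (v : 'M[R]_(p + q, m)) :
  dsubmx (M *m v) = dlsubmx M *m usubmx v + drsubmx M *m dsubmx v.
Proof.
by rewrite -[M in LHS]submxK -[v in LHS]vsubmxK mul_block_col col_mxKd.
Qed.

Lemma glofK (M : 'M[R]_(p + q)) :
  (forall v : E, dsubmx v = 0 -> dsubmx (M *m v) = 0) -> glmx (glof M) = M.
Proof.
move=> h; rewrite /glmx /glof /= -[RHS]submxK; congr block_mx.
apply/matrixP => i j; rewrite mxE.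
have := h (col_mx (delta_mx j 0) 0); rewrite col_mxKd => /(_ erefl).
rewrite dsubmx_mul col_mxKu col_mxKd mulmx0 addr0 -colE.
by move/matrixP/(_ i 0); rewrite !mxE => ->.
Qed.

Lemma dsubmx_glmx m (a : gl R p q) (v : 'M[R]_(p + q, m)) :
  dsubmx (glmx a *m v) = a.2 *m dsubmx v.
Proof. by rewrite dsubmx_mul /glmx block_mxKdl block_mxKdr mul0mx add0r. Qed.

Lemma glmx_unit (a : gl R p q) : (glmx a \in unitmx) = isGL a.
Proof. by rewrite unitmxE /glmx det_ublock unitrM -!unitmxE. Qed.

Lemma linear_glmx : linear (@glmx R p q).
Proof.
move=> c [[A B] D] [[A' B'] D']; rewrite /glmx /=.
by rewrite scale_block_mx add_block_mx scaler0 addr0.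
Qed.

Lemma linear_glof : linear glof.
Proof.
move=> c M N; congr (_, _, _); apply/matrixP => i j; by rewrite !mxE.
Qed.

Lemma drsubmx_glmx (a : gl R p q) : drsubmx (glmx a) = a.2.
Proof. by rewrite /glmx block_mxKdr. Qed.

Lemma row0_mul (xi : 'rV[R]_q) (v : E) : row_mx 0 xi *m v = xi *m dsubmx v.
Proof. by rewrite -{1}[v]vsubmxK mul_row_col mul0mx add0r. Qed.

Lemma linear_dsubmx m : linear (@dsubmx R p q m).
Proof. by move=> c u v; apply/matrixP => i j; rewrite !mxE. Qed.

End Blocks.

Section Jacobian.
Context {R : realType}.

Lemma cV_sum n (v : 'cV[R]_n) : v = \sum_i v i 0 *: ev i.
Proof.
rewrite {1}(matrix_sum_delta v); apply: eq_bigr => i _.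
by rewrite big_ord_recl big_ord0 addr0.
Qed.

Lemma derive_jac n m (F : 'cV[R]_n -> 'cV[R]_m) x v :
  differentiable F x -> 'D_v F x = jac F x *m v.
Proof.
move=> dF; rewrite {1}(cV_sum v).
have [g gE] := linear_pack (derive_is_linear dF).
rewrite -[LHS]/((fun v => 'D_v F x) (\sum_i v i 0 *: ev i)) gE linear_sum.
apply/matrixP => i j; rewrite !mxE summxE; apply: eq_bigr => k _.
by rewrite linearZ -gE !mxE (ord1 j) mulrC.
Qed.

Lemma mulmx_inj n m (M N : 'M[R]_(m, n)) :
  (forall v : 'cV[R]_n, M *m v = N *m v) -> M = N.
Proof.
move=> MN; apply/matrixP => i j; have := MN (delta_mx j 0).
by rewrite -!colE => /matrixP/(_ i 0); rewrite !mxE.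
Qed.

Lemma diffk_jac n m k (F : 'cV[R]_n -> 'cV[R]_m) (U : set 'cV[R]_n) :
  open U -> diffk k.+1 U F -> diffk k U (jac F).
Proof.
move=> oU dF; apply: diffk_mx => // i j.
apply: diffk_ext (diffk_mxE i 0 oU (dF.2 (ev j))) => // x _.
by rewrite mxE.
Qed.

Lemma unit_bijective n (M : 'M[R]_n) :
  M \in unitmx <-> bijective (fun v : 'cV[R]_n => M *m v).
Proof.
split=> [uM|[g gK Kg]].
  by exists (fun v => invmx M *m v) => v /=; rewrite mulmxA ?mulVmx ?mulmxV// mul1mx.
(* Transposed, the rows of the kernel of the transpose of [M] are column vectors killed by [M]. *)
rewrite -unitmx_tr -row_free_unit -kermx_eq0; apply/eqP/row_matrixP => i.
apply: trmx_inj; rewrite row0 trmx0; apply: (can_inj gK).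
rewrite mulmx0 -[X in X *m _]trmxK -trmx_mul -row_mul mulmx_ker row0 trmx0 //.
Qed.

Lemma diffk_det (V : normedModType R) n k (U : set V) (F : V -> 'M[R]_n) :
  open U -> diffk k U F -> diffk k U (fun x => \det (F x)).
Proof.
move=> oU dF.
apply: (diffk_ext (F := fun x => \sum_(s : 'S_n) (-1) ^+ s * \prod_i F x i (s i))) => //.
apply: diffk_sumf => // s; apply: diffkM => //; first exact: diffk_cst.
by apply: diffk_prod => // i _; exact: diffk_mxE.
Qed.

Lemma open_preimage (V W : normedModType R) (U : set V) (F : V -> W) (U' : set W) :
  open U -> (forall x, U x -> differentiable F x) -> open U' ->
  open (U `&` F @^-1` U').
Proof.
move=> oU dF oU'; rewrite openE => x [Ux U'Fx]; apply: filterI.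
  exact: open_nbhs_nbhs.
by apply: (differentiable_continuous (dF x Ux)); exact: open_nbhs_nbhs.
Qed.

End Jacobian.

(** What the frame computations use of an atlas. It is shared by foliated manifolds, by [R^n] and by
    the local leaf spaces; the conditional form of [ao_pref] allows points of [T] outside all
    charts, as for an open subset of [R^q]. *)
Record atlas_ok {R : realType} {p q : nat} {T : Type}
    (A : charted T 'cV[R]_(p + q)) : Prop := AtlasOk {
  ao_open : forall c, open (@ccod _ _ _ A c);
  ao_coordK : forall c m, @cdom _ _ _ A c m ->
    @ccod _ _ _ A c (coord c m) /\ param c (coord c m) = m;
  ao_paramK : forall c e, @ccod _ _ _ A c e ->
    @cdom _ _ _ A c (param c e) /\ coord c (param c e) = e;
  ao_pref : forall c m, @cdom _ _ _ A c m -> @cdom _ _ _ A (pref A m) m;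
  ao_topen : forall c c',
    open [set e | @ccod _ _ _ A c e /\ @cdom _ _ _ A c' (param c e)];
  ao_smooth : forall c c',
    diff_infty [set e | @ccod _ _ _ A c e /\ @cdom _ _ _ A c' (param c e)]
              (@coord _ _ _ A c' \o @param _ _ _ A c);
  ao_fol : forall c c' e v,
    @ccod _ _ _ A c e -> @cdom _ _ _ A c' (param c e) ->
    dsubmx v = 0 ->
    dsubmx ('D_v (@coord _ _ _ A c' \o @param _ _ _ A c) e) = 0 }.

Arguments ao_open {R p q T A} a c.
Arguments open_hom_dom {R n} xi.
Arguments hom_dom0 {R n} xi.

Section Transitions.
Context {R : realType} {p q : nat} {T : Type} (A : charted T 'cV[R]_(p + q)).
Hypothesis AO : atlas_ok A.
Local Notation E := 'cV[R]_(p + q).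
Implicit Types c : cidx A.

Definition tdom c c' : set E := [set e | ccod c e /\ cdom c' (param c e)].
Definition trans c c' : E -> E := coord c' \o param c.
Definition tjac c c' (e : E) : 'M[R]_(p + q) := jac (trans c c') e.

Lemma open_tdom c c' : open (tdom c c'). Proof. exact: ao_topen. Qed.
Arguments open_tdom : clear implicits.

Lemma trans_smooth c c' : diff_infty (tdom c c') (trans c c').
Proof. exact: ao_smooth. Qed.

Lemma trans_diff c c' e : tdom c c' e -> differentiable (trans c c') e.
Proof. exact: diffoo_diff (trans_smooth c c'). Qed.

Lemma derive_trans c c' e v : tdom c c' e -> 'D_v (trans c c') e = tjac c c' e *m v.
Proof. by move=> /trans_diff d; rewrite derive_jac. Qed.

Lemma tdom_coord c c' m : cdom c m -> cdom c' m -> tdom c c' (coord c m).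
Proof. by move=> cm c'm; have [? E0] := ao_coordK AO cm; split; rewrite ?E0. Qed.

Lemma tdomV c c' e : tdom c c' e ->
  [/\ tdom c' c (trans c c' e), trans c' c (trans c c' e) = e &
     param c' (trans c c' e) = param c e].
Proof.
move=> [ce c'e]; have [cp E1] := ao_paramK AO ce; have [? E2] := ao_coordK AO c'e.
by split; rewrite /trans /= ?E2//; split => //=; rewrite E2.
Qed.

Lemma tjacV c c' e : tdom c c' e ->
  tjac c' c (trans c c' e) *m tjac c c' e = 1%:M.
Proof.
move=> ce; have [c'e E1 _] := tdomV ce; apply: mulmx_inj => v.
rewrite mul1mx -mulmxA -(derive_trans v ce) -(derive_trans _ c'e).
rewrite -(derive_comp v (trans_diff ce) (trans_diff c'e)).
rewrite (derive_ext (G := id) v (open_tdom c c') ce); first by rewrite derive_id.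
by move=> y /set_mem /tdomV[].
Qed.

Lemma tjac_unit c c' e : tdom c c' e -> tjac c c' e \in unitmx.
Proof. by move=> /tjacV /mulmx1_unit[]. Qed.

Lemma tjac_fol c c' e : tdom c c' e -> glmx (glof (tjac c c' e)) = tjac c c' e.
Proof.
move=> ce; apply: glofK => v v0; rewrite -derive_trans//.
by case: ce => ? ?; exact: ao_fol.
Qed.

Lemma dsubmx_tjac c c' e (v : E) : tdom c c' e ->
  dsubmx (tjac c c' e *m v) = drsubmx (tjac c c' e) *m dsubmx v.
Proof. by move=> ce; rewrite -{1}(tjac_fol ce) dsubmx_glmx. Qed.

Lemma tjac_comp c1 c2 c3 e : tdom c1 c2 e -> tdom c1 c3 e ->
  tjac c2 c3 (trans c1 c2 e) *m tjac c1 c2 e = tjac c1 c3 e.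
Proof.
move=> e12 e13; have [e21 _ E2] := tdomV e12.
have e23 : tdom c2 c3 (trans c1 c2 e).
  by split; [exact: e21.1|rewrite E2; exact: e13.2].
apply: mulmx_inj => v; rewrite -mulmxA -(derive_trans v e12) -(derive_trans _ e23).
rewrite -(derive_comp v (trans_diff e12) (trans_diff e23)) -(derive_trans v e13).
have oI : open (tdom c1 c2 `&` tdom c1 c3) by apply: openI; exact: open_tdom.
apply: (derive_ext v oI) => // y /set_mem[/tdomV[_ _ E3] _].
by rewrite /= /trans /= E3.
Qed.

End Transitions.

Arguments open_tdom {R p q T A} AO c c'.

Section Germs.
Context {R : realType} {p q : nat} {T : pointedType} (A : charted T 'cV[R]_(p + q)).
Hypothesis AO : atlas_ok A.
Local Notation E := 'cV[R]_(p + q).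
Implicit Types (c : cidx A) (f g : E -> T).

(** [adapted_germ] read in an arbitrary chart instead of the preferred one, with both conditions on
    the differential expressed by its Jacobian matrix. *)
Definition chart_germ c f := exists U : set E,
  [/\ open U, U 0, forall z, U z -> cdom c (f z), diff_infty U (coord c \o f) &
   forall z, U z -> jac (coord c \o f) z \in unitmx /\
    glmx (glof (jac (coord c \o f) z)) = jac (coord c \o f) z].

Lemma chart_germP f : adapted_germ A f <-> chart_germ (pref A (f 0)) f.
Proof.
split=> -[U [oU U0 Uf sf h]]; exists U; split=> //.
- exact/(smooth_onP _ oU).
- move=> z Uz; have [bz fz] := h z Uz.
  have dz : differentiable (coord (pref A (f 0)) \o f) z.
    by apply: diffoo_diff Uz; exact/smooth_onP.
  split; last by apply: glofK => v v0; rewrite -derive_jac//; exact: fz.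
  by apply/unit_bijective; apply: (eq_bij bz) => v; rewrite derive_jac.
- exact/(smooth_onP _ oU).
- move=> z Uz; have [uz fz] := h z Uz.
  have dz := diffoo_diff sf Uz.
  split; last by move=> v v0; rewrite derive_jac// -fz dsubmx_glmx v0 mulmx0.
  by apply: (eq_bij ((unit_bijective _).1 uz)) => v; rewrite derive_jac.
Qed.

Lemma chart_germ_dom c f : chart_germ c f -> cdom c (f 0).
Proof. by move=> [U [_ U0 + _ _]]; exact. Qed.

Lemma coord_change c c' f z : cdom c (f z) ->
  (coord c' \o f) z = trans c c' ((coord c \o f) z).
Proof. by move=> cf; have [_ E1] := ao_coordK AO cf; rewrite /trans /= E1. Qed.

Lemma chart_germ_change c c' f : chart_germ c f -> cdom c' (f 0) -> chart_germ c' f.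
Proof.
move=> [U [oU U0 Uf sf h]] c'f.
pose U' := U `&` (coord c \o f) @^-1` tdom c c'.
have oU' : open U'.
  by apply: open_preimage (open_tdom AO c c') => // x; exact: diffoo_diff sf.
have EU : {in U', coord c' \o f =1 trans c c' \o (coord c \o f)}.
  by move=> z /set_mem[/Uf zc _]; exact: coord_change.
have sf' : diff_infty U' (trans c c' \o (coord c \o f)).
  move=> k; apply: (diffk_comp oU' (open_tdom AO c c')) => [x []//||].
    by apply: diffk_sub (sf k) => x [].
  exact: trans_smooth.
have jE z : U' z -> jac (coord c' \o f) z =
    tjac c c' (coord c (f z)) *m jac (coord c \o f) z.
  move=> U'z; have dz := diffoo_diff sf U'z.1.
  have dt := trans_diff AO U'z.2.
  apply: mulmx_inj => v; rewrite -mulmxA -derive_jac//; last first.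
    apply: differentiable_ext oU' U'z _ (diffoo_diff sf' U'z).
    by move=> y yU; rewrite EU.
  rewrite (derive_ext v oU' U'z EU) (derive_comp v dz dt).
  by rewrite (derive_trans AO _ U'z.2) derive_jac.
exists U'; split=> //.
- by split=> //; apply: tdom_coord => //; exact: Uf.
- move=> z [Uz [_]] /=; have [_ ->] := ao_coordK AO (Uf z Uz); exact.
- by move=> k; apply: diffk_ext (sf' k) => // y yU; rewrite EU.
- move=> z U'z; have [uz fz] := h z U'z.1; rewrite jE//; split.
    by rewrite unitmx_mul uz andbT; exact: tjac_unit U'z.2.
  apply: glofK => v v0; rewrite -mulmxA (dsubmx_tjac AO _ U'z.2).
  have := dsubmx_glmx (glof (jac (coord c \o f) z)) v; rewrite fz => ->.
  by rewrite v0; move: (drsubmx _) (glof _).2 => B C; rewrite !mulmx0.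
Qed.

Lemma chart_germ_adapted c f : chart_germ c f -> adapted_germ A f.
Proof.
move=> cf; apply/chart_germP; apply: (chart_germ_change cf).
exact: (ao_pref AO (chart_germ_dom cf)).
Qed.

Lemma adapted_chart_germ c f : adapted_germ A f -> cdom c (f 0) -> chart_germ c f.
Proof. by move=> /chart_germP fg cf; exact: chart_germ_change fg cf. Qed.

Lemma jet_change r c c' f g : (r <= 2)%N -> chart_germ c f -> chart_germ c g -> f 0 = g 0 ->
  cdom c' (f 0) -> jet_eq r (coord c \o f) (coord c \o g) ->
  jet_eq r (coord c' \o f) (coord c' \o g).
Proof.
move=> r2 [U1 [oU1 U10 Uf1 sf1 _]] [U2 [oU2 U20 Uf2 sf2 _]] fg c'f J.
pose V1 := U1 `&` (coord c \o f) @^-1` tdom c c'.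
pose V2 := U2 `&` (coord c \o g) @^-1` tdom c c'.
have oV1 : open V1.
  by apply: open_preimage (open_tdom AO c c') => // x; exact: diffoo_diff sf1.
have oV2 : open V2.
  by apply: open_preimage (open_tdom AO c c') => // x; exact: diffoo_diff sf2.
have V10 : V1 0 by split=> //; apply: tdom_coord => //; exact: Uf1.
have V20 : V2 0 by split=> //; apply: tdom_coord => //; [exact: Uf2|rewrite -fg].
have L1 : jet_eq r (coord c' \o f) (fun z => trans c c' ((coord c \o f) z)).
  by apply: (jet_eq_local oV1 V10) => z /set_mem[/Uf1 zc _]; exact: coord_change.
have L2 : jet_eq r (fun z => trans c c' ((coord c \o g) z)) (coord c' \o g).
  apply: jet_eq_sym.
  by apply: (jet_eq_local oV2 V20) => z /set_mem[/Uf2 zc _]; exact: coord_change.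
apply: jet_eq_trans L1 (jet_eq_trans _ L2).
apply: (jet_eq_comp r2 oV1 oV2 (open_tdom AO c c')) => //.
- by move=> x [].
- by move=> x [].
- by apply: diffk_sub (sf1 1%N) => x [].
- by apply: diffk_sub (sf2 1%N) => x [].
- exact: trans_smooth.
- exact: trans_smooth.
Qed.

(** Operations on jets are defined through the representative chosen by [get]; this gives access to
    its derivatives. *)
Lemma get_jet r c f : (r <= 2)%N -> chart_germ c f -> let g := get (jet A r f) in
  [/\ chart_germ c g, g 0 = f 0 & jet_eq r (coord c \o f) (coord c \o g)].
Proof.
move=> r2 cf g; have fa := chart_germ_adapted cf; have cf0 := chart_germ_dom cf.
have : jet A r f g.
  by apply: getPex; exists f; split.
move=> [ga g0 J]; have cg : chart_germ c g by apply: adapted_chart_germ; rewrite ?g0.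
split=> //; have cp := ao_pref AO cf0.
apply: (jet_change r2 (chart_germ_change cf cp) _ (esym g0) cf0 J).
by apply: (chart_germ_change cg); rewrite g0.
Qed.

Lemma jet_eqP r c f g : (r <= 2)%N -> chart_germ c f -> chart_germ c g -> f 0 = g 0 ->
  jet_eq r (coord c \o f) (coord c \o g) -> jet A r f = jet A r g.
Proof.
move=> r2 cf cg fg J; have cp := ao_pref AO (chart_germ_dom cf).
have J' := jet_change r2 cf cg fg cp J.
apply/seteqP; split=> h [ha h0 Jh]; split=> //.
- by rewrite h0.
- by rewrite /= -fg; exact: jet_eq_trans (jet_eq_sym J') Jh.
- by rewrite h0.
- by move: Jh; rewrite /= -fg => Jh; exact: jet_eq_trans J' Jh.
Qed.

Lemma jet_inj r c f g : (r <= 2)%N -> chart_germ c f -> chart_germ c g ->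
  jet A r f = jet A r g -> f 0 = g 0 /\ jet_eq r (coord c \o f) (coord c \o g).
Proof.
move=> r2 cf cg fg; have [_ E1 J1] := get_jet r2 cf.
have [_ E2 J2] := get_jet r2 cg; rewrite -fg in E2 J2.
by split; [rewrite -E1|exact: jet_eq_trans J1 (jet_eq_sym J2)].
Qed.

Lemma jbase_jet r c f : (r <= 2)%N -> chart_germ c f -> jbase (jet A r f) = f 0.
Proof. by move=> r2 cf; have [] := get_jet r2 cf. Qed.

End Germs.

(** * Adapted frames *)

(* [ch_law] is the transformation law of Christoffel symbols, evaluated on the diagonal. *)
Record christ_ok {R : realType} {p q : nat} {T : Type}
    (A : charted T 'cV[R]_(p + q))
    (G : cidx A -> T -> 'cV[R]_(p + q) -> 'cV[R]_(p + q)) : Prop := ChristOk {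
  ch_quad : forall c m, @cdom _ _ _ A c m -> quadratic (G c m);
  ch_fol : forall c m Z Z', @cdom _ _ _ A c m -> dsubmx Z = dsubmx Z' ->
    dsubmx (G c m Z) = dsubmx (G c m Z');
  ch_law : forall c c' e Z, @tdom _ _ _ _ A c c' e ->
    G c' (param c e) (tjac c c' e *m Z) = tjac c c' e *m G c (param c e) Z -
      'D_Z (fun y => 'D_Z (@trans _ _ _ _ A c c') y) e }.

(** Multiplication of the matrices with rows [(a, 0), (xi, 1)] and [(b, 0), (eta, 1)]. Where the
    outer denominator vanishes both sides are 0, as [0^-1 = 0]. *)
Lemma hom_comp {R : realType} n (a b : 'M[R]_n) (xi eta : 'rV[R]_n) (Z : 'cV[R]_n) :
  hom_dom eta Z ->
  hom a xi (hom b eta Z) = hom (a *m b) (xi *m b + eta) Z.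
Proof.
rewrite /hom_dom /hom /=; set s := (eta *m Z) 0 0 + 1 => s0.
have -> : (xi *m (s^-1 *: (b *m Z))) 0 0 + 1 =
    s^-1 * (((xi *m b + eta) *m Z) 0 0 + 1).
  have ZE (k : R) (N : 'M[R]_1) : (k *: N) 0 0 = k * N 0 0 by rewrite mxE.
  have DE (N N' : 'M[R]_1) : (N + N') 0 0 = N 0 0 + N' 0 0 by rewrite mxE.
  rewrite -scalemxAr mulmxDl mulmxA ZE DE.
  by rewrite -addrA -/s mulrDr mulVf.
rewrite -scalemxAr scalerA invfM invrK mulrAC mulfV// mul1r.
by rewrite mulmxA.
Qed.

Lemma glmxZ {R : realType} {p q : nat} k (a : gl R p q) :
  glmx (k *: a) = k *: glmx a.
Proof. by rewrite /glmx /= scale_block_mx scaler0. Qed.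

(** Normalizes the representative of a class modulo scalars, so that [PF_param], whose last entry is
    1, reaches all of [PF]. *)
Lemma homographyE {R : realType} {p q : nat} (h : gl R p q * 'rV[R]_q * R) :
  h.2 != 0 ->
  homography h = homography (h.2^-1 *: h.1.1, h.2^-1 *: h.1.2, 1).
Proof.
move=> h0; apply/funext => Z; rewrite /homography /= glmxZ.
have -> : row_mx 0 (h.2^-1 *: h.1.2) = h.2^-1 *: row_mx (0 : 'rV_p) h.1.2.
  by rewrite scale_row_mx scaler0.
have ZE (k : R) (N : 'M[R]_1) : (k *: N) 0 0 = k * N 0 0 by rewrite mxE.
rewrite -!scalemxAl ZE scalerA; congr (_ *: _).
by rewrite -[in RHS](mulVf h0) -mulrDr invfM invrK mulrAC mulfV// mul1r.
Qed.

Section Frames.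
Context {R : realType} {p q : nat} {T : pointedType} (A : charted T 'cV[R]_(p + q)).
Hypothesis AO : atlas_ok A.
Local Notation E := 'cV[R]_(p + q).
Implicit Types (c : cidx A) (f g : E -> T).

Lemma dsubmx_polar (Q : E -> E) u w u' w' :
  (forall Z Z', dsubmx Z = dsubmx Z' -> dsubmx (Q Z) = dsubmx (Q Z')) ->
  dsubmx u = dsubmx u' -> dsubmx w = dsubmx w' ->
  dsubmx (polar Q u w) = dsubmx (polar Q u' w').
Proof.
move=> fQ uu' ww'; rewrite /polar !linearB /=; congr (_ - _ - _); apply: fQ => //.
by rewrite !linearD /= uu' ww'.
Qed.

Lemma jet_ext r f g : f 0 = g 0 ->
  jet_eq r (coord (pref A (f 0)) \o f) (coord (pref A (f 0)) \o g) ->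
  jet A r f = jet A r g.
Proof.
move=> fg J; apply/seteqP; split=> h [ha h0 Jh]; split=> //.
- by rewrite h0.
- by rewrite /= -fg; exact: jet_eq_trans (jet_eq_sym J) Jh.
- by rewrite h0.
- by move: Jh; rewrite /= -fg => Jh; exact: jet_eq_trans J Jh.
Qed.

Lemma model_germ c x (Q : E -> E) (a : gl R p q) (xi : 'rV[R]_q) :
  ccod c x -> quadratic Q ->
  (forall Z Z', dsubmx Z = dsubmx Z' -> dsubmx (Q Z) = dsubmx (Q Z')) -> isGL a ->
  chart_germ c (fun Z => param c (model x Q (glmx a) (row_mx 0 xi) Z)) /\
  forall r, jet_eq r
    (coord c \o (fun Z => param c (model x Q (glmx a) (row_mx 0 xi) Z)))
    (model x Q (glmx a) (row_mx 0 xi)).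
Proof.
move=> cx qQ fQ ga; set F := model _ _ _ _.
pose D := hom_dom (row_mx (0 : 'rV[R]_p) xi); have oD : open D by exact: open_hom_dom.
have sF k : diffk k D F by exact: diffk_model.
pose U0 := D `&` F @^-1` ccod c.
have oU0 : open U0.
  by apply: (open_preimage oD _ (ao_open AO c)) => z; exact: diffk_diff (sF 0%N).
have sF0 k : diffk k U0 F by apply: diffk_sub (sF k) => z [].
(* The germ condition asks for invertibility near 0; at 0 the Jacobian is [glmx a]. *)
pose U := U0 `&` (fun z => \det (jac F z)) @^-1` [set x | x != 0].
have oU : open U.
  apply: (open_preimage oU0 _ (@open_neq _ _)) => z.
  by apply: (diffk_diff (k := 0)); apply: diffk_det => //; exact: diffk_jac.
have U00 : U 0.
  split; first by split; [exact: hom_dom0|rewrite /F /preimage /= model0].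
  rewrite /preimage /=; have -> : jac F 0 = glmx a.
    apply: mulmx_inj => v; rewrite -derive_jac; first exact: derive_model0.
    exact: diffk_diff (sF 0%N) (hom_dom0 _).
  by move: ga; rewrite -glmx_unit unitmxE unitfE.
have EU : {in U, coord c \o (fun Z => param c (F Z)) =1 F}.
  by move=> z /set_mem[[_ /(ao_paramK AO)[]]].
have jE z : U z -> jac (coord c \o (fun Z => param c (F Z))) z = jac F z.
  move=> Uz; apply/matrixP => i j; rewrite !mxE; congr (fun_of_matrix _ _ _).
  exact: derive_ext oU Uz EU.
split; last by move=> r; exact: jet_eq_local oU U00 EU.
exists U; split=> //.
- by move=> z [[_ /(ao_paramK AO)[]]].
- move=> k; apply: (diffk_ext oU) => [z zU|]; first by rewrite EU.
  by apply: diffk_sub (sF k) => z [[]].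
- move=> z Uz; rewrite jE//; split; first by rewrite unitmxE unitfE; exact: Uz.2.
  have Dz : D z by exact: Uz.1.1.
  apply: glofK => v v0; rewrite -derive_jac; last exact: diffk_diff (sF 0%N) Dz.
  rewrite derive_model// linearB /= linearZ /=.
  (* The linear form [(0, xi)] kills the leaf direction [v], so that the derivative of the
     homography along [v] is a multiple of [a v]. *)
  have h0 : dsubmx ('D_v (hom (glmx a) (row_mx 0 xi)) z) = 0.
    have xv : ((row_mx 0 xi : 'rV_(p + q)) *m v) 0 0 = 0.
      by rewrite row0_mul v0 mulmx0 mxE.
    rewrite derive_hom// xv mulr0 oppr0 scale0r add0r.
    by rewrite linearZ /= dsubmx_glmx v0 mulmx0 scaler0.
  rewrite h0 sub0r (dsubmx_polar (u' := hom (glmx a) (row_mx 0 xi) z) (w' := 0) fQ)//.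
    by rewrite polarC polar0// linear0 scaler0 oppr0.
  by rewrite h0 linear0.
Qed.

Section PFrames.
Variable G : cidx A -> T -> E -> E.
Hypothesis CH : christ_ok G.
Implicit Types e : pgl R p q.

Definition frame_model c e : E -> E :=
  model e.1.1 (G c (param c e.1.1)) (glmx e.1.2) (row_mx 0 e.2).

Definition frame c e : E -> T := proj_frame G c e.1.1 \o homography (e.1.2, e.2, 1).

Lemma frame_quadratic c e : PF_cod c e -> quadratic (G c (param c e.1.1)).
Proof. by move=> [ce _]; apply: (ch_quad CH); have [] := ao_paramK AO ce. Qed.

Lemma frame_germ c e : PF_cod c e ->
  chart_germ c (frame c e) /\ forall r, jet_eq r (coord c \o frame c e) (frame_model c e).
Proof.
move=> ce; apply: model_germ (frame_quadratic ce) _ ce.2; first exact: ce.1.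
by move=> Z Z'; apply: (ch_fol CH); have [] := ao_paramK AO ce.1.
Qed.

Lemma frame0 c e : PF_cod c e -> frame c e 0 = param c e.1.1.
Proof.
move=> ce; rewrite -[LHS]/(param c (frame_model c e 0)); rewrite /frame_model model0//.
exact: frame_quadratic.
Qed.

Lemma PF_param_inj c e e' : PF_cod c e -> PF_cod c e' ->
  PF_param G c e = PF_param G c e' -> e = e'.
Proof.
move=> ce ce' ee'; have [ag J] := frame_germ ce; have [ag' J'] := frame_germ ce'.
have [E0 JJ] := jet_inj AO (leqnn 2) ag ag' ee'.
rewrite !frame0// in E0.
have E1 : e.1.1 = e'.1.1.
  have [_ <-] := ao_paramK AO ce.1; have [_ <-] := ao_paramK AO ce'.1.
  by rewrite E0.
have := jet_eq_trans (jet_eq_sym (J 2)) (jet_eq_trans JJ (J' 2)).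
rewrite /frame_model -E1 => /(model_inj (frame_quadratic ce)).
rewrite glmx_unit ce.2 => /(_ isT)[_ /glmx_inj E2 /eq_row_mx[_ E3]].
by move: E1 E2 E3; case: e {ce ee' ag J JJ E0} => [[? ?] ?];
   case: e' {ce' ag' J'} => [[? ?] ?] /= -> -> ->.
Qed.

Lemma PF_coordK c e : PF_cod c e ->
  @coord _ _ _ (PFc G) c (PF_param G c e) = e.
Proof.
move=> ce; rewrite /=.
have : [set e' | PF_cod c e' /\ PF_param G c e' = PF_param G c e]
    (get [set e' | PF_cod c e' /\ PF_param G c e' = PF_param G c e]).
  by apply: getPex; exists e.
by move=> [ce' /PF_param_inj]; exact.
Qed.

Lemma jbase_PF c e : PF_cod c e -> jbase (PF_param G c e) = param c e.1.1.
Proof.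
by move=> ce; rewrite (jbase_jet AO (leqnn 2) (frame_germ ce).1) frame0.
Qed.

(** Change of local trivialization of the projective frames. The component [xi] is unchanged because
    the reference sections of all charts come from the same connection; see [ptrans_jet]. *)
Definition ptrans c c' e : pgl R p q :=
  (trans c c' e.1.1, glof (tjac c c' e.1.1 *m glmx e.1.2), e.2).

Lemma tjac_glmx c c' x (a : gl R p q) : tdom c c' x ->
  glmx (glof (tjac c c' x *m glmx a)) = tjac c c' x *m glmx a.
Proof.
move=> ce; apply: glofK => v v0; rewrite -mulmxA (dsubmx_tjac AO _ ce).
by rewrite dsubmx_glmx v0 !mulmx0.
Qed.

Lemma ptrans_jet c c' e : PF_cod c e -> tdom c c' e.1.1 ->
  jet_eq 2 (trans c c' \o frame_model c e) (frame_model c' (ptrans c c' e)) /\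
  forall v w, 'D_(glmx e.1.2 *m v)
      (fun y => 'D_(glmx e.1.2 *m w) (trans c c') y) e.1.1 =
    hess (G c' (param c e.1.1)) (tjac c c' e.1.1 *m glmx e.1.2) (row_mx 0 e.2) v w -
    tjac c c' e.1.1 *m hess (G c (param c e.1.1)) (glmx e.1.2) (row_mx 0 e.2) v w.
Proof.
move=> ce cc'; have [_ _ E0] := tdomV AO cc'.
rewrite /frame_model /ptrans /= E0 tjac_glmx//.
apply: (model_transition _ _ (frame_quadratic ce) _ (open_tdom AO c c')) => //.
- exact: ch_quad CH _ _ cc'.2.
- exact: trans_smooth.
- by move=> v; exact: derive_trans.
- by move=> Z; exact: ch_law.
Qed.

Lemma PF_trans c c' e : PF_cod c e -> cdom c' (param c e.1.1) ->
  PF_cod c' (ptrans c c' e) /\ PF_param G c e = PF_param G c' (ptrans c c' e).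
Proof.
move=> ce c'e; have cc' : tdom c c' e.1.1 by split; [exact: ce.1|].
have [cV E1 E2] := tdomV AO cc'.
have c'e' : PF_cod c' (ptrans c c' e).
  split; first exact: cV.1.
  rewrite -glmx_unit /ptrans /= tjac_glmx// unitmx_mul (tjac_unit AO cc') glmx_unit.
  exact: ce.2.
split=> //; have [ag J] := frame_germ ce; have [ag' J'] := frame_germ c'e'.
apply: (jet_eqP AO (leqnn 2) (c := c') _ ag').
- by apply: (chart_germ_change AO ag); rewrite frame0.
- by rewrite -[LHS]/(frame c e 0) -[RHS]/(frame c' (ptrans c c' e) 0) !frame0.
- exact: jet_eq_trans (ptrans_jet ce cc').1 (jet_eq_sym (J' 2)).
Qed.

Lemma PFP u : PF G u <-> exists c e, PF_cod c e /\ u = PF_param G c e.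
Proof.
split=> [[c [m [h [cm hH ->]]]]|[c [e [ce ->]]]]; last first.
  have [cp E1] := ao_paramK AO ce.1.
  exists c, (param c e.1.1), (e.1.2, e.2, 1); split=> //.
    by apply/andP; split; [exact: ce.2|exact: oner_neq0].
  by rewrite E1.
have [cc _] := ao_coordK AO cm; case/andP: hH => ha h0.
exists c, ((coord c m, h.2^-1 *: h.1.1), h.2^-1 *: h.1.2); split.
  split=> //=; rewrite -glmx_unit glmxZ unitmxZ ?glmx_unit//.
  by rewrite unitfE invr_eq0.
by rewrite (homographyE h0).
Qed.

Lemma open_PF_cod c : open (@PF_cod R p q T A c).
Proof.
have l1 : linear (fun e : pgl R p q => e.1.1) by [].
have l2 : linear (fun e : pgl R p q => glmx e.1.2).
  by move=> k x y; rewrite -linear_glmx.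
have o1 : open (setT `&` (fun e : pgl R p q => e.1.1) @^-1` ccod c).
  apply: (open_preimage openT _ (ao_open AO c)) => x _; exact: linear_diff.
have dd : diffk 0 setT (fun e : pgl R p q => \det (glmx e.1.2)).
  by apply: diffk_det; [exact: openT|exact: diffk_lin l2].
have o2 := open_preimage openT dd.1 (@open_neq R 0).
have -> : @PF_cod R p q T A c = (setT `&` (fun e : pgl R p q => e.1.1) @^-1` ccod c)
   `&` (setT `&` (fun e : pgl R p q => \det (glmx e.1.2)) @^-1` [set x | x != 0]).
  apply/seteqP; split=> e.
    by move=> [h1 h2]; split; split=> //=; rewrite -unitfE -unitmxE glmx_unit.
  move=> [[_ h1] [_ h2]]; split=> //.
  by move: h2; rewrite /preimage /= -unitfE -unitmxE glmx_unit.
exact: openI.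
Qed.

Lemma ract_PF c e (b : gl R p q) (eta : 'rV[R]_q) : PF_cod c e ->
  ract A (PF_param G c e) (b, eta, 1) =
  PF_param G c (e.1.1, glof (glmx e.1.2 *m glmx b), e.2 *m b.2 + eta).
Proof.
move=> ce; have [fg _] := frame_germ ce.
have [gg g0 J] := get_jet AO (leqnn 2) fg.
have hE a xi : homography (a, xi, 1) = hom (glmx a) (row_mx 0 xi) :> (E -> E) by [].
have glE : glmx (glof (glmx e.1.2 *m glmx b)) = glmx e.1.2 *m glmx b.
  by apply: glofK => v v0; rewrite -mulmxA !dsubmx_glmx v0 !mulmx0.
have rE : row_mx 0 (e.2 *m b.2 + eta) =
    row_mx 0 e.2 *m glmx b + row_mx 0 eta :> 'rV_(p + q).
  by rewrite /glmx mul_row_block !mul0mx !mulmx0 !add0r add_row_mx add0r.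
pose e' : pgl R p q :=
  (e.1.1, glof (glmx e.1.2 *m glmx b), e.2 *m b.2 + eta).
set f := get _ in gg g0 J.
have f'0 : (f \o homography (b, eta, 1)) 0 = param c e.1.1.
  by rewrite /= hE hom0 g0 frame0.
apply: jet_ext; rewrite f'0.
  by rewrite -[RHS]/(param c (frame_model c e' 0)) /frame_model model0//; exact:
    frame_quadratic ce.
set c0 := pref A _.
have c00 : cdom c0 (frame c e 0).
  by rewrite frame0//; apply: (ao_pref AO (c := c)); have [] := ao_paramK AO ce.1.
have [U1 [oU1 U10 Uf1 sf1 _]] := chart_germ_change AO fg c00.
have [U2 [oU2 U20 Uf2 sf2 _]] : chart_germ c0 f by apply: (chart_germ_change AO gg); rewrite g0.
have J0 := jet_change AO (leqnn 2) fg gg (esym g0) c00 J.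
pose H := hom (glmx b) (row_mx 0 eta); pose D := hom_dom (row_mx (0 : 'rV[R]_p) eta).
pose U' := U1 `&` U2; have oU' : open U' by exact: openI.
have oD : open D by exact: open_hom_dom.
pose U := D `&` H @^-1` U'.
have oU : open U.
  by apply: (open_preimage oD _ oU') => z; exact: diffk_diff (diffk_hom _ _ 0).
have U0 : U 0 by split; [exact: hom_dom0|rewrite /preimage /= /H hom0].
have sH : diffk 1 U H by apply: diffk_sub (diffk_hom _ _ 1) => z [].
(* The chosen representative [f] is replaced by the explicit frame, whose composition with a
   homography is again explicit. *)
have HH : jet_eq 2 (fun z => (coord c0 \o f) (H z)) (fun z => (coord c0 \o frame c e) (H z)).
  apply: (jet_eq_comp (leqnn 2) oU oU oU' U0 U0 _ _ sH sH) => //.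
  - by move=> z [].
  - by move=> z [].
  - by apply: diffk_sub (sf2 1%N) => z [].
  - by apply: diffk_sub (sf1 1%N) => z [].
  - by move=> vs hs; rewrite /H hom0; apply/esym; exact: J0.
apply: jet_eq_trans HH _.
apply: (jet_eq_local oD (hom_dom0 _)) => z /set_mem Dz.
rewrite /= /frame /= !hE; congr (coord c0 (proj_frame G c e.1.1 _)).
by rewrite glE rE; exact: hom_comp.
Qed.

End PFrames.
End Frames.

Lemma derive_mulmx {R : realType} (V : normedModType R) m n k
    (F : V -> 'M[R]_(m, n)) (H : V -> 'M[R]_(n, k)) x v :
  differentiable F x -> differentiable H x ->
  differentiable (fun y => F y *m H y) x /\
  'D_v (fun y => F y *m H y) x = 'D_v F x *m H x + F x *m 'D_v H x.
Proof.
move=> dF dH.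
have dFi i j : differentiable (fun y => F y i j : R) x.
  exact: (differentiable_comp (g := fun M : 'M[R]_(m, n) => M i j : R) dF
    (linear_diff _ (@linear_mxE R m n i j))).
have dHi i j : differentiable (fun y => H y i j : R) x.
  exact: (differentiable_comp (g := fun M : 'M[R]_(n, k) => M i j : R) dH
    (linear_diff _ (@linear_mxE R n k i j))).
have dZ i j l : differentiable (fun y => F y i l *: H y l j : R) x.
  exact: differentiableZlr.
have EF : (fun y => F y *m H y) =
    (fun y => \matrix_(i, j) \sum_l (F y i l *: H y l j : R)).
  by apply/funext => y; apply/matrixP => i j; rewrite !mxE.
have dFH : differentiable (fun y => F y *m H y) x.
  apply: differentiable_mx => i j.
  have -> : (fun y => (F y *m H y) i j) = (fun y => \sum_l (F y i l *: H y l j : R)).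
    by apply/funext => y; rewrite mxE.
  exact: (derive_sumf 0 (dZ i j)).1.
split=> //; apply/matrixP => i j; rewrite derive_mxE; last exact: diff_derivable.
have -> : (fun y => (F y *m H y) i j) = (fun y => \sum_l (F y i l *: H y l j : R)).
  by apply/funext => y; rewrite mxE.
have [_ ->] := derive_sumf v (dZ i j).
rewrite !mxE -big_split; apply: eq_bigr => l _ /=.
rewrite (@derive_mxE R V m n F x v i l (diff_derivable dF)).
rewrite (@derive_mxE R V n k H x v l j (diff_derivable dH)).
exact: deriveZlr.
Qed.

(** * Linear frames *)

Section LinearFrames.
Context {R : realType} {p q : nat}.
Local Notation E := 'cV[R]_(p + q).

Lemma open_charted_ok (D : set E) : open D -> atlas_ok (open_charted D).
Proof.
move=> oD; have E1 : (id \o id : E -> E) = id by [].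
split=> //=.
- by move=> _ _; rewrite (_ : [set e | _] = D)//; apply/seteqP; split=> // e [].
- move=> _ _ k; rewrite E1; exact: diffk_lin.
- by move=> _ _ e v _ _ v0; rewrite E1 derive_id.
Qed.

Context {T : pointedType} (A : charted T E).
Hypothesis AO : atlas_ok A.
Implicit Types (c : cidx A) (f g : E -> T).

Lemma quadratic_zero n : @quadratic R n (fun=> 0).
Proof.
exists (fun _ _ => 0) => Z; rewrite big1// => i _; rewrite big1// => j _.
by rewrite scaler0.
Qed.

(** Linear frames are models with zero Christoffel form and [xi = 0], so the lemmas on models apply
    to them. *)
Lemma lin_frameE c x (a : gl R p q) :
  lin_frame c x a = fun Z => param c (model x (fun=> 0) (glmx a) (row_mx 0 0) Z).
Proof.
apply/funext => Z; rewrite /lin_frame /model /hom row0_mul mul0mx mxE add0r invr1.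
by rewrite scale1r scaler0 subr0.
Qed.

Lemma lin_germ c x (a : gl R p q) : ccod c x -> isGL a ->
  chart_germ c (lin_frame c x a) /\
  forall r, jet_eq r (coord c \o lin_frame c x a)
    (model x (fun=> 0) (glmx a) (row_mx 0 0)).
Proof. by move=> cx ga; rewrite lin_frameE; exact: model_germ (quadratic_zero _) _ _. Qed.

Lemma lin_frame0 c x (a : gl R p q) : lin_frame c x a 0 = param c x.
Proof. by rewrite /lin_frame mulmx0 addr0. Qed.

Lemma LF_param_inj c e e' : LF_cod c e -> LF_cod c e' ->
  LF_param c e = LF_param c e' -> e = e'.
Proof.
move=> ce ce' ee'; have [ag J] := lin_germ ce.1 ce.2.
have [ag' J'] := lin_germ ce'.1 ce'.2.
have [E0 JJ] := jet_inj AO (leqnSn 1) ag ag' ee'.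
have := jet_eq_trans (jet_eq_sym (J 1)) (jet_eq_trans JJ (J' 1)).
move=> /jet_eq1P[E1 E2]; rewrite !model0 in E1; try exact: quadratic_zero.
have E3 : glmx e.2 = glmx e'.2.
  apply: mulmx_inj => v.
  by have := E2 v; rewrite !derive_model0; try exact: quadratic_zero.
by move: E1 E3; case: e {ce ee' ag J JJ E0 E2} => ? ?;
   case: e' {ce' ag' J'} => ? ? /= -> /glmx_inj ->.
Qed.

Lemma LF_coordK c e : LF_cod c e -> @coord _ _ _ (LF A) c (LF_param c e) = e.
Proof.
move=> ce; rewrite /=.
have : [set e' | LF_cod c e' /\ LF_param c e' = LF_param c e]
    (get [set e' | LF_cod c e' /\ LF_param c e' = LF_param c e]).
  by apply: getPex; exists e.
by move=> [ce' /LF_param_inj]; exact.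
Qed.

Lemma jbase_LF c e : LF_cod c e -> jbase (LF_param c e) = param c e.1.
Proof.
by move=> ce; rewrite (jbase_jet AO (leqnSn 1) (lin_germ ce.1 ce.2).1) lin_frame0.
Qed.

Lemma jet1_LF c f e : chart_germ c f -> LF_cod c e -> f 0 = param c e.1 ->
  (forall v, 'D_v (coord c \o f) 0 = glmx e.2 *m v) -> jet A 1 f = LF_param c e.
Proof.
move=> cf ce f0 Df; have [ag J] := lin_germ ce.1 ce.2.
apply: (jet_eqP AO (leqnSn 1) cf ag); first by rewrite lin_frame0.
apply: jet_eq_trans (jet_eq_sym (J 1)); apply/jet_eq1P; split.
  by rewrite model0; [rewrite /= f0; have [] := ao_paramK AO ce.1|exact: quadratic_zero].
by move=> v; rewrite Df derive_model0//; exact: quadratic_zero.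
Qed.

Lemma p2_PF (G : cidx A -> T -> E -> E) (CH : christ_ok G) c e : PF_cod c e ->
  p2 A (PF_param G c e) = LF_param c e.1.
Proof.
move=> ce; have [fg J] := frame_germ AO CH ce.
have [gg g0 J'] := get_jet AO (leqnn 2) fg.
apply: (jet1_LF gg ce); first by rewrite g0 (frame0 AO CH).
move=> v; have := jet_eq_trans (jet_eq_sym (J 2)) J'.
move=> /jet_eq2P[_ <- _]; apply: derive_model0; exact: (frame_quadratic AO CH ce).
Qed.

End LinearFrames.

Section Theta.
Context {R : realType} {p q : nat} {T : pointedType} (A : charted T 'cV[R]_(p + q)).
Hypothesis AO : atlas_ok A.
Local Notation E := 'cV[R]_(p + q).
Implicit Types (c : cidx A) (f : E -> T).
Local Notation Rn := (open_charted [set: E]).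

Lemma Rn_ok : atlas_ok Rn. Proof. exact: open_charted_ok openT. Qed.

Lemma comp_germ c f (U : set E) (g : E -> E) :
  open U -> (forall z, U z -> cdom c (f z)) -> diff_infty U (coord c \o f) ->
  (forall z, U z -> jac (coord c \o f) z \in unitmx /\
    glmx (glof (jac (coord c \o f) z)) = jac (coord c \o f) z) ->
  chart_germ (A := Rn) tt g -> U (g 0) ->
  chart_germ c (f \o g) /\
  forall v, 'D_v (coord c \o (f \o g)) 0 = jac (coord c \o f) (g 0) *m 'D_v g 0.
Proof.
move=> oU Uf sf jf [V [oV V0 _ sg jg]] Ug0.
have E1 : (coord (c := Rn) tt \o g) = g by [].
rewrite E1 in sg jg.
pose W := V `&` g @^-1` U.
have oW : open W by apply: (open_preimage oV _ oU) => z; exact: diffoo_diff.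
have sfg : diff_infty W (fun z => (coord c \o f) (g z)).
  move=> k; apply: (diffk_comp oW oU) (sf k) => [z []//|].
  by apply: diffk_sub (sg k) => z [].
have DE z v : W z -> 'D_v (fun z => (coord c \o f) (g z)) z =
    jac (coord c \o f) (g z) *m (jac g z *m v).
  move=> Wz; have d1 := diffoo_diff sg Wz.1; have d2 := diffoo_diff sf Wz.2.
  by rewrite (derive_comp v d1 d2) (derive_jac _ d2) (derive_jac _ d1).
have jE z : W z -> jac (coord c \o (f \o g)) z = jac (coord c \o f) (g z) *m jac g z.
  move=> Wz; apply: mulmx_inj => v.
  by rewrite -derive_jac ?DE ?mulmxA//; exact: diffoo_diff sfg Wz.
split; last first.
  move=> v; have W0 : W 0 by split.
  by apply: (etrans (DE 0 v W0)); rewrite -(derive_jac v (diffoo_diff sg V0)).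
exists W; split=> //.
- by move=> z [_ /Uf].
- move=> z Wz; rewrite jE//; have [u1 g1] := jf _ Wz.2; have [u2 g2] := jg _ Wz.1.
  rewrite unitmx_mul u1 u2; split=> //; apply: glofK => v v0.
  rewrite -mulmxA -g1 -g2 !dsubmx_glmx v0.
  by move: (glof _).2 (glof _).2 => B C; rewrite !mulmx0.
Qed.

(** [P1 A f] in linear frame coordinates is [(z, b) |-> (f z, f'(z) b)]. It is needed at all frames
    near the identity, in order to be differentiated there. *)
Lemma P1_LF c f (U : set E) z (b : gl R p q) :
  open U -> (forall z, U z -> cdom c (f z)) -> diff_infty U (coord c \o f) ->
  (forall z, U z -> jac (coord c \o f) z \in unitmx /\
    glmx (glof (jac (coord c \o f) z)) = jac (coord c \o f) z) ->
  U z -> isGL b ->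
  P1 A f (LF_param (A := Rn) tt (z, b)) =
  LF_param c (coord c (f z), glof (jac (coord c \o f) z *m glmx b)) /\
  (LF_cod c (coord c (f z), glof (jac (coord c \o f) z *m glmx b)) /\
   glmx (glof (jac (coord c \o f) z *m glmx b)) = jac (coord c \o f) z *m glmx b).
Proof.
move=> oU Uf sf jf Uz gb.
have [lg _] := lin_germ Rn_ok (c := tt) (x := z) I gb.
have [gg g0 /jet_eq1P[_ J]] := get_jet Rn_ok (leqnSn 1) lg.
rewrite lin_frame0 in g0.
have Ug0 : U (get (LF_param (A := Rn) tt (z, b)) 0) by rewrite g0.
have [fg Dfg] := comp_germ oU Uf sf jf gg Ug0.
have [uz fz] := jf _ Uz.
have gE : glmx (glof (jac (coord c \o f) z *m glmx b)) = jac (coord c \o f) z *m glmx b.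
  by apply: glofK => v v0; rewrite -mulmxA -fz !dsubmx_glmx v0 !mulmx0.
have [cz Ez] := ao_coordK AO (Uf _ Uz).
have cod : LF_cod c (coord c (f z), glof (jac (coord c \o f) z *m glmx b)).
  by split=> //=; rewrite -glmx_unit gE unitmx_mul uz glmx_unit.
split; last by split.
apply: (jet1_LF AO fg cod) => [|v]; first by rewrite /= g0 Ez.
rewrite Dfg g0 gE -mulmxA; congr (_ *m _).
have /= <- := J v.
have [_ JJ] := lin_germ Rn_ok (c := tt) (x := z) I gb.
have /jet_eq1P[_ ->] := JJ 1%N.
by rewrite derive_model0//; exact: quadratic_zero.
Qed.

End Theta.

(** * The canonical form *)

Lemma diffk_mulmx {R : realType} (V : normedModType R) m n p k (U : set V)
    (F : V -> 'M[R]_(m, n)) (H : V -> 'M[R]_(n, p)) :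
  open U -> diffk k U F -> diffk k U H -> diffk k U (fun y => F y *m H y).
Proof.
move=> oU dF dH; apply: diffk_mx => // i j.
apply: (diffk_ext (F := fun y => \sum_l F y i l * H y l j)) => //.
  by move=> y _; rewrite mxE.
by apply: diffk_sumf => // l; apply: diffkM => //; exact: diffk_mxE.
Qed.

Section PTrans.
Context {R : realType} {p q : nat} {T : pointedType} (A : charted T 'cV[R]_(p + q)).
Hypothesis AO : atlas_ok A.
Local Notation E := 'cV[R]_(p + q).
Implicit Types (c : cidx A) (f : E -> T) (e Y : pgl R p q).

Definition pdom c c' : set (pgl R p q) :=
  [set e | PF_cod c e /\ tdom c c' e.1.1].

Lemma linear_base : linear (fun e : pgl R p q => e.1.1). Proof. by []. Qed.
Lemma linear_fiber : linear (fun e : pgl R p q => glmx e.1.2).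
Proof. by move=> k x y; rewrite -linear_glmx. Qed.
Lemma linear_frame : linear (fun e : pgl R p q => e.1). Proof. by []. Qed.
Lemma linear_xi : linear (fun e : pgl R p q => e.2). Proof. by []. Qed.

Lemma open_pdom c c' : open (pdom c c').
Proof.
have o1 : open (@PF_cod R p q T A c) by exact: open_PF_cod.
have -> : pdom c c' = PF_cod c `&` (fun e : pgl R p q => e.1.1) @^-1` tdom c c'.
  by apply/seteqP; split.
apply: (open_preimage o1 _ (open_tdom AO c c')) => x _.
exact: linear_diff linear_base.
Qed.
Arguments open_pdom : clear implicits.

Lemma diff_tjac_base c c' k : diffk k (pdom c c') (fun e => tjac c c' e.1.1).
Proof.
have o := open_pdom c c'; have ot := open_tdom AO c c'.
apply: (diffk_comp (F := fun e : pgl R p q => e.1.1) (G := tjac c c') o ot).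
- by move=> e [].
- exact: diffk_lin linear_base.
- by apply: diffk_jac => //; exact: trans_smooth.
Qed.

Lemma diff_ptrans_fiber c c' k :
  diffk k (pdom c c') (fun e => tjac c c' e.1.1 *m glmx e.1.2).
Proof.
apply: diffk_mulmx; [exact: open_pdom|exact: diff_tjac_base|].
exact: diffk_lin linear_fiber.
Qed.

Lemma diff_trans_base c c' k : diffk k (pdom c c') (fun e => trans c c' e.1.1).
Proof.
apply: (diffk_comp (F := fun e : pgl R p q => e.1.1) (G := trans c c')
  (open_pdom c c') (open_tdom AO c c')).
- by move=> e [].
- exact: diffk_lin linear_base.
- exact: trans_smooth.
Qed.

Lemma ptrans_smooth c c' k : diffk k (pdom c c') (ptrans c c').
Proof.
have o := open_pdom c c'; apply: diffk_pair => //; last exact: diffk_lin linear_xi.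
apply: diffk_pair => //; first exact: diff_trans_base.
exact: (diffk_linear o (@linear_glof R p q) (diff_ptrans_fiber c c' k)).
Qed.

Lemma derive_ptrans c c' e Y : pdom c c' e ->
  [/\ ('D_Y (ptrans c c') e).1.1 = tjac c c' e.1.1 *m Y.1.1,
      glmx ('D_Y (ptrans c c') e).1.2 =
        'D_(Y.1.1) (tjac c c') e.1.1 *m glmx e.1.2 + tjac c c' e.1.1 *m glmx Y.1.2 &
      ('D_Y (ptrans c c') e).2 = Y.2].
Proof.
move=> ce; have o := open_pdom c c'.
have dp : differentiable (ptrans c c') e := (ptrans_smooth c c' 0).1 _ ce.
split.
- rewrite -(derive_linear Y linear_base dp) -[LHS]/('D_Y (fun y => trans c c' y.1.1) e).
  rewrite (derive_precomp (trans c c') e Y linear_base).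
  exact: (derive_trans AO _ ce.2).
- rewrite -(derive_linear Y linear_fiber dp).
  rewrite (derive_ext (G := fun e => tjac c c' e.1.1 *m glmx e.1.2) Y o ce); last first.
    by move=> y /set_mem[_ hy]; rewrite /ptrans /= (tjac_glmx AO).
  have d1 := (diff_tjac_base c c' 0).1 _ ce.
  have d2 : differentiable (fun e : pgl R p q => glmx e.1.2) e.
    exact: linear_diff linear_fiber.
  have [_ ->] := derive_mulmx Y d1 d2.
  by rewrite (linear_derive e Y linear_fiber) (derive_precomp (tjac c c') e Y linear_base).
- rewrite -(derive_linear Y linear_xi dp) -[LHS]/('D_Y (fun y : pgl R p q => y.2) e).
  exact: linear_derive linear_xi.
Qed.

Variable G : cidx A -> T -> E -> E.
Hypothesis CH : christ_ok G.

Lemma coord_PF_ptrans c c' e : pdom c c' e ->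
  @coord _ _ _ (PFc G) c' (PF_param G c e) = ptrans c c' e.
Proof.
move=> [ce [_ c'e]]; have [ce' ->] := PF_trans AO CH ce c'e.
exact: (PF_coordK AO CH ce').
Qed.

Lemma cvec_PF c e Y : PF_cod c e ->
  let c' := pref A (param c e.1.1) in
  pdom c c' e /\
  cvec (C := PFc G) c Y (PF_param G c e) = 'D_Y (ptrans c c') e.
Proof.
move=> ce c'; have [cp _] := ao_paramK AO ce.1.
have pe : pdom c c' e by split=> //; split; [exact: ce.1|exact: (ao_pref AO cp)].
split; first exact: pe.
rewrite /cvec (PF_coordK AO CH ce) /= (jbase_PF AO CH ce) -/c'.
apply: (derive_ext _ (open_pdom c c') pe) => y /set_mem ye.
exact: coord_PF_ptrans.
Qed.

Local Notation Rn := (open_charted [set: E]).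

(** The defining equation of the canonical form in coordinates: [p2] becomes the linear projection
    [e |-> e.1], and the other side is the differential of [(z, b) |-> (F z, F'(z) b)] at the
    identity frame. *)
Lemma theta_pref (w : set (E -> T) -> pgl R p q -> pgl R p q) c e X f
    (F := coord c \o f) :
  has_canonical_part G w -> PF_cod c e -> PF_param G c e f ->
  c = pref A (param c e.1.1) ->
  X.1.1 = jac F 0 *m (w (PF_param G c e) X).1.1 /\
  glmx X.1.2 = 'D_((w (PF_param G c e) X).1.1) (jac F) 0 +
     jac F 0 *m glmx (w (PF_param G c e) X).1.2.
Proof.
move=> can ce uf cE; set u := PF_param G c e in uf *.
have uP : PF G u by apply/PFP => //; exists c, e.
have [cp E0] := ao_paramK AO ce.1.
have [fa f00 _] := uf.
have f0 : f 0 = param c e.1.1 by rewrite f00; exact: (frame0 AO CH ce).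
have cf : chart_germ c f by apply: (adapted_chart_germ AO fa); rewrite f0.
have [U [oU U0 Uf sf jf]] := cf.
have H : forall z b, U z -> isGL b -> _ := fun z b => P1_LF AO oU Uf sf jf.
have := can u f uP uf X; rewrite /tmap.
have g1 : isGL (@glid R p q) by rewrite /isGL /= !unitmx1.
have glid1 : glmx (@glid R p q) = 1%:M by rewrite /glmx /glid /= -scalar_mx_block.
have cod0 : LF_cod (A := Rn) tt (0, @glid R p q) by split.
have E1 : jet Rn 1 id = LF_param (A := Rn) tt (0, @glid R p q).
  rewrite /LF_param; congr (jet Rn 1 _); apply/funext => Z.
  by rewrite /lin_frame /= glid1 mul1mx add0r.
have E2 : coord (c := LF Rn) (pref (LF Rn) (jet Rn 1 id)) (jet Rn 1 id) = (0, @glid R p q).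
  by rewrite E1; exact: (LF_coordK (Rn_ok (p := p) (q := q)) cod0).
rewrite E2 [in X in X = _ -> _]E1.
have [P1E [cod1 _]] := H 0 _ U0 g1.
have E3 : pref (LF A) (P1 A f (LF_param (A := Rn) tt (0, @glid R p q))) = c.
  rewrite P1E /= (jbase_LF AO cod1) /=.
  by have [_ ->] := ao_coordK AO (Uf _ U0); rewrite f0 -cE.
rewrite E3.
have E4 : pref (PFc G) u = c by rewrite /= (jbase_PF AO CH ce) -cE.
have E5 : pref (LF A) (p2 A u) = c.
  by rewrite (p2_PF AO CH ce) /= (jbase_LF AO ce) -cE.
rewrite E4 E5 (PF_coordK AO CH ce : coord (c := PFc G) c u = e).
rewrite [RHS](derive_ext (G := fun e : pgl R p q => e.1) X (@open_PF_cod R p q T A AO c) ce);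
  last first.
  move=> y /set_mem cy; rewrite /= -/(PF_param G c y) (p2_PF AO CH cy).
  exact: (LF_coordK AO cy).
rewrite (linear_derive e X linear_frame).
set vk := (w u X).1.
pose V : set (E * gl R p q)%type := [set zb | U zb.1 /\ isGL zb.2].
have lf : linear (fun zb : (E * gl R p q)%type => zb.1) by [].
have ls : linear (fun zb : (E * gl R p q)%type => zb.2) by [].
have lg : linear (fun zb : (E * gl R p q)%type => glmx zb.2).
  by move=> k x y; rewrite -linear_glmx.
have oV : open V.
  have o1 := open_preimage openT (fun x _ => linear_diff x lf) oU.
  have dd : diffk 0 setT (fun zb : (E * gl R p q)%type => \det (glmx zb.2)).
    by apply: diffk_det; [exact: openT|exact: diffk_lin lg].
  have -> : V = (setT `&` (fun zb : (E * gl R p q)%type => zb.1) @^-1` U) `&`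
     (setT `&` (fun zb : (E * gl R p q)%type => \det (glmx zb.2)) @^-1` [set x | x != 0]).
    apply/seteqP; split=> zb.
      by move=> [h1 h2]; split; split=> //=; rewrite -unitfE -unitmxE glmx_unit.
    move=> [[_ h1] [_ h2]]; split=> //.
    by move: h2; rewrite /preimage /= -unitfE -unitmxE glmx_unit.
  apply: openI; first exact: o1.
  exact: open_preimage openT dd.1 (@open_neq R 0).
have V0 : V (0, glid) by split.
pose Phi (zb : (E * gl R p q)%type) := (F zb.1, glof (jac F zb.1 *m glmx zb.2)).
rewrite (derive_ext (G := Phi) vk oV V0); last first.
  move=> [z b] /set_mem[/= Uz gb]; have [-> [cod _]] := H z b Uz gb.
  exact: (LF_coordK AO cod).
move=> XE.
have sFl k : diffk k V (fun zb => F zb.1).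
  apply: (diffk_comp (F := fun zb : (E * gl R p q)%type => zb.1) (G := F) oV oU).
  - by move=> zb [].
  - exact: diffk_lin lf.
  - exact: sf.
have sJ k : diffk k V (fun zb => jac F zb.1).
  apply: (diffk_comp (F := fun zb : (E * gl R p q)%type => zb.1) (G := jac F) oV oU).
  - by move=> zb [].
  - exact: diffk_lin lf.
  - exact: diffk_jac (sf k.+1).
have sM k : diffk k V (fun zb => jac F zb.1 *m glmx zb.2).
  by apply: diffk_mulmx; [exact: oV|exact: sJ|exact: diffk_lin lg].
have dPhi : differentiable Phi (0, @glid R p q).
  have sP : diffk 0 V Phi.
    exact: (diffk_pair oV (sFl 0%N)
      (diffk_linear oV (@linear_glof R p q) (sM 0%N))).
  exact: sP.1.
split.
  rewrite -XE -(derive_linear vk lf dPhi) -[LHS]/('D_vk (fun zb => F zb.1) (0, glid)).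
  rewrite (derive_precomp F (0, glid) vk lf).
  exact: (derive_jac _ (diffoo_diff sf U0)).
rewrite -XE -(derive_linear vk lg dPhi).
rewrite (derive_ext (G := fun zb => jac F zb.1 *m glmx zb.2) vk oV V0); last first.
  by move=> [z b] /set_mem[/= Uz gb]; have [_ [_ ->]] := H z b Uz gb.
have [_ ->] := derive_mulmx vk ((sJ 0%N).1 _ V0) (linear_diff (0, glid) lg).
rewrite (derive_precomp (jac F) (0, glid) vk lf) (linear_derive _ _ lg) /=.
by rewrite glid1 mulmx1.
Qed.

(** The equation of [theta_pref] in the preferred chart is pulled back to [c]. The transition
    Jacobians cancel and the second derivatives combine into one hessian in [c], so that only [e],
    [Y] and the Christoffel form of [c] remain; in this shape the equation can be projected to the
    leaf space. *)
Lemma theta (w : set (E -> T) -> pgl R p q -> pgl R p q) c e Y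
    (u := PF_param G c e) (vk := (w u (cvec (C := PFc G) c Y u)).1) :
  has_canonical_part G w -> PF_cod c e ->
  Y.1.1 = glmx e.1.2 *m vk.1 /\
  forall v : E, glmx Y.1.2 *m v = glmx e.1.2 *m (glmx vk.2 *m v) +
    hess (G c (param c e.1.1)) (glmx e.1.2) (row_mx 0 e.2) vk.1 v.
Proof.
move=> can ce; set c' := pref A (param c e.1.1).
have [pe cE] := cvec_PF Y ce.
have [_ [_ c'e]] := pe; have cc' := pe.2; have [_ _ E0] := tdomV AO cc'.
have [ce' uE] := PF_trans AO CH ce c'e.
have [fg J1] := frame_germ AO CH ce'.
have [gg g0 J2] := get_jet AO (leqnn 2) fg.
set f := get _ in gg g0 J2.
have uf : PF_param G c' (ptrans c c' e) f.
  by rewrite /f; apply: getPex; exists (frame G c' (ptrans c c' e)); split;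
     [exact: (chart_germ_adapted AO fg)|by []|by []].
have c'E : c' = pref A (param c' (ptrans c c' e).1.1) by rewrite /ptrans /= E0.
have := theta_pref (cvec (C := PFc G) c Y u) can ce' uf c'E.
rewrite -uE -/u -/vk cE; have [D1 D2 _] := derive_ptrans Y pe.
rewrite D1 D2; set F := coord c' \o f.
have JJ := jet_eq_trans (jet_eq_sym (J1 2)) J2.
have qe' := frame_quadratic AO CH ce'.
have /jet_eq2P[_ F1 F2] := JJ.
have [U [oU U0 Uf sf jf]] := gg.
have DF v : 'D_v F 0 = tjac c c' e.1.1 *m (glmx e.1.2 *m v).
  by rewrite -(F1 v) (derive_model0 _ _ _ _ qe') /= (tjac_glmx AO _ cc') mulmxA.
have DDF v x : 'D_v (fun z => 'D_x F z) 0 =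
    hess (G c' (param c e.1.1)) (tjac c c' e.1.1 *m glmx e.1.2) (row_mx 0 e.2) v x.
  by rewrite -(F2 v x) (derive2_model0 _ _ _ _ _ qe') /= (tjac_glmx AO _ cc') E0.
have dF0 := diffoo_diff sf U0.
have jF : jac F 0 = tjac c c' e.1.1 *m glmx e.1.2.
  by apply: mulmx_inj => v; rewrite -(derive_jac v dF0) DF mulmxA.
have uJ := tjac_unit AO cc'.
have Jinj m (M N : 'M[R]_(p + q, m)) : tjac c c' e.1.1 *m M = tjac c c' e.1.1 *m N -> M = N.
  by move=> /(congr1 (mulmx (invmx (tjac c c' e.1.1)))); rewrite !mulmxA mulVmx// !mul1mx.
rewrite jF -mulmxA => -[/Jinj YE YE2]; split=> // v.
apply: Jinj; have := congr1 (fun M => M *m v) YE2.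
rewrite !mulmxDl -!mulmxA.
have lv k : linear (fun M : 'M[R]_(p + q, k) => M) by [].
have lmv : linear (fun M : 'M[R]_(p + q) => M *m v).
  by move=> k M N; rewrite mulmxDl scalemxAl.
have djF : differentiable (jac F) 0.
  exact: (diffk_jac oU (sf 1%N)).1.
have E1 : 'D_(vk.1) (jac F) 0 *m v = 'D_(vk.1) (fun z => 'D_v F z) 0.
  rewrite -(derive_linear _ lmv djF); apply: (derive_ext _ oU U0) => z /set_mem Uz.
  by rewrite -(derive_jac v (diffoo_diff sf Uz)).
have lav : linear (fun M : 'M[R]_(p + q) => M *m (glmx e.1.2 *m v)).
  by move=> k M N; rewrite mulmxDl scalemxAl.
have djt : differentiable (tjac c c') e.1.1.
  have h : diffk 0 (tdom c c') (tjac c c').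
    by apply: (diffk_jac (open_tdom AO c c')); exact: trans_smooth.
  exact: (h.1 _ cc').
have E2 : 'D_(Y.1.1) (tjac c c') e.1.1 *m (glmx e.1.2 *m v) =
   'D_(Y.1.1) (fun y => 'D_(glmx e.1.2 *m v) (trans c c') y) e.1.1.
  rewrite -(derive_linear _ lav djt); apply: (derive_ext _ (open_tdom AO c c') cc').
  by move=> z /set_mem Uz; rewrite (derive_trans AO _ Uz).
(* [N2] is the second derivative of [f] in [c'] and [N1] that of the transition; by [ptrans_jet]
   they differ by [M4], the Jacobian applied to the hessian in [c]. *)
have alg (M1 M2 M3 M4 N1 N2 : E) : N1 = M3 - M4 -> N2 = M3 ->
    N1 + M1 = N2 + M2 -> M1 = M2 + M4.
  move=> -> -> EE; apply: (addrI (M3 - M4)); rewrite EE.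
  by rewrite [M2 + M4]addrC addrA subrK.
have E3 := etrans E1 (DDF vk.1 v).
rewrite [in X in _ = X]YE in E2.
have E4 := etrans E2 ((ptrans_jet AO CH ce cc').2 vk.1 v).
by move=> EE; rewrite mulmxDr; exact: alg E4 E3 EE.
Qed.

End PTrans.

(** * Comparison of the normal Cartan connections *)

Arguments open_PF_cod {R p q T A} AO c.

Lemma pgl_ext {R : realType} {p q : nat} (x y : pgl R p q) :
  x.1.1 = y.1.1 -> x.1.2 = y.1.2 -> x.2 = y.2 -> x = y.
Proof. by move: x y => [[? ?] ?] [[? ?] ?] /= -> -> ->. Qed.

Section Fundamental.
Context {R : realType} {p q : nat} {T : pointedType} (A : charted T 'cV[R]_(p + q)).
Hypothesis AO : atlas_ok A.
Local Notation E := 'cV[R]_(p + q).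
Variable G : cidx A -> T -> E -> E.
Hypothesis CH : christ_ok G.
Implicit Types (c : cidx A) (e X Y : pgl R p q).

(** In the trivialization of [c] the orbit map of the right action is affine near the identity,
    [e + lin h], by [ract_PF]; its differential is the linear part. *)
Lemma fundamental_PF c e (k : gl R p q * 'rV[R]_q) : PF_cod c e ->
  c = pref A (param c e.1.1) ->
  fundamental G (PF_param G c e) k =
  ((0, glof (glmx e.1.2 *m glmx k.1)), e.2 *m k.1.2 + k.2).
Proof.
move=> ce cE; rewrite /fundamental /= (jbase_PF AO CH ce) -cE.
pose V : set (gl R p q * 'rV[R]_q)%type := [set h | isGL (glid + h.1)].
pose lin (h : (gl R p q * 'rV[R]_q)%type) : pgl R p q :=
  ((0, glof (glmx e.1.2 *m glmx h.1)), e.2 *m h.1.2 + h.2).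
have llin : linear lin.
  move=> a x y; apply: pgl_ext => /=.
  - by rewrite scaler0 addr0.
  - by rewrite linear_glmx mulmxDr -scalemxAr linear_glof.
  - by rewrite /= mulmxDr -scalemxAr scalerDr addrACA.
have glid1 : glmx (@glid R p q) = 1%:M by rewrite /glmx /glid /= -scalar_mx_block.
have oV : open V.
  have dd : diffk 0 setT (fun h : (gl R p q * 'rV[R]_q)%type => \det (1%:M + glmx h.1)).
    apply: diffk_det; first exact: openT.
    apply: diffkD; [exact: openT|exact: diffk_cst|].
    apply: diffk_lin => a x y; exact: linear_glmx.
  have := open_preimage openT dd.1 (@open_neq R 0); rewrite (_ : _ `&` _ = V)//.
  apply/seteqP; split=> h; rewrite /V /preimage /= -glmx_unit.
    move=> [_ /=]; rewrite -unitfE -unitmxE.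
    by have := linear_glmx 1 (@glid R p q) h.1; rewrite !scale1r glid1 => ->.
  have := linear_glmx 1 (@glid R p q) h.1; rewrite !scale1r glid1 => ->.
  by rewrite unitmxE unitfE.
have V0 : V 0.
  by rewrite /V /= addr0 /isGL /= !unitmx1.
rewrite (derive_ext (G := fun h => e + lin h) k oV V0); last first.
  move=> h /set_mem gh; rewrite (ract_PF AO CH _ _ ce).
  have codh : PF_cod c (e.1.1, glof (glmx e.1.2 *m glmx (glid + h.1)),
      e.2 *m (glid + h.1).2 + h.2).
    split; first exact: ce.1.
    rewrite -glmx_unit /=.
    have -> : glmx (glof (glmx e.1.2 *m glmx (glid + h.1))) =
        glmx e.1.2 *m glmx (glid + h.1).
      by apply: glofK => v v0; rewrite -mulmxA !dsubmx_glmx v0 !mulmx0.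
    rewrite unitmx_mul !glmx_unit; apply/andP; split; [exact: ce.2|exact: gh].
  apply: (etrans (PF_coordK AO CH codh)).
  have -> : glmx (glid + h.1) = 1%:M + glmx h.1.
    by have := linear_glmx 1 (@glid R p q) h.1; rewrite !scale1r glid1.
  rewrite mulmxDr mulmx1; have := linear_glof 1 (glmx e.1.2) (glmx e.1.2 *m glmx h.1).
  rewrite !scale1r glmxK => ->.
  rewrite /= mulmxDr mulmx1 -addrA /lin.
  by apply: pgl_ext; rewrite //= addr0.
have dl : differentiable lin 0 by exact: linear_diff.
rewrite deriveDf; [|exact: differentiable_cst|exact: dl].
by rewrite (derive_cst e) add0r (linear_derive 0 k llin).
Qed.

Lemma cvec_pref c e X : PF_cod c e -> c = pref A (param c e.1.1) ->
  cvec (C := PFc G) c X (PF_param G c e) = X.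
Proof.
move=> ce cE; have E1 : pref (PFc G) (PF_param G c e) = c.
  by rewrite -[LHS]/(pref A (jbase (PF_param G c e))) (jbase_PF AO CH ce) -cE.
rewrite /cvec E1 (PF_coordK AO CH ce).
rewrite (derive_ext (G := id) X (open_PF_cod AO c) ce); first by rewrite derive_id.
by move=> y /set_mem cy; exact: (PF_coordK AO CH cy).
Qed.

(* The normalisation is a trace of [K]; feeding the curvature with the lifts of the
   transverse basis turns it into a trace of the curvature itself. *)
Lemma ricci w u (X : 'I_q -> pgl R p q) Y (j : 'I_q) : normal_cartan G w -> PF G u ->
  (forall i, (w u (X i)).1.1 = ev (rshift p i)) ->
  \sum_i (curvature G w u (X i) Y).1.2.2 i j = 0.
Proof.
move=> [_ _ _ [K KP]] uP wX; have [Ka KE Kr] := KP u uP.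
have E1 i : (curvature G w u (X i) Y).1.2.2 i j =
    \sum_l K u (rshift p i) (rshift p j) (rshift p i) l * (w u Y).1.1 l 0.
  have := KE (X i) Y (rshift p i) (rshift p j).
  rewrite {1}/glmx block_mxEdr => ->; rewrite wX.
  have -> : \sum_k \sum_l K u (rshift p i) (rshift p j) k l *
      ((ev (rshift p i) : E) k 0 * (w u Y).1.1 l 0
       - (w u Y).1.1 k 0 * (ev (rshift p i) : E) l 0) =
    \sum_l K u (rshift p i) (rshift p j) (rshift p i) l * (w u Y).1.1 l 0 +
    \sum_k K u (rshift p i) (rshift p j) (rshift p i) k * (w u Y).1.1 k 0.
    under eq_bigr => k _ do under eq_bigr => l _ do rewrite mulrBr.
    under eq_bigr do rewrite sumrB.
    rewrite sumrB; congr (_ + _).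
      rewrite (bigD1 (rshift p i)) //= [X in _ + X]big1 ?addr0 => [|k ki].
        by apply: eq_bigr => l _; rewrite mxE !eqxx mul1r.
      by apply: big1 => l _; rewrite mxE (negbTE ki) mul0r mulr0.
    rewrite -sumrN; apply: eq_bigr => k _.
    rewrite (bigD1 (rshift p i)) //= [X in _ + X]big1 ?addr0 => [|l li].
      by rewrite mxE !eqxx mulr1 Ka mulNr opprK.
    by rewrite mxE (negbTE li) !mulr0.
  by move: (\sum_l _) => s; lra.
under eq_bigr do rewrite E1.
rewrite exchange_big /=; apply: big1 => l _.
by rewrite -mulr_suml Kr mul0r.
Qed.

(** The scalar matrix comes from normalizing a class modulo scalars by subtracting the last diagonal
    entry. *)
Lemma bracket_dr (x y : pgl R p q) : (pgl_bracket x y).1.2.2 =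
  x.1.2.2 *m y.1.2.2 + dsubmx x.1.1 *m y.2 - (y.1.2.2 *m x.1.2.2 + dsubmx y.1.1 *m x.2)
  - ((x.2 *m dsubmx y.1.1 - y.2 *m dsubmx x.1.1) 0 0)%:M.
Proof.
rewrite /pgl_bracket /mx_pgl /pgl_mx !mulmx_block !(mulmx0, mul0mx, addr0) /=.
rewrite opp_block_mx add_block_mx !block_mxKul block_mxKdr.
have drD (M N : 'M[R]_(p + q)) : drsubmx (M + N) = drsubmx M + drsubmx N.
  by apply/matrixP => i j; rewrite !mxE.
have drN (M : 'M[R]_(p + q)) : drsubmx (- M) = - drsubmx M.
  by apply/matrixP => i j; rewrite !mxE.
have drC (v : E) (xi : 'rV[R]_q) : drsubmx (v *m row_mx 0 xi) = dsubmx v *m xi.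
  rewrite -[v in LHS]vsubmxK mul_col_row block_mxKdr //.
have dr1 (s : R) : drsubmx (s%:M : 'M[R]_(p + q)) = s%:M.
  by rewrite scalar_mx_block block_mxKdr.
by rewrite !(drD, drN) !block_mxKdr !drC dr1 !row0_mul !add0r.
Qed.

End Fundamental.

Section Zero.
Context {R : realType} {q : nat}.

(** [0 + q] reduces to [q], so the statements of this section are well typed, but the index maps and
    block matrices on their two sides agree only propositionally. *)
Lemma rshift0 (i : 'I_q) : rshift 0 i = i :> 'I_q.
Proof. exact: val_inj. Qed.

Lemma glmx0 (a : gl R 0 q) : glmx a = a.2 :> 'M[R]_q.
Proof.
apply/matrixP => i j.
apply: (etrans _ (@block_mxEdr R 0 q 0 q a.1.1 a.1.2 0 a.2 i j)).
by congr (fun_of_matrix (glmx a) _ _); apply/esym/rshift0.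
Qed.

Lemma dsubmx0 m (v : 'M[R]_(0 + q, m)) : dsubmx v = v :> 'M[R]_(q, m).
Proof. by apply/matrixP => i j; rewrite mxE; congr (fun_of_matrix v _ _); exact: rshift0. Qed.

Lemma row0mx (xi : 'rV[R]_q) : row_mx (0 : 'rV_0) xi = xi :> 'rV[R]_q.
Proof.
apply/rowP => j; apply: (etrans _ (@row_mxEr R 1 0 q 0 xi 0 j)).
by congr (fun_of_matrix (row_mx 0 xi) _ _); apply/esym/rshift0.
Qed.

Lemma gl0_eq (a b : gl R 0 q) : a.2 = b.2 -> a = b.
Proof.
case: a b => [[A B] D] [[A' B'] D'] /= ->.
by rewrite (flatmx0 A) (flatmx0 A') (flatmx0 B) (flatmx0 B').
Qed.

Lemma isGL0 (a : gl R 0 q) : isGL a = (a.2 \in unitmx).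
Proof. by rewrite /isGL unitmxE det_mx00 unitr1. Qed.

End Zero.

Definition leaf_projection {R : realType} {p q : nat} (e : pgl R p q) : pgl R 0 q :=
  ((dsubmx e.1.1, (0, 0, e.1.2.2)), e.2).

Lemma linear_leaf_projection {R : realType} {p q : nat} : linear (@leaf_projection R p q).
Proof.
move=> a x y; apply: pgl_ext => //=; first by rewrite linearP.
exact: gl0_eq.
Qed.

(** Each ingredient of [hess] descends: the form [(0, xi)] sees only transverse parts, [glmx a] acts
    on them by [a.2], and [Q] descends by hypothesis. *)
Lemma dsubmx_hess {R : realType} {p q : nat} (Q : 'cV[R]_(p + q) -> 'cV[R]_(p + q))
    (Q0 : 'cV[R]_q -> 'cV[R]_q) (a : gl R p q) (xi : 'rV[R]_q) v w :
  (forall Z, dsubmx (Q Z) = Q0 (dsubmx Z)) ->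
  dsubmx (hess Q (glmx a) (row_mx 0 xi) v w) =
  hess Q0 a.2 xi (dsubmx v) (dsubmx w).
Proof.
move=> QQ; rewrite /hess !row0_mul.
have dB (x y : 'cV[R]_(p + q)) : dsubmx (x - y) = dsubmx x - dsubmx y.
  exact: linearB.
have dD (x y : 'cV[R]_(p + q)) : dsubmx (x + y) = dsubmx x + dsubmx y.
  exact: linearD.
have dN (x : 'cV[R]_(p + q)) : dsubmx (- x) = - dsubmx x by exact: linearN.
have dZ k (x : 'cV[R]_(p + q)) : dsubmx (k *: x) = k *: dsubmx x by exact: linearZ.
rewrite dB dB dN !dZ !dsubmx_glmx; congr (_ - _ *: _).
by rewrite /polar !dB !QQ dD !dsubmx_glmx.
Qed.

Lemma dext_dr {R : realType} {p q : nat} {T : pointedType}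
    (A : charted T 'cV[R]_(p + q)) (AO : atlas_ok A) G (CH : @christ_ok R p q T A G)
    (w : set ('cV[R]_(p + q) -> T) -> pgl R p q -> pgl R p q) c e X Y :
  smooth_form (PFc G) w -> PF_cod c e -> c = pref A (param c e.1.1) ->
  (dext (PFc G) w (PF_param G c e) X Y).1.2.2 =
  'D_X (fun y => (w (PF_param G c y) (cvec (C := PFc G) c Y (PF_param G c y))).1.2.2 :
    'M[R]_q) e -
  'D_Y (fun y => (w (PF_param G c y) (cvec (C := PFc G) c X (PF_param G c y))).1.2.2 :
    'M[R]_q) e.
Proof.
move=> sw ce cE; have o := open_PF_cod AO c.
have E1 : pref (PFc G) (PF_param G c e) = c.
  by rewrite -[LHS]/(pref A (jbase (PF_param G c e))) (jbase_PF AO CH ce) -cE.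
have lL : linear (fun x : pgl R p q => x.1.2.2) by [].
have dw Z : differentiable
    (fun y => w (PF_param G c y) (cvec (C := PFc G) c Z (PF_param G c y))) e.
  by apply: (diffoo_diff (U := PF_cod c)) ce; apply/smooth_onP => //; exact: sw.
rewrite /dext E1 (PF_coordK AO CH ce) -[LHS]/(_.1.2.2 - _.1.2.2).
exact: (f_equal2 (fun a b => a - b) (esym (derive_linear X lL (dw Y)))
  (esym (derive_linear Y lL (dw X)))).
Qed.

(** * Projection of a normal Cartan connection to the leaf space of a chart *)

Section Compare.
Context {R : realType} {p q : nat} {T : pointedType} (A : charted T 'cV[R]_(p + q)).
Hypothesis AO : atlas_ok A.
Local Notation E := 'cV[R]_(p + q).
Local Notation Eq := 'cV[R]_(0 + q).
Variable G : cidx A -> T -> E -> E.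
Hypothesis CH : christ_ok G.
Variable c : cidx A.
Variable D : set Eq.
Local Notation B := (open_charted D : charted Eq Eq).
Hypothesis oD : open D.
Hypothesis DE : forall x, ccod c x -> D (dsubmx x).
Variable GL : cidx B -> Eq -> Eq -> Eq.
Hypothesis CHL : @christ_ok R 0 q Eq B GL.
Hypothesis GLE : forall x Z, ccod c x ->
  dsubmx (G c (param c x) Z) = GL tt (dsubmx x) (dsubmx Z).
Variable w : set (E -> T) -> pgl R p q -> pgl R p q.
Hypothesis wN : normal_cartan G w.
Variable wc : set (Eq -> Eq) -> pgl R 0 q -> pgl R 0 q.
Hypothesis wcN : @normal_cartan R 0 q Eq B GL wc.
Implicit Types (e X Y : pgl R p q).

Let BO : @atlas_ok R 0 q Eq B. Proof. exact: (@open_charted_ok R 0 q D oD). Qed.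

Local Notation leafp e := (@PF_param R 0 q Eq B GL tt (leaf_projection e)).

Lemma PF_cod_leaf_projection e : PF_cod c e -> @PF_cod R 0 q Eq B tt (leaf_projection e).
Proof.
move=> [ce ge]; split; first exact: DE.
by rewrite isGL0 /=; case/andP: ge.
Qed.

(** The transverse part of [theta] is [theta] for the leaf space, and both equations have a unique
    solution as [e.1.2.2] is invertible. The coordinate fields of [c] are used so that the equality
    holds over the whole chart and can be differentiated. *)
Lemma proj_theta e Y (x := w (PF_param G c e) (cvec (C := PFc G) c Y (PF_param G c e)))
    (y := wc (leafp e) (cvec (C := PFc GL) tt (leaf_projection Y) (leafp e))) : PF_cod c e ->
  dsubmx x.1.1 = y.1.1 /\ x.1.2.2 = y.1.2.2.
Proof.
move=> ce; have ce' := PF_cod_leaf_projection ce.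
have [_ can _ _] := wN; have [_ canc _ _] := wcN.
have [h1 h2] := theta AO CH Y can ce.
have [k1 k2] := theta BO CHL (leaf_projection Y) canc ce'.
rewrite -/x in h1 h2; rewrite -/y in k1 k2.
have ua : e.1.2.2 \in unitmx by case: ce => _ /andP[].
have inj m (M N : 'M[R]_(q, m)) : e.1.2.2 *m M = e.1.2.2 *m N -> M = N.
  by move=> /(congr1 (mulmx (invmx e.1.2.2))); rewrite !mulmxA mulVmx// !mul1mx.
have v_eq : dsubmx x.1.1 = y.1.1.
  apply: inj; rewrite -dsubmx_glmx -h1.
  by move: k1; rewrite glmx0 /= => ->.
split=> //; apply: mulmx_inj => z; apply: inj.
have := congr1 dsubmx (h2 (col_mx 0 z)).
rewrite dsubmx_glmx linearD /= !dsubmx_glmx col_mxKd.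
rewrite (dsubmx_hess _ _ _ _ (fun Z => GLE Z ce.1)) col_mxKd v_eq.
have := k2 z; rewrite !glmx0 /= row0mx => ->.
by move=> /addIr ->.
Qed.

(* [delta] is the difference of the [R^q*]-parts.  The two [d omega] terms agree, so the
   transverse Ricci conditions only involve the brackets: they give [trE], hence [dsym],
   hence [(q^2 - 1) delta = 0] on the lifts of the basis, and then [(q + 1) delta = 0]. *)
Lemma proj_form e X : (2 <= q)%N -> PF_cod c e -> c = pref A (param c e.1.1) ->
  leaf_projection (w (PF_param G c e) X) = wc (leafp e) (leaf_projection X).
Proof.
move=> q2 ce cE; have ce' := PF_cod_leaf_projection ce.
set u := PF_param G c e; set u' := leafp e.
have uP : PF G u by apply/PFP => //; exists c, e.
have uP' : @PF R 0 q Eq B GL u' by apply/PFP => //; exists tt, (leaf_projection e).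
pose dx Y := dsubmx (w u Y).1.1.
have pt Y : dx Y = (wc u' (leaf_projection Y)).1.1 /\ (w u Y).1.2.2 = (wc u' (leaf_projection
  Y)).1.2.2.
  have := proj_theta Y ce.
  by rewrite (cvec_pref AO CH _ ce cE) (cvec_pref BO CHL (leaf_projection Y) ce' erefl).
pose delta Y := (w u Y).2 - (wc u' (leaf_projection Y)).2.
have [[sw lw _ _] _ _ _] := wN; have [[swc lwc _ _] _ _ _] := wcN.
have o := open_PF_cod AO c.
have dextE Y Z : (dext (PFc G) w u Y Z).1.2.2 =
    (dext (PFc GL) wc u' (leaf_projection Y) (leaf_projection Z)).1.2.2.
  have D1 Y' Z' : 'D_Y' (fun y => (w (PF_param G c y)
        (cvec (C := PFc G) c Z' (PF_param G c y))).1.2.2 : 'M[R]_q) e =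
      'D_(leaf_projection Y') (fun y => (wc (@PF_param R 0 q Eq B GL tt y)
        (cvec (C := PFc GL) tt (leaf_projection Z') (@PF_param R 0 q Eq B GL tt y))).1.2.2 :
          'M[R]_q)
        (leaf_projection e).
    (* By [proj_theta] the function upstairs factors through the linear map [leaf_projection], hence
       so does its derivative. *)
    rewrite -(derive_precomp (fun y => (wc (@PF_param R 0 q Eq B GL tt y)
        (cvec (C := PFc GL) tt (leaf_projection Z') (@PF_param R 0 q Eq B GL tt y))).1.2.2 :
          'M[R]_q)
        e Y' linear_leaf_projection).
    apply: (derive_ext _ o ce) => y /set_mem cy.
    exact: (proj_theta Z' cy).2.
  apply: (etrans (dext_dr AO CH Y Z sw ce cE)).
  apply: (etrans (f_equal2 (fun a b => a - b) (D1 Y Z) (D1 Z Y))).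
  exact/esym/(dext_dr BO CHL (leaf_projection Y) (leaf_projection Z) swc ce' erefl).
have curvE Y Z : (curvature G w u Y Z).1.2.2 -
    (curvature GL wc u' (leaf_projection Y) (leaf_projection Z)).1.2.2 =
    dx Y *m delta Z - dx Z *m delta Y - ((delta Y *m dx Z - delta Z *m dx Y) 0 0)%:M.
  rewrite /curvature -[(_ + _).1.2.2]/(_.1.2.2 + _.1.2.2) dextE.
  rewrite -[(_ + _).1.2.2 in X in _ - X]/(_.1.2.2 + _.1.2.2) !bracket_dr.
  rewrite !dsubmx0 -!(pt _).1 -!(pt _).2 /delta.
  move: (dext _ _ _ _ _).1.2.2 (w u Y).1.2.2 (w u Z).1.2.2 => d a b.
  move: (w u Y).2 (w u Z).2 (wc u' (leaf_projection Y)).2 (wc u' (leaf_projection Z)).2 => xi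
    eta xi' eta'.
  rewrite -/(dx Y) -/(dx Z) !mulmxBr !mulmxBl.
  move: (a *m b) (b *m a) (dx Y *m eta) (dx Y *m eta') (dx Z *m xi) (dx Z *m xi').
  move: (xi *m dx Z) (xi' *m dx Z) (eta *m dx Y) (eta' *m dx Y).
  move=> s1 s2 s3 s4 m1 m2 m3 m4 m5 m6; apply/matrixP => i j; rewrite !mxE.
  by case: (i == j); rewrite ?mulr1n ?mulr0n; ring.
have [[g gK Kg] _] := lw _ uP.
(* Horizontal lifts of the transverse basis. Their projections have the solder parts required by
   [ricci] on the leaf space as well. *)
pose Xi (i : 'I_q) := g ((ev (rshift p i), 0), 0).
have wXi i : w u (Xi i) = ((ev (rshift p i), 0), 0) by exact: Kg.
have dXi i : dx (Xi i) = ev i.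
  by rewrite /dx wXi /=; apply/matrixP => k l; rewrite !mxE (inj_eq (@rshift_inj p q)).
have evE (i k : 'I_q) : (ev i : 'cV[R]_q) k 0 = (k == i)%:R.
  by rewrite mxE eqxx andbT.
have trE Y j : (q%:R + 1) * delta Y 0 j =
    \sum_i dx Y i 0 * delta (Xi i) 0 j + \sum_i delta (Xi j) 0 i * dx Y i 0.
  have R1 := ricci Y j wN uP (fun i => congr1 (fun x => x.1.1) (wXi i)).
  have R2 : \sum_i (curvature GL wc u' (leaf_projection (Xi i)) (leaf_projection Y)).1.2.2 i
    j = 0.
    apply: (ricci (X := fun i => leaf_projection (Xi i)) _ _ wcN uP') => i.
    by rewrite -(pt (Xi i)).1 dXi; congr (ev _); apply/esym/rshift0.
  have RR : \sum_i (dx (Xi i) *m delta Y - dx Y *m delta (Xi i)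
     - ((delta (Xi i) *m dx Y - delta Y *m dx (Xi i)) 0 0)%:M) i j = 0.
    transitivity (\sum_i ((curvature G w u (Xi i) Y).1.2.2 i j -
        (curvature GL wc u' (leaf_projection (Xi i)) (leaf_projection Y)).1.2.2 i j)).
      apply: eq_bigr => i _; rewrite -curvE.
      by move: (curvature _ _ _ _ _).1.2.2 (curvature _ _ _ _ _).1.2.2 => a b; rewrite !mxE.
    by rewrite sumrB R1 R2 subrr.
  have S1 : \sum_i (dx (Xi i) *m delta Y) i j = q%:R * delta Y 0 j.
    rewrite (eq_bigr (fun=> delta Y 0 j)) => [|i _].
      by rewrite sumr_const card_ord mulr_natl.
    by rewrite dXi mxE big_ord_recl big_ord0 addr0 evE eqxx mul1r.
  have S2 : \sum_i (dx Y *m delta (Xi i)) i j = \sum_i dx Y i 0 * delta (Xi i) 0 j.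
    by apply: eq_bigr => i _; rewrite mxE big_ord_recl big_ord0 addr0.
  have S3 : \sum_i (((delta (Xi i) *m dx Y - delta Y *m dx (Xi i)) 0 0)%:M : 'M[R]_q) i j
     = \sum_i delta (Xi j) 0 i * dx Y i 0 - delta Y 0 j.
    rewrite (bigD1 j) //= [X in _ + X]big1 ?addr0 => [|i ij]; last first.
      by rewrite mxE (negbTE ij) mulr0n.
    have DE0 (N N' : 'M[R]_1) : (N - N') 0 0 = N 0 0 - N' 0 0 by rewrite !mxE.
    rewrite mxE eqxx mulr1n DE0; congr (_ - _); first by rewrite mxE.
    rewrite dXi mxE (bigD1 j) //= big1 ?addr0 => [|i ij].
      by rewrite evE eqxx mulr1.
    by rewrite evE (negbTE ij) mulr0.
  have : \sum_i (dx (Xi i) *m delta Y) i j - \sum_i (dx Y *m delta (Xi i)) i j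
     - \sum_i (((delta (Xi i) *m dx Y - delta Y *m dx (Xi i)) 0 0)%:M : 'M[R]_q) i j = 0.
    apply: etrans RR; rewrite -!sumrB; apply: eq_bigr => i _.
    have DE2 (N N' N'' : 'M[R]_q) : (N - N' - N'') i j = N i j - N' i j - N'' i j.
      by rewrite !mxE.
    by rewrite DE2.
  rewrite S1 S2 S3; move: (\sum_i _) (\sum_i _) => s1 s2; lra.
have dsym i j : q%:R * delta (Xi i) 0 j = delta (Xi j) 0 i.
  have := trE (Xi i) j; rewrite dXi.
  rewrite (bigD1 i) //= [X in _ + X + _]big1 => [|k ki]; last first.
    by rewrite evE (negbTE ki) mul0r.
  rewrite (bigD1 i (F := fun k => _ * _)) //= [X in _ + (_ + X)]big1 => [|k ki]; last first.
    by rewrite evE (negbTE ki) mulr0.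
  rewrite evE eqxx mul1r mulr1 !addr0; lra.
have q2R : 2 <= q%:R :> R by rewrite ler_nat.
have dXi0 i j : delta (Xi i) 0 j = 0.
  have E1 := dsym i j; have E2 := dsym j i; rewrite -E1 mulrA in E2.
  have : (q%:R * q%:R - 1) * delta (Xi i) 0 j = 0 by rewrite mulrBl E2 mul1r subrr.
  move/eqP; rewrite mulf_eq0 => /orP[/eqP|/eqP//]; nra.
have delta0 Y : delta Y = 0.
  apply/rowP => j; rewrite [RHS]mxE; have := trE Y j.
  rewrite big1 => [|i _]; last by rewrite dXi0 mulr0.
  rewrite big1 => [|i _]; last by rewrite dXi0 mul0r.
  rewrite addr0 => /eqP; rewrite mulf_eq0 => /orP[/eqP|/eqP//]; lra.
apply: pgl_ext; [exact: (pt X).1|exact: (gl0_eq (a := (leaf_projection (w u X)).1.2) (pt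
  X).2)|].
by apply/eqP; rewrite -subr_eq0; apply/eqP; exact: delta0.
Qed.

End Compare.

(** * Vector fields and connections in adapted charts *)

Section Manifold.
Context {R : realType} {p q : nat} (M : foliated_manifold R p q).
Local Notation E := 'cV[R]_(p + q).
Local Notation A := (fatlas M).
Implicit Types (c : cidx A) (m : M) (X Y : M -> E) (U : set M).

Lemma open_param_preim c U : open U -> open [set e | ccod c e /\ U (param c e)].
Proof.
move=> oU; rewrite openE => e [ce Ue]; apply: filterI.
  by apply: open_nbhs_nbhs; split; [exact: fcod_open|].
have := @fparam_continuous _ _ _ M c.
rewrite continuous_open_subspace; last exact: fcod_open.
move=> /(_ e (mem_set ce)); apply.
exact: open_nbhs_nbhs.
Qed.

Lemma fatlas_ok : atlas_ok A.
Proof.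
split.
- exact: fcod_open.
- exact: fcoordK.
- exact: fparamK.
- by move=> c m _; exact: fpref_dom.
- by move=> c c'; apply: open_param_preim; exact: fdom_open.
- move=> c c'; apply/smooth_onP; last exact: ftransition_smooth.
  by apply: open_param_preim; exact: fdom_open.
- exact: ftransition_foliated.
Qed.

Local Notation AO := fatlas_ok.

Lemma tcompE c m v : cdom c m ->
  tcomp c m v = tjac (pref A m) c (coord (pref A m) m) *m v.
Proof.
move=> cm; rewrite /tcomp -[coord c \o _]/(trans _ c).
by apply: (derive_trans AO); apply: (tdom_coord AO) => //; exact: fpref_dom.
Qed.

Lemma cvecE c m v : cdom c m ->
  cvec c v m = tjac c (pref A m) (coord c m) *m v.
Proof.
move=> cm; rewrite /cvec -[coord _ \o _]/(trans c _).
by apply: (derive_trans AO); apply: (tdom_coord AO) => //; exact: fpref_dom.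
Qed.

Lemma tcomp_change c c' m v : cdom c m -> cdom c' m ->
  tcomp c' m v = tjac c c' (coord c m) *m tcomp c m v.
Proof.
move=> cm c'm; rewrite !tcompE// mulmxA; congr (_ *m _).
have h1 := tdom_coord AO (fpref_dom m) cm.
have h2 := tdom_coord AO (fpref_dom m) c'm.
have Tc := tjac_comp AO h1 h2.
have E0 : trans (pref A m) c (coord (pref A m) m) = coord c m.
  by rewrite /trans /=; have [_ ->] := fcoordK (fpref_dom m).
by rewrite E0 in Tc; exact: esym Tc.
Qed.

Lemma tcomp_cvec c c' m v : cdom c m -> cdom c' m ->
  tcomp c' m (cvec c v m) = tjac c c' (coord c m) *m v.
Proof.
move=> cm c'm; rewrite tcompE// cvecE// mulmxA; congr (_ *m _).
have h1 := tdom_coord AO cm (fpref_dom m).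
have h2 := tdom_coord AO cm c'm.
have Tc := tjac_comp AO h1 h2.
have E0 : trans c (pref A m) (coord c m) = coord (pref A m) m.
  by rewrite /trans /=; have [_ ->] := fcoordK cm.
by rewrite E0 in Tc.
Qed.

Lemma tcomp_linear c m : cdom c m -> linear (tcomp c m).
Proof. by move=> cm a u v; rewrite !tcompE// mulmxDr scalemxAr. Qed.

Lemma tcomp_inj c m : cdom c m -> injective (tcomp c m).
Proof.
move=> cm u v; rewrite !tcompE// => /(congr1 (mulmx (invmx (tjac (pref A m) c (coord (pref A
  m) m))))).
rewrite !mulmxA mulVmx ?mul1mx//.
by apply: (tjac_unit AO); apply: (tdom_coord AO) => //; exact: fpref_dom.
Qed.

Lemma cls_tcomp c m v : cdom c m -> (dsubmx (tcomp c m v) = 0 <-> dsubmx v = 0).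
Proof.
move=> cm; have h := tdom_coord AO (fpref_dom m) cm.
rewrite tcompE// (dsubmx_tjac AO _ h); split=> [|->]; last by rewrite mulmx0.
have : drsubmx (tjac (pref A m) c (coord (pref A m) m)) \in unitmx.
  have := tjac_unit AO h; rewrite -(tjac_fol AO h) glmx_unit drsubmx_glmx.
  by case/andP.
move=> u /(congr1 (mulmx (invmx (drsubmx (tjac (pref A m) c (coord (pref A m) m)))))).
by rewrite mulmxA mulVmx// mul1mx mulmx0.
Qed.

Lemma tjac_id c e : ccod c e -> tjac c c e = 1%:M.
Proof.
move=> ce; have [cp E0] := fparamK ce; have h : tdom c c e by split.
apply: mulmx_inj => v; rewrite -(derive_trans AO v h) mul1mx.
rewrite (derive_ext (G := id) v (open_tdom AO c c) h) ?derive_id//.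
by move=> y /set_mem[cy _]; have [] := fparamK cy.
Qed.

Lemma vrep_change c c' X e : tdom c c' e ->
  vrep c' X (trans c c' e) = tjac c c' e *m vrep c X e.
Proof.
move=> h; have [h' _ E1] := tdomV AO h; rewrite /vrep E1.
have [cp E0] := fparamK h.1.
by rewrite (tcomp_change _ cp h.2) E0.
Qed.

Definition udom c U : set E := [set e | ccod c e /\ U (param c e)].

(** Smoothness in one chart around [U] implies it in all charts, as the components change by the
    smooth Jacobian of the transition. *)
Lemma smooth_fieldP c U X : open U -> U `<=` cdom c ->
  diff_infty (udom c U) (vrep c X) <-> smooth_field A U X.
Proof.
move=> oU Uc; split=> [sX c'|sX]; last first.
  by apply/smooth_onP; [exact: open_param_preim|exact: sX].
apply/smooth_onP; first exact: open_param_preim.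
have o' : open (udom c' U) by exact: open_param_preim.
have o : open (udom c U) by exact: open_param_preim.
move=> k.
have sub : udom c' U `<=` tdom c' c by move=> e [c'e Ue]; split=> //; exact: Uc.
apply: (diffk_ext (F := fun e => tjac c c' (trans c' c e) *m vrep c X (trans c' c e))).
- exact: o'.
- move=> e /set_mem ue; have [h E1 _] := tdomV AO (sub _ ue).
  by rewrite -(vrep_change _ h) E1.
have st : diffk k (udom c' U) (trans c' c).
  by apply: (diffk_sub sub); exact: (trans_smooth AO).
apply: diffk_mulmx => //.
- apply: (diffk_comp o' (open_tdom AO c c') _ st).
    by move=> e ue; have [] := tdomV AO (sub _ ue).
  by apply: diffk_jac; [exact: (open_tdom AO)|exact: (trans_smooth AO)].
- apply: (diffk_comp o' o _ st); last exact: sX.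
  by move=> e ue; have [h _ E1] := tdomV AO (sub _ ue); split; [exact: h.1|rewrite E1; exact:
    ue.2].
Qed.

Lemma smooth_funP c U (f : M -> R) : open U -> U `<=` cdom c ->
  diff_infty (udom c U) (f \o param c) <-> smooth_fun A U f.
Proof.
move=> oU Uc; split=> [sX c'|sX]; last first.
  by apply/smooth_onP; [exact: open_param_preim|exact: sX].
apply/smooth_onP; first exact: open_param_preim.
have o' : open (udom c' U) by exact: open_param_preim.
have o : open (udom c U) by exact: open_param_preim.
move=> k.
have sub : udom c' U `<=` tdom c' c by move=> e [c'e Ue]; split=> //; exact: Uc.
apply: (diffk_ext (F := fun e => (f \o param c) (trans c' c e))).
- exact: o'.
- by move=> e /set_mem ue; have [h _ E1] := tdomV AO (sub _ ue); rewrite /= E1.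
have st : diffk k (udom c' U) (trans c' c).
  by apply: (diffk_sub sub); exact: (trans_smooth AO).
apply: (diffk_comp o' o _ st); last exact: sX.
by move=> e ue; have [h _ E1] := tdomV AO (sub _ ue); split; [exact: h.1|rewrite E1; exact:
  ue.2].
Qed.

Lemma vrep_cvec_id c v e : ccod c e -> vrep c (cvec c v) e = v.
Proof.
move=> ce; rewrite /vrep; have [cp E0] := fparamK ce.
by rewrite (tcomp_cvec _ cp cp) E0 (tjac_id ce) mul1mx.
Qed.

Lemma cvec_smooth c v U : open U -> U `<=` cdom c -> smooth_field A U (cvec c v).
Proof.
move=> oU Uc; apply/(smooth_fieldP _ oU Uc) => k.
apply: (diffk_ext (F := fun=> v)); [exact: open_param_preim| |exact: diffk_cst].
by move=> e /set_mem[ce _]; rewrite vrep_cvec_id.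
Qed.

Lemma vrep_pref m X : vrep (pref A m) X (coord (pref A m) m) = X m.
Proof.
rewrite /vrep; have [cp ->] := fcoordK (fpref_dom m).
rewrite tcompE; last exact: fpref_dom.
by rewrite tjac_id// mul1mx.
Qed.

Lemma lieE c (f : M -> R) X m U : open U -> U m -> cdom c m -> smooth_fun A U f ->
  lie A X f m = 'D_(vrep c X (coord c m)) (f \o param c) (coord c m).
Proof.
move=> oU Um cm sf; rewrite /lie; set c0 := pref A m.
have h := tdom_coord AO (fpref_dom m) cm; have [h' E1 E2] := tdomV AO h.
have hE : trans c0 c (coord c0 m) = coord c m.
  by rewrite /trans /=; have [_ ->] := fcoordK (fpref_dom m).
rewrite -[X m]vrep_pref -hE (vrep_change _ h) -(derive_trans AO _ h).
have d1 := trans_diff AO h.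
have d2 : differentiable (f \o param c) (trans c0 c (coord c0 m)).
  apply: (diffoo_diff (U := udom c U)).
    by apply/smooth_onP; [exact: open_param_preim|exact: sf].
  split; first exact: h'.1.
  by rewrite hE; have [_ ->] := fcoordK cm.
rewrite -(derive_comp _ d1 d2).
apply: (derive_ext _ (open_tdom AO c0 c) h) => y /set_mem ty.
by have [_ _ E3] := tdomV AO ty; rewrite /= E3.
Qed.

(** The bracket is defined in the preferred chart. In passing to [c], the second derivatives of the
    transition in the two terms cancel by Schwarz. *)
Lemma bracketE c X Y m U : open U -> U m -> cdom c m ->
  smooth_field A U X -> smooth_field A U Y ->
  tcomp c m (bracket A X Y m) =
  'D_(vrep c X (coord c m)) (vrep c Y) (coord c m) -
  'D_(vrep c Y (coord c m)) (vrep c X) (coord c m).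
Proof.
move=> oU Um cm sX sY; set c0 := pref A m; pose e0 := coord c0 m.
have h := tdom_coord AO (fpref_dom m) cm; have [h' E1 E2] := tdomV AO h.
have hE : trans c0 c e0 = coord c m.
  by rewrite /e0 /trans /=; have [_ ->] := fcoordK (fpref_dom m).
have ot := open_tdom AO c0 c.
have dV Z c1 : smooth_field A U Z -> cdom c1 m -> diff_infty (udom c1 U) (vrep c1 Z).
  by move=> sZ c1m; apply/smooth_onP; [exact: open_param_preim|exact: sZ].
have uE c1 : cdom c1 m -> udom c1 U (coord c1 m).
  by move=> c1m; have [c1c E3] := fcoordK c1m; split=> //; rewrite E3.
have key Z W : smooth_field A U Z -> smooth_field A U W ->
    'D_(vrep c Z (coord c m)) (vrep c W) (coord c m) =
    'D_(Z m) (fun y => 'D_(W m) (trans c0 c) y) e0 +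
    tjac c0 c e0 *m 'D_(Z m) (vrep c0 W) e0.
  move=> sZ sW; rewrite -hE (vrep_change _ h) vrep_pref -(derive_trans AO _ h).
  have d1 := trans_diff AO h.
  have d2 : differentiable (vrep c W) (trans c0 c e0).
    by rewrite hE; exact: diffoo_diff (dV W c sW cm) (uE _ cm).
  rewrite -(derive_comp _ d1 d2).
  rewrite (derive_ext (G := fun y => tjac c0 c y *m vrep c0 W y) _ ot h); last first.
    by move=> y /set_mem ty; rewrite /= (vrep_change _ ty).
  have dj : diffk 0 (tdom c0 c) (tjac c0 c).
    by apply: diffk_jac => //; exact: (trans_smooth AO).
  have d3 := dj.1 _ h.
  have d4 := diffoo_diff (dV W c0 sW (fpref_dom m)) (uE _ (fpref_dom m)).
  have [_ ->] := derive_mulmx (Z m) d3 d4.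
  congr (_ + _); rewrite vrep_pref.
  have lW : linear (fun N : 'M[R]_(p + q) => N *m W m).
    by move=> k N N'; rewrite mulmxDl scalemxAl.
  rewrite -(derive_linear _ lW d3); apply: (derive_ext _ ot h) => y /set_mem ty.
  by rewrite (derive_trans AO _ ty).
have t2 : diffk 2 (tdom c0 c) (trans c0 c) by exact: (trans_smooth AO).
have sw := derive_swap (X m) (Y m) ot h t2.
have alg (a a' b b' : E) : a = a' -> b - b' = (a + b) - (a' + b').
  by move=> ->; rewrite opprD addrACA subrr add0r.
rewrite (tcompE _ cm) /bracket -/c0 -/e0 mulmxBr; apply/esym.
apply: (etrans (f_equal2 (fun a b => a - b) (key X Y sX sY) (key Y X sY sX))).
by apply/esym; apply: alg; exact: sw.
Qed.

End Manifold.

(** * Functions constant along plaques *)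

Section Plaques.
Context {R : realType} {p q : nat} (M : foliated_manifold R p q).
Local Notation E := 'cV[R]_(p + q).
Local Notation A := (fatlas M).

(** The segment is prolonged to [s] in [[-1, 1]] because [line_MVT] only bounds the absolute value
    of its intermediate point. *)
Lemma zero_derivative_locally_constant (V : normedModType R) n (U : set V)
    (F : V -> 'cV[R]_n) (x y : V) :
  (forall s : R, `|s| <= 1 -> U (x + s *: (y - x))) ->
  (forall z, U z -> differentiable F z) ->
  (forall z, U z -> 'D_(y - x) F z = 0) -> F x = F y.
Proof.
move=> seg dF DF; apply/matrixP => i j; rewrite (ord1 j).
have dFi z : U z -> differentiable (fun z => F z i 0 : R) z.
  move=> Uz; exact: (differentiable_comp (g := fun N : 'cV[R]_n => N i 0 : R) (dF z Uz)
    (linear_diff _ (@linear_mxE R n 1 i 0))).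
have [|s s1] := line_MVT (G := fun z => F z i 0 : R) (y := x) (b := y - x) (t := 1).
  by rewrite normr1 => s /seg Us; apply: diff_derivable; exact: dFi.
rewrite normr1 in s1.
rewrite scale1r (addrC x) subrK -derive_mxE; last by apply: diff_derivable; exact: (dF _ (seg
  _ s1)).
rewrite (DF _ (seg _ s1)) mxE mulr0.
by move/eqP; rewrite subr_eq0 => /eqP.
Qed.

(* Plaques are connected, as the charts are rectangular over a connected set; they need
   not be convex, so that only local constancy comes from the mean value theorem. *)
Lemma plaque_constant (c : cidx A) n (F : E -> 'cV[R]_n) :
  (forall z, ccod c z -> differentiable F z) ->
  (forall z v, ccod c z -> dsubmx v = 0 -> 'D_v F z = 0) ->
  forall e e', ccod c e -> ccod c e' -> dsubmx e = dsubmx e' -> F e = F e'.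
Proof.
move=> dF DF e e' ce ce' ee'.
have [P [Q [cP cE]]] := frectangular c.
rewrite cE in ce ce' *.
pose y := dsubmx e; pose j (x : 'cV[R]_p) : E := col_mx x y.
have jC x : P x -> ccod c (j x).
  by move=> Px; rewrite cE /= /j col_mxKu col_mxKd; split=> //; exact: ce.2.
have jP x : ccod c (j x) -> P x by rewrite cE /= /j col_mxKu => -[].
have ljz : linear (fun x : 'cV[R]_p => col_mx x (0 : 'cV[R]_q)).
  by move=> a u v; rewrite scale_col_mx add_col_mx scaler0 addr0.
have jE x : j x = col_mx 0 y + col_mx x 0 by rewrite add_col_mx add0r addr0.
have dj x : differentiable j x.
  have -> : j = (fun x => col_mx 0 y + col_mx x 0) by apply/funext => z; exact: jE.
  by apply: differentiableD; [exact: differentiable_cst|exact: linear_diff].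
have oP : open P.
  have -> : P = setT `&` j @^-1` ccod c.
    by apply/seteqP; split=> x; [split=> //; exact: jC|move=> [_]; exact: jP].
  by apply: open_preimage => //; [exact: openT|exact: fcod_open].
have loc x : P x -> \forall x' \near x, P x' /\ F (j x') = F (j x).
  move=> Px; have : nbhs x P by exact: open_nbhs_nbhs.
  move=> /nbhs_ballP[d /= d0 dP]; apply/nbhs_ballP; exists d => //= x' xx'.
  split; first exact: dP.
  apply/esym; apply: (zero_derivative_locally_constant (U := ccod c)) => //.
    move=> s s1; have -> : j x + s *: (j x' - j x) = j (x + s *: (x' - x)).
      by rewrite /j opp_col_mx add_col_mx subrr scale_col_mx scaler0 add_col_mx addr0.
    apply: jC; apply: dP; move: xx'; rewrite -!ball_normE /ball_ /=.
    rewrite opprD addNKr normrN normrZ distrC => h.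
    by apply: le_lt_trans h; rewrite ler_piMl.
  move=> z cz; apply: DF => //.
  by rewrite /j opp_col_mx add_col_mx subrr col_mxKd.
pose B := [set x | P x /\ F (j x) = F e].
have ejE : j (usubmx e) = e by exact: vsubmxK.
have eP : P (usubmx e) by exact: ce.1.
(* The level set [B] is nonempty, open and closed in the connected set [P]. *)
have BP : B = P.
  apply: cP.
  - by exists (usubmx e); split=> //; rewrite ejE.
  - exists B; last by apply/seteqP; split=> x; [move=> Bx; split=> //; exact: Bx.1|case].
    rewrite openE => x [Px Fx]; have := loc x Px.
    by apply: filterS => x' [Px' Fx']; split=> //; rewrite Fx'.
  - exists (~` [set x | P x /\ F (j x) <> F e]).
      apply: open_closedC; rewrite openE => x [Px Fx]; have := loc x Px.
      by apply: filterS => x' [Px' Fx']; split=> //; rewrite Fx'.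
    apply/seteqP; split=> x; first by move=> [Px Fx]; split=> // -[].
    by move=> [Px h]; split=> //; apply: contrapT => h'; apply: h.
have e'P : P (usubmx e') by exact: ce'.1.
move: e'P; rewrite -BP => -[_ <-].
by rewrite /j /y ee' vsubmxK.
Qed.

End Plaques.

Section Connection.
Context {R : realType} {p q : nat} (M : foliated_manifold R p q).
Local Notation E := 'cV[R]_(p + q).
Local Notation A := (fatlas M).
Implicit Types (c : cidx A) (m : M) (X Y : M -> E) (U : set M).
Local Notation AO := (fatlas_ok M).

Lemma open_cdom c : open (cdom c). Proof. exact: fdom_open. Qed.

Lemma cdom_udom c e : ccod c e -> udom c (cdom c) e.
Proof. by move=> ce; split=> //; have [] := fparamK ce. Qed.

Lemma open_udom c U : open U -> open (udom c U). Proof. exact: open_param_preim. Qed.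
Arguments open_udom : clear implicits.

Lemma smooth_vrep c U X : open U -> smooth_field A U X -> diff_infty (udom c U) (vrep c X).
Proof. by move=> oU sX; apply/smooth_onP; [exact: (open_udom c _ oU)|exact: sX]. Qed.

Lemma leaf_vrep c U Y e : leaf_field U Y -> udom c U e -> dsubmx (vrep c Y e) = 0.
Proof.
move=> [_ Y0] [ce Ue]; apply/cls_tcomp; first by have [] := fparamK ce.
exact: Y0 (mem_set Ue).
Qed.

Lemma derive_vrep_cvec c v u e : ccod c e -> 'D_u (vrep c (cvec c v)) e = 0.
Proof.
move=> ce; apply: (etrans (derive_ext (G := fun=> v) u
  (open_udom c _ (open_cdom c)) (cdom_udom ce) _)); last exact: derive_cst.
by move=> y /set_mem[cy _]; rewrite vrep_cvec_id.
Qed.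

(** In [c] the bracket of a constant field with [Y] is the derivative of the components of [Y] along
    [v]; it keeps the transverse components of a leaf field zero. *)
Lemma cvec_adapted c v : adapted_field (cdom c) (cvec c v).
Proof.
have oc := open_cdom c; have sv := cvec_smooth v oc (@subset_refl _ _).
split; first exact: sv.
move=> Y lY; have sY := lY.1.
have o := open_udom c _ oc.
have bE m : cdom c m -> tcomp c m (bracket A (cvec c v) Y m) =
    'D_v (vrep c Y) (coord c m).
  move=> cm; have [cc Em] := fcoordK cm; apply: (etrans (bracketE oc cm cm sv sY)).
  apply: (etrans (f_equal2 (fun a b => a - b) _
    (derive_vrep_cvec v (vrep c Y (coord c m)) cc))); last exact: subr0.
  by rewrite (vrep_cvec_id v cc).
split.
  apply/(smooth_fieldP _ oc (@subset_refl _ _)) => k.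
  apply: (diffk_ext (F := fun e => 'D_v (vrep c Y) e)) => //.
    move=> e /set_mem[ce _]; have [cp Ee] := fparamK ce.
    apply/esym; apply: (etrans (bE (param c e) cp)).
    by rewrite Ee.
  by have [_ h] := smooth_vrep c oc sY k.+1; exact: h.
move=> m /set_mem cm; apply: (cls_tcomp _ cm).1; rewrite (bE m cm).
have [cc Em] := fcoordK cm; have uc := cdom_udom cc.
have dY := diffoo_diff (smooth_vrep c oc sY) uc.
apply: (etrans (esym (derive_linear v (@linear_dsubmx R p q 1) dY))).
apply: (etrans (derive_ext (G := fun=> 0) v o uc _)).
  by move=> e /set_mem ue; exact: leaf_vrep lY ue.
exact: derive_cst.
Qed.

Lemma cvec_leaf c v : dsubmx v = 0 -> leaf_field (cdom c) (cvec c v).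
Proof.
move=> v0; split; first exact: (cvec_smooth v (open_cdom c) (@subset_refl _ _)).
move=> m /set_mem cm; apply: (cls_tcomp (cvec c v m) cm).1.
have h := tdom_coord AO cm cm.
by rewrite (tcomp_cvec v cm cm) (dsubmx_tjac AO _ h) v0 mulmx0.
Qed.

(** The bracket of [X] with a constant field [v] along the leaves is minus the derivative of its
    components along [v]; being tangent to the leaves, it has no transverse part, so
    [plaque_constant] applies. *)
Lemma adapted_basic c X : adapted_field (cdom c) X ->
  forall e e', ccod c e -> ccod c e' -> dsubmx e = dsubmx e' ->
  dsubmx (vrep c X e) = dsubmx (vrep c X e').
Proof.
move=> [sX aX]; have oc := open_cdom c; have o := open_udom c _ oc.
have dX z : ccod c z -> differentiable (vrep c X) z.
  by move=> cz; exact: diffoo_diff (smooth_vrep c oc sX) (cdom_udom cz).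
apply: (plaque_constant (F := fun e => dsubmx (vrep c X e))) => [z cz|z v cz v0].
  exact: (differentiable_comp (g := @dsubmx R p q 1) (dX z cz)
    (linear_diff _ (@linear_dsubmx R p q 1))).
have [_ l0] := aX _ (cvec_leaf c v0).
have [cp Ez] := fparamK cz.
have := (cls_tcomp _ cp).2 (l0 _ (mem_set cp)).
rewrite (bracketE oc cp cp sX (cvec_smooth v oc (@subset_refl _ _))) Ez => h0.
have h : dsubmx (- 'D_v (vrep c X) z) = 0.
  rewrite -sub0r; apply: etrans h0; apply/esym; apply: (f_equal dsubmx).
  apply: (f_equal2 (fun a b => a - b) (derive_vrep_cvec v (vrep c X z) cz)).
  exact: (f_equal (fun w => 'D_w (vrep c X) z) (vrep_cvec_id v cz)).
apply: (etrans (derive_linear v (@linear_dsubmx R p q 1) (dX z cz))).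
by apply: oppr_inj; rewrite oppr0 -h linearN.
Qed.
End Connection.

Arguments open_udom {R p q M} c U.

Lemma linear_cV_sum {R : realType} n (W : lmodType R) (F : 'cV[R]_n -> W) Z :
  linear F -> F Z = \sum_i Z i 0 *: F (ev i).
Proof.
move=> lF; pose g : {linear 'cV[R]_n -> W} :=
  HB.pack F (GRing.isLinear.Build _ _ _ _ F lF).
rewrite -[F]/(g : _ -> _) {1}(cV_sum Z) linear_sum.
by apply: eq_bigr => i _; rewrite linearZ.
Qed.

Section SmoothFields.
Context {R : realType} {p q : nat} (M : foliated_manifold R p q).
Local Notation E := 'cV[R]_(p + q).
Local Notation A := (fatlas M).
Implicit Types (c : cidx A) (m : M) (X Y : M -> E) (U : set M).
Local Notation AO := (fatlas_ok M).

Lemma vrep_comb c (f : M -> R) X X' e : ccod c e ->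
  vrep c (fun m => f m *: X m + X' m) e = f (param c e) *: vrep c X e + vrep c X' e.
Proof.
by move=> ce; have [cp _] := fparamK ce; rewrite /vrep (tcomp_linear cp).
Qed.

Lemma smooth_comb U (f : M -> R) X X' : open U -> smooth_fun A U f ->
  smooth_field A U X -> smooth_field A U X' ->
  smooth_field A U (fun m => f m *: X m + X' m).
Proof.
move=> oU sf sX sX' c; have o := open_udom c U oU.
apply/smooth_onP; first exact: o.
have sfc : diff_infty (udom c U) (f \o param c) by apply/smooth_onP; [exact: o|exact: sf].
move=> k; apply: (diffk_ext (F := fun e => (f \o param c) e *: vrep c X e + vrep c X' e)).
- exact: o.
- by move=> e /set_mem[ce _]; apply/esym; exact: vrep_comb.
- apply: diffkD; [exact: o| |exact: (smooth_vrep c oU sX' k)].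
  apply: diffkZ; [exact: o|exact: sfc|exact: (smooth_vrep c oU sX k)].
Qed.

Lemma smooth_zero U : open U -> smooth_field A U (fun=> 0).
Proof.
move=> oU c; have o := open_udom c U oU; apply/smooth_onP; first exact: o.
move=> k; apply: (diffk_ext (F := fun=> 0)); [exact: o| |exact: diffk_cst].
move=> e /set_mem[ce _]; have [cp _] := fparamK ce.
by rewrite /vrep tcompE// mulmx0.
Qed.

Lemma smooth_cst U (a : R) : open U -> smooth_fun A U (fun=> a).
Proof.
move=> oU c; have o := open_udom c U oU; apply/smooth_onP; first exact: o.
move=> k; exact: diffk_cst.
Qed.

Lemma smooth_sum U (I : Type) (r : seq I) (h : I -> M -> R) (Y : I -> M -> E) :
  open U -> (forall i, smooth_fun A U (h i)) -> (forall i, smooth_field A U (Y i)) ->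
  smooth_field A U (fun m => \sum_(i <- r) h i m *: Y i m).
Proof.
move=> oU sh sY; elim: r => [|i r IH].
  have -> : (fun m => \sum_(i <- [::]) h i m *: Y i m) = (fun=> 0 : E).
    by apply/funext => m; rewrite big_nil.
  exact: smooth_zero.
have -> : (fun m => \sum_(j <- i :: r) h j m *: Y j m) =
    (fun m => h i m *: Y i m + \sum_(j <- r) h j m *: Y j m).
  by apply/funext => m; rewrite big_cons.
exact: (smooth_comb oU (sh i) (sY i) IH).
Qed.

Lemma cvec_sum c v m : cdom c m -> cvec c v m = \sum_i v i 0 *: cvec c (ev i) m.
Proof.
move=> cm; rewrite cvecE// {1}(cV_sum v) mulmx_sumr; apply: eq_bigr => i _.
by rewrite -scalemxAr cvecE.
Qed.

Lemma cvec_change c c' v m : cdom c m -> cdom c' m ->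
  cvec c v m = cvec c' (tjac c c' (coord c m) *m v) m.
Proof.
move=> cm c'm; apply: (tcomp_inj c'm); rewrite (tcomp_cvec _ cm c'm).
by rewrite (tcomp_cvec _ c'm c'm) tjac_id ?mul1mx//; have [] := fcoordK c'm.
Qed.

Lemma cvec_linear c m : cdom c m -> linear (fun v => cvec c v m).
Proof. by move=> cm a u v; rewrite !cvecE// mulmxDr scalemxAr. Qed.

End SmoothFields.

(** * Christoffel symbols of an adapted connection *)

Section Connection.
Context {R : realType} {p q : nat} (M : foliated_manifold R p q).
Local Notation E := 'cV[R]_(p + q).
Local Notation A := (fatlas M).
Implicit Types (c : cidx A) (m : M) (X Y : M -> E) (U : set M).
Local Notation AO := (fatlas_ok M).
Variable nabla : (M -> E) -> (M -> E) -> M -> E.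
Hypothesis na : adapted_connection nabla.

Lemma nabla_local U X X' Y Y' m : open U -> U m -> {in U, X =1 X'} ->
  {in U, Y =1 Y'} -> nabla X Y m = nabla X' Y' m.
Proof. by case: na => lc _ _ oU Um XX YY; exact: (lc U oU).1 XX YY m (mem_set Um). Qed.

Lemma nabla_comb1 U (f : M -> R) X X' Y m : open U -> U m -> smooth_fun A U f ->
  smooth_field A U X -> smooth_field A U X' -> smooth_field A U Y ->
  nabla (fun m => f m *: X m + X' m) Y m = f m *: nabla X Y m + nabla X' Y m.
Proof.
case: na => lc _ _ oU Um sf sX sX' sY.
by have [_ + _ _] := (lc U oU).2 f X X' Y Y sf sX sX' sY sY; apply; exact: mem_set.
Qed.

Lemma nabla_comb2 U (f : M -> R) X Y Y' m : open U -> U m -> smooth_fun A U f ->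
  smooth_field A U X -> smooth_field A U Y -> smooth_field A U Y' ->
  nabla X (fun m => f m *: Y m + Y' m) m =
  lie A X f m *: Y m + f m *: nabla X Y m + nabla X Y' m.
Proof.
case: na => lc _ _ oU Um sf sX sY sY'.
have sfY : smooth_field A U (fun m => f m *: Y m).
  have := smooth_comb oU sf sY (smooth_zero oU).
  by congr (smooth_field _ _ _); apply/funext => x; rewrite addr0.
have [_ _ h _] := (lc U oU).2 f X X (fun m => f m *: Y m) Y' sf sX sX sfY sY'.
have [_ _ _ h'] := (lc U oU).2 f X X Y Y' sf sX sX sY sY'.
by rewrite (h m (mem_set Um)) (h' m (mem_set Um)).
Qed.

Lemma nabla01 U Y m : open U -> U m -> smooth_field A U Y -> nabla (fun=> 0) Y m = 0.
Proof.
move=> oU Um sY.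
have := nabla_comb1 oU Um (smooth_cst 1 oU) (smooth_zero oU) (smooth_zero oU) sY.
have -> : (fun m : M => 1 *: (0 : E) + 0) = (fun=> 0).
  by apply/funext => x; rewrite scaler0 addr0.
by rewrite scale1r => /eqP; rewrite addrC -subr_eq subrr => /eqP/esym.
Qed.

Lemma lie_cst X (a : R) m : lie A X (fun=> a) m = 0.
Proof. by rewrite /lie; exact: derive_cst. Qed.

Lemma nabla02 U X m : open U -> U m -> smooth_field A U X -> nabla X (fun=> 0) m = 0.
Proof.
move=> oU Um sX.
have := nabla_comb2 oU Um (smooth_cst 1 oU) sX (smooth_zero oU) (smooth_zero oU).
have -> : (fun m : M => 1 *: (0 : E) + 0) = (fun=> 0).
  by apply/funext => x; rewrite scaler0 addr0.
rewrite scaler0 add0r scale1r => /eqP; rewrite addrC -subr_eq subrr.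
by move=> /eqP/esym.
Qed.

Lemma nabla_sum1 U (I : Type) (r : seq I) (h : I -> M -> R) (X : I -> M -> E) Y m :
  open U -> U m -> (forall i, smooth_fun A U (h i)) ->
  (forall i, smooth_field A U (X i)) -> smooth_field A U Y ->
  nabla (fun m => \sum_(i <- r) h i m *: X i m) Y m =
  \sum_(i <- r) h i m *: nabla (X i) Y m.
Proof.
move=> oU Um sh sX sY; elim: r => [|i r IH].
  have -> : (fun m => \sum_(i <- [::]) h i m *: X i m) = (fun=> 0 : E).
    by apply/funext => x; rewrite big_nil.
  by rewrite big_nil; exact: (nabla01 oU Um sY).
have -> : (fun m => \sum_(j <- i :: r) h j m *: X j m) =
    (fun m => h i m *: X i m + \sum_(j <- r) h j m *: X j m).
  by apply/funext => x; rewrite big_cons.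
rewrite (nabla_comb1 oU Um (sh i) (sX i) (smooth_sum r oU sh sX) sY).
by rewrite IH big_cons.
Qed.

Lemma nabla_sum2 U (I : Type) (r : seq I) (h : I -> M -> R) (Y : I -> M -> E) X m :
  open U -> U m -> (forall i, smooth_fun A U (h i)) ->
  (forall i, smooth_field A U (Y i)) -> smooth_field A U X ->
  nabla X (fun m => \sum_(i <- r) h i m *: Y i m) m =
  \sum_(i <- r) (lie A X (h i) m *: Y i m + h i m *: nabla X (Y i) m).
Proof.
move=> oU Um sh sY sX; elim: r => [|i r IH].
  have -> : (fun m => \sum_(i <- [::]) h i m *: Y i m) = (fun=> 0 : E).
    by apply/funext => x; rewrite big_nil.
  by rewrite big_nil; exact: (nabla02 oU Um sX).
have -> : (fun m => \sum_(j <- i :: r) h j m *: Y j m) =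
    (fun m => h i m *: Y i m + \sum_(j <- r) h j m *: Y j m).
  by apply/funext => x; rewrite big_cons.
rewrite (nabla_comb2 oU Um (sh i) sX (sY i) (smooth_sum r oU sh sY)).
by rewrite IH big_cons.
Qed.

Definition christoffel_op c m u v : E := tcomp c m (nabla (cvec c u) (cvec c v) m).

Lemma cvec_lin_ext c a u v : {in cdom c, cvec c (a *: u + v) =1
  (fun m => (fun=> a) m *: cvec c u m + cvec c v m)}.
Proof. by move=> m /set_mem cm; exact: (cvec_linear cm). Qed.

Lemma christoffel_op_linear1 c m v : cdom c m -> linear (fun u => christoffel_op c m u v).
Proof.
move=> cm a u u'; have oc := open_cdom c.
have s w := cvec_smooth w oc (@subset_refl _ _).
have E1 := nabla_local (Y := cvec c v) (Y' := cvec c v) oc cm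
  (cvec_lin_ext (c := c) a u u') (fun m _ => erefl).
have E2 := nabla_comb1 oc cm (smooth_cst a oc) (s u) (s u') (s v).
apply: (etrans (f_equal (tcomp c m) (etrans E1 E2))).
exact: (tcomp_linear cm).
Qed.

Lemma christoffel_op_linear2 c m u : cdom c m -> linear (christoffel_op c m u).
Proof.
move=> cm a v v'; have oc := open_cdom c.
have s w := cvec_smooth w oc (@subset_refl _ _).
have E1 := nabla_local (X := cvec c u) (X' := cvec c u) oc cm (fun m _ => erefl)
  (cvec_lin_ext (c := c) a v v').
have E2 := nabla_comb2 oc cm (smooth_cst a oc) (s u) (s v) (s v').
rewrite lie_cst scale0r add0r in E2.
apply: (etrans (f_equal (tcomp c m) (etrans E1 E2))).
exact: (tcomp_linear cm).
Qed.

Lemma christoffelE c m Z : cdom c m -> christoffel nabla c m Z = christoffel_op c m Z Z.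
Proof.
move=> cm; rewrite /christoffel.
apply/esym; apply: (etrans (linear_cV_sum Z (christoffel_op_linear1 Z cm))).
apply: eq_bigr => k _; rewrite (linear_cV_sum Z (christoffel_op_linear2 (ev k) cm)) scaler_sumr.
by apply: eq_bigr => l _; rewrite scalerA.
Qed.


Lemma christoffel_quadratic c m : quadratic (christoffel nabla c m).
Proof.
by exists (fun k l => tcomp c m (nabla (cvec c (ev k)) (cvec c (ev l)) m)).
Qed.

(** [nabla_Z Z] for the constant field [Z] of [c] is evaluated in [c'] in two ways. Expanding [Z] in
    the coordinate fields of [c'], the Leibniz rule differentiates the coefficients [h], which
    produces the second derivative of the transition. *)
Lemma christoffel_law c c' e Z : tdom c c' e ->
  christoffel nabla c' (param c e) (tjac c c' e *m Z) =
  tjac c c' e *m christoffel nabla c (param c e) Z -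
  'D_Z (fun y => 'D_Z (trans c c') y) e.
Proof.
move=> cc'; set m := param c e; have [cm Ee] := fparamK cc'.1; have c'm := cc'.2.
rewrite -/m in cm Ee c'm.
pose U := cdom c `&` cdom c'.
have oU : open U by apply: openI; exact: open_cdom.
have Um : U m by split.
have sUc : U `<=` cdom c by move=> x [].
have sUc' : U `<=` cdom c' by move=> x [].
pose h (i : 'I_(p + q)) (x : M) : R := (tjac c c' (coord c x) *m Z) i 0.
have E1 : {in U, cvec c Z =1 fun x => \sum_i h i x *: cvec c' (ev i) x}.
  by move=> x /set_mem[cx c'x]; rewrite (cvec_change _ cx c'x) cvec_sum.
have dj k : diffk k (tdom c c') (fun y => tjac c c' y *m Z).
  have o := open_tdom AO c c'.
  apply: diffk_mulmx; [exact: o| |exact: diffk_cst].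
  by apply: diffk_jac; [exact: o|exact: (trans_smooth AO)].
have uU : udom c U `<=` tdom c c' by move=> y [cy [_ c'y]]; split.
have ouU := open_udom c U oU.
have hE i : {in udom c U, (fun y => (tjac c c' y *m Z) i 0 : R) =1 h i \o param c}.
  by move=> y /set_mem[cy _]; have [_ Ey] := fparamK cy; rewrite /h /= Ey.
have sh i : smooth_fun A U (h i).
  apply/(smooth_funP _ oU sUc) => k.
  apply: (diffk_ext ouU (hE i)).
  by apply: diffk_mxE; [exact: ouU|exact: (diffk_sub uU (dj k))].
have sY i : smooth_field A U (cvec c' (ev i)) := cvec_smooth _ oU sUc'.
have sZ : smooth_field A U (cvec c Z) := cvec_smooth _ oU sUc.
have N1 := nabla_local (X := cvec c Z) (X' := cvec c Z) oU Um (fun _ _ => erefl) E1.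
have N2 := nabla_sum2 (index_enum _) oU Um sh sY sZ.
have N3 i : nabla (cvec c Z) (cvec c' (ev i)) m =
    \sum_j h j m *: nabla (cvec c' (ev j)) (cvec c' (ev i)) m.
  apply: (etrans (nabla_local (Y := cvec c' (ev i)) (Y' := cvec c' (ev i))
    oU Um E1 (fun _ _ => erefl))).
  exact: (nabla_sum1 (index_enum _) oU Um sh sY (sY i)).
have lieh i : lie A (cvec c Z) (h i) m = ('D_Z (fun y => 'D_Z (trans c c') y) e) i 0.
  have ue : udom c U e by split; [exact: cc'.1|exact: Um].
  apply: (etrans (lieE _ oU Um cm (sh i))).
  rewrite Ee vrep_cvec_id; last exact: cc'.1.
  have dd := (dj 0%N).1 _ cc'.
  apply: (etrans (derive_ext (G := fun y => (tjac c c' y *m Z) i 0 : R) Z ouU ue _)).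
    by move=> y yU; rewrite hE.
  apply: (etrans (derive_linear Z (@linear_mxE R (p + q) 1 i 0) dd)).
  congr (fun_of_matrix _ _ _); apply: (derive_ext Z (open_tdom AO c c') cc').
  by move=> y /set_mem ty; apply/esym; exact: (derive_trans AO).
have T1 : tcomp c' m (nabla (cvec c Z) (cvec c Z) m) =
    tjac c c' e *m christoffel nabla c m Z.
  by rewrite (tcomp_change _ cm c'm) Ee (christoffelE Z cm).
move: ('D_Z _ e) lieh => D lieh.
have hm i : h i m = (tjac c c' e *m Z) i 0 by rewrite /h Ee.
have T2 : tcomp c' m (nabla (cvec c Z) (cvec c Z) m) = D +
    christoffel nabla c' m (tjac c c' e *m Z).
  apply: (etrans (f_equal (tcomp c' m) (etrans N1 N2))).
  have [g gE] := linear_pack (tcomp_linear c'm); rewrite gE linear_sum.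
  apply: (etrans (eq_bigr (fun i => D i 0 *: ev i
    + \sum_j (h i m * h j m) *: christoffel_op c' m (ev j) (ev i)) _)) => [i _|].
    rewrite linearD !linearZ /= -gE (tcomp_cvec _ c'm c'm) tjac_id; last first.
      by have [] := fcoordK c'm.
    rewrite mul1mx lieh; congr (_ + _); rewrite N3 gE linear_sum scaler_sumr.
    by apply: eq_bigr => j _; rewrite linearZ /= scalerA -gE.
  rewrite big_split /=; apply: (f_equal2 +%R); first exact: (esym (cV_sum D)).
  rewrite exchange_big; apply: eq_bigr => k _; apply: eq_bigr => l _.
  by rewrite !hm mulrC.
by rewrite -T1 T2 (addrC D) addrK.
Qed.

Lemma christoffel_op_leaf2 c m u v : cdom c m -> dsubmx v = 0 -> dsubmx (christoffel_op c m u
  v) = 0.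
Proof.
move=> cm v0; apply: (cls_tcomp _ cm).2.
case: na => _ _ ad; have [ad1 _] := ad _ (open_cdom c).
have [_] := ad1 _ _ (cvec_adapted c u) (cvec_leaf c v0).
by move=> /(_ m (mem_set cm)).
Qed.

(** Coordinate fields commute, so absence of torsion exchanges [u] and [v]. *)
Lemma christoffel_op_leaf1 c m u v : cdom c m -> dsubmx u = 0 -> dsubmx (christoffel_op c m u
  v) = 0.
Proof.
move=> cm u0; have oc := open_cdom c.
case: na => _ tf _.
have s w := cvec_smooth w oc (@subset_refl _ _).
have := tf _ oc _ _ (s u) (s v) m (mem_set cm).
move=> /(congr1 (tcomp c m)).
have lB : tcomp c m (nabla (cvec c u) (cvec c v) m - nabla (cvec c v) (cvec c u) m) =
    christoffel_op c m u v - christoffel_op c m v u.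
  by have [g gE] := linear_pack (tcomp_linear cm); rewrite /christoffel_op gE linearB.
have [cc _] := fcoordK cm.
have B0 : tcomp c m (bracket A (cvec c u) (cvec c v) m) = 0.
  apply: (etrans (bracketE oc cm cm (s u) (s v))).
  apply: (etrans (f_equal2 (fun a b => a - b) (derive_vrep_cvec v _ cc)
    (derive_vrep_cvec u _ cc))).
  exact: subrr.
rewrite lB B0.
by move=> /eqP; rewrite subr_eq0 => /eqP ->; exact: christoffel_op_leaf2.
Qed.

Lemma christoffel_fol c m Z Z' : cdom c m -> dsubmx Z = dsubmx Z' ->
  dsubmx (christoffel nabla c m Z) = dsubmx (christoffel nabla c m Z').
Proof.
move=> cm ZZ; rewrite !(christoffelE _ cm).
have n0 : dsubmx (Z' - Z) = 0 by rewrite linearB /= ZZ subrr.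
have -> : Z' = Z + (Z' - Z) by rewrite addrC subrK.
move: (Z' - Z) n0 => n n0.
have DE u v w : christoffel_op c m (u + v) w = christoffel_op c m u w + christoffel_op c m v w.
  by have := christoffel_op_linear1 w cm 1 u v; rewrite !scale1r.
have DE' u v w : christoffel_op c m w (u + v) = christoffel_op c m w u + christoffel_op c m w v.
  by have := christoffel_op_linear2 w cm 1 u v; rewrite !scale1r.
rewrite DE !DE'; have lD (x y : E) : dsubmx (x + y) = dsubmx x + dsubmx y.
  exact: linearD.
have alg (g1 g2 g3 g4 : E) : dsubmx g2 = 0 -> dsubmx g3 = 0 -> dsubmx g4 = 0 ->
    dsubmx g1 = dsubmx (g1 + g2 + (g3 + g4)).
  by move=> e2 e3 e4; rewrite !lD e2 e3 e4 !addr0.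
by apply: alg; [exact: christoffel_op_leaf2|exact: christoffel_op_leaf1|exact:
  christoffel_op_leaf1].
Qed.

Lemma christoffel_ok : christ_ok (christoffel nabla).
Proof.
split.
- by move=> c m _; exact: christoffel_quadratic.
- by move=> c m Z Z'; exact: christoffel_fol.
- by move=> c c' e Z; exact: christoffel_law.
Qed.

(** The covariant derivative of an adapted field along an adapted field is adapted, and transverse
    components of adapted fields are constant along plaques. *)
Lemma christoffel_basic c e e' Z : ccod c e -> ccod c e' -> dsubmx e = dsubmx e' ->
  dsubmx (christoffel nabla c (param c e) Z) = dsubmx (christoffel nabla c (param c e') Z).
Proof.
move=> ce ce' ee'; have [cp _] := fparamK ce; have [cp' _] := fparamK ce'.
rewrite (christoffelE Z cp) (christoffelE Z cp').
case: na => _ _ ad; have [_ ad2] := ad _ (open_cdom c).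
exact: (adapted_basic (ad2 _ _ (cvec_adapted c Z) (cvec_adapted c Z)) ce ce' ee').
Qed.

Variable nablaN : (M -> 'cV[R]_q) -> (M -> 'cV[R]_q) -> M -> 'cV[R]_q.
Hypothesis nN : induced_connection nabla nablaN.

(** [christoffelN] lifts a class in the normal bundle by [col_mx 0] before changing chart. This lift
    differs from [nabla] of the coordinate fields by a leaf vector, which remains a leaf vector in
    the chart [c]. *)
Lemma christoffelN_E c m z : cdom c m ->
  christoffelN nablaN c m z = dsubmx (christoffel nabla c m (col_mx 0 z)).
Proof.
move=> cm; rewrite /christoffel big_split_ord /=.
have cu i : (col_mx 0 z : E) (lshift q i) 0 = 0 by rewrite col_mxEu mxE.
rewrite [X in _ = dsubmx (X + _)]big1 => [|i _]; last first.
  by apply: big1 => l _; rewrite cu mul0r scale0r.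
rewrite add0r (linear_sum (@dsubmx R p q 1)); apply: eq_bigr => a _.
rewrite big_split_ord /= [X in _ = dsubmx (X + _)]big1 => [|i _]; last first.
  by rewrite cu mulr0 scale0r.
rewrite add0r (linear_sum (@dsubmx R p q 1)); apply: eq_bigr => b _.
rewrite !(@col_mxEd R p q 1 0 z); apply: (etrans _ (esym (linearZ _ _))).
congr (_ *: _).
apply: (etrans (f_equal (fun x => dsubmx (tcomp c m (col_mx 0 x)))
  (nN (open_cdom c) (cvec_adapted c (ev (rshift p a)))
    (cvec_adapted c (ev (rshift p b))) (mem_set cm)))).
rewrite /cls; move: (nabla _ _ m) => v.
apply/eqP; rewrite -subr_eq0 -(linearB (@dsubmx R p q 1)); apply/eqP.
have [g gE] := linear_pack (tcomp_linear cm); rewrite gE -linearB -gE.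
apply: (cls_tcomp _ cm).2.
by rewrite (linearB (@dsubmx R p q 1)) /= col_mxKd subrr.
Qed.

End Connection.

(** * Normal frames *)

Section NormalFrames.
Context {R : realType} {p q : nat} {T : pointedType} (A : charted T 'cV[R]_(p + q)).
Hypothesis AO : atlas_ok A.
Local Notation E := 'cV[R]_(p + q).
Local Notation Eq := 'cV[R]_(0 + q).
Implicit Types (c : cidx A).

(** Jets of normal frames are read in the transverse coordinates only, but changing chart requires
    smoothness of all coordinates. *)
Definition smooth_germ c (f : Eq -> T) := exists U : set Eq,
  [/\ open U, U 0, forall z, U z -> cdom c (f z) & diff_infty U (coord c \o f)].

Definition ycoord c : T -> 'cV[R]_q := dsubmx \o coord c.

Lemma ytrans_diff c c' k : diffk k (tdom c c') (fun e => dsubmx (trans c c' e)).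
Proof.
apply: (diffk_linear (open_tdom AO c c') (@linear_dsubmx R p q 1)).
exact: (trans_smooth AO).
Qed.

Lemma derive_ytrans c c' e v : tdom c c' e ->
  'D_v (fun e => dsubmx (trans c c' e)) e = drsubmx (tjac c c' e) *m dsubmx v.
Proof.
move=> ce; apply: (etrans (derive_linear v (@linear_dsubmx R p q 1) (trans_diff AO ce))).
by rewrite (derive_trans AO v ce) (dsubmx_tjac AO v ce).
Qed.

(** The first derivative depends only on the transverse part of its direction, on a whole open set,
    so the inner direction may be replaced; [derive_swap] gives the same for the outer one. *)
Lemma derive2_ytrans c c' e a a' b b' : tdom c c' e ->
  dsubmx a = dsubmx a' -> dsubmx b = dsubmx b' ->
  'D_a (fun y => 'D_b (fun e => dsubmx (trans c c' e)) y) e =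
  'D_a' (fun y => 'D_b' (fun e => dsubmx (trans c c' e)) y) e.
Proof.
move=> ce aa bb; have o := open_tdom AO c c'.
have step u v v' : dsubmx v = dsubmx v' ->
    'D_u (fun y => 'D_v (fun e => dsubmx (trans c c' e)) y) e =
    'D_u (fun y => 'D_v' (fun e => dsubmx (trans c c' e)) y) e.
  move=> vv; apply: (derive_ext u o ce) => y /set_mem ty.
  by rewrite (derive_ytrans v ty) (derive_ytrans v' ty) vv.
have sw u v : 'D_u (fun y => 'D_v (fun e => dsubmx (trans c c' e)) y) e =
    'D_v (fun y => 'D_u (fun e => dsubmx (trans c c' e)) y) e.
  exact: (derive_swap u v o ce (ytrans_diff c c' 2)).
apply: (etrans (step a b b' bb)); apply: (etrans (sw a b')).
by apply: (etrans (step b' a a' aa)); exact: sw.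
Qed.

Lemma smooth_germ_change_dom c c' f : smooth_germ c f -> cdom c' (f 0) ->
  exists U : set Eq, [/\ open U, U 0, forall z, U z -> tdom c c' ((coord c \o f) z),
    diff_infty U (coord c \o f) & {in U, coord c' \o f =1 trans c c' \o (coord c \o f)}].
Proof.
move=> [U [oU U0 Uf sf]] c'f; exists (U `&` (coord c \o f) @^-1` tdom c c'); split.
- by apply: (open_preimage oU _ (open_tdom AO c c')) => z; exact: diffoo_diff sf.
- by split=> //; apply: tdom_coord => //; exact: Uf.
- by move=> z [].
- by move=> k; apply: diffk_sub (sf k) => z [].
- by move=> z /set_mem[/Uf cz _]; rewrite /trans /=; have [_ ->] := ao_coordK AO cz.
Qed.

(** Only transverse coordinates of [f] and [g] have equal derivatives. The chain rules still agree,
    because the first two derivatives of the transverse part of a transition ignore leaf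
    directions. *)
Lemma njet_change c c' f g : smooth_germ c f -> smooth_germ c g -> f 0 = g 0 -> cdom c' (f 0) ->
  jet_eq 2 (ycoord c \o f) (ycoord c \o g) -> jet_eq 2 (ycoord c' \o f) (ycoord c' \o g).
Proof.
move=> sf sg fg c'f J.
have [U1 [oU1 U10 Uf1 sf1 E1]] := smooth_germ_change_dom sf c'f.
have [U2 [oU2 U20 Uf2 sf2 E2]] := smooth_germ_change_dom sg (eq_ind _ (cdom c') c'f _ fg).
pose Phi e := dsubmx (trans c c' e).
have L1 : jet_eq 2 (ycoord c' \o f) (fun z => Phi ((coord c \o f) z)).
  by apply: (jet_eq_local oU1 U10) => z zU; rewrite /ycoord /= [coord c' _](E1 z zU).
have L2 : jet_eq 2 (fun z => Phi ((coord c \o g) z)) (ycoord c' \o g).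
  apply: jet_eq_sym.
  by apply: (jet_eq_local oU2 U20) => z zU; rewrite /ycoord /= [coord c' _](E2 z zU).
apply: jet_eq_trans L1 (jet_eq_trans _ L2).
have [_ J1 J2] := (jet_eq2P _ _).1 J.
have x0 : (coord c \o f) 0 = (coord c \o g) 0 by rewrite /= fg.
have x1 := Uf1 0 U10.
have o := open_tdom AO c c'.
have yD1 (F : Eq -> E) (U : set Eq) v z : diff_infty U F -> U z ->
    'D_v (fun z => dsubmx (F z)) z = dsubmx ('D_v F z).
  by move=> sF Uz; exact: (derive_linear v (@linear_dsubmx R p q 1) (diffoo_diff sF Uz)).
have yD2 (F : Eq -> E) (U : set Eq) v w : open U -> U 0 -> diff_infty U F ->
    'D_v (fun z => 'D_w (fun z => dsubmx (F z)) z) 0 = dsubmx ('D_v (fun z => 'D_w F z) 0).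
  move=> oU U0 sF; rewrite (derive_ext v oU U0 (fun z zU => yD1 F U w z sF (set_mem zU))).
  exact: (yD1 _ U v 0 (diffoo_D w sF) U0).
have d1 v : dsubmx ('D_v (coord c \o f) 0) = dsubmx ('D_v (coord c \o g) 0).
  apply: (etrans (esym (yD1 (coord c \o f) _ v 0 sf1 U10))).
  by apply: (etrans (J1 v)); exact: (yD1 (coord c \o g) _ v 0 sf2 U20).
have d2 v w : dsubmx ('D_v (fun z => 'D_w (coord c \o f) z) 0) =
    dsubmx ('D_v (fun z => 'D_w (coord c \o g) z) 0).
  apply: (etrans (esym (yD2 (coord c \o f) _ v w oU1 U10 sf1))).
  by apply: (etrans (J2 v w)); exact: (yD2 (coord c \o g) _ v w oU2 U20 sf2).
have dPhi : diffk 1 (tdom c c') Phi by exact: ytrans_diff.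
have dy u v : dsubmx u = dsubmx v ->
    'D_u Phi ((coord c \o f) 0) = 'D_v Phi ((coord c \o f) 0).
  by move=> uv; rewrite (derive_ytrans u x1) (derive_ytrans v x1) uv.
apply/jet_eq2P; split.
- by rewrite x0.
- move=> v.
  apply: (etrans (derive_comp (G := Phi) v (diffoo_diff sf1 U10) (dPhi.1 _ x1))).
  apply: (etrans (dy _ _ (d1 v))); rewrite x0; apply: esym.
  exact: (derive_comp (G := Phi) v (diffoo_diff sf2 U20) (dPhi.1 _ (Uf2 0 U20))).
- move=> v w.
  apply: (etrans (derive2_comp v w oU1 o U10 Uf1 (sf1 1%N) dPhi)); apply: esym.
  apply: (etrans (derive2_comp v w oU2 o U20 Uf2 (sf2 1%N) dPhi)); apply: esym.
  rewrite -x0; apply: (f_equal2 +%R).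
    exact: (dy _ _ (d2 v w)).
  exact: (derive2_ytrans x1 (d1 _) (d1 _)).
Qed.

Lemma njet_ext r (f g : Eq -> T) : f 0 = g 0 ->
  jet_eq r (ycoord (pref A (f 0)) \o f) (ycoord (pref A (f 0)) \o g) ->
  njet A r f = njet A r g.
Proof.
move=> fg J; apply/seteqP; split=> h [ha h0 Jh]; split=> //.
- by rewrite h0.
- by rewrite /= -fg; exact: jet_eq_trans (jet_eq_sym J) Jh.
- by rewrite h0.
- by move: Jh; rewrite /= -fg => Jh; exact: jet_eq_trans J Jh.
Qed.

Definition incl : Eq -> E := fun z => col_mx 0 z.

Lemma linear_incl : linear incl.
Proof. by move=> a u v; rewrite /incl scale_col_mx add_col_mx scaler0 addr0. Qed.

Lemma incl0 : incl 0 = 0. Proof. by rewrite /incl col_mx0. Qed.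

Lemma chart_germ_incl c f : chart_germ c f -> smooth_germ c (f \o incl) /\ transverse_germ A
  (f \o incl).
Proof.
move=> cf.
(* Needed twice: in [c], and in the preferred chart for [transverse_germ]. *)
have sg c1 : chart_germ c1 f -> exists U : set Eq, [/\ open U, U 0,
   forall z, U z -> cdom c1 (f (incl z)), diff_infty U (coord c1 \o (f \o incl)) &
   forall z, U z -> differentiable (coord c1 \o f) (incl z) /\
     jac (coord c1 \o f) (incl z) \in unitmx /\
    glmx (glof (jac (coord c1 \o f) (incl z))) = jac (coord c1 \o f) (incl z)].
  move=> [U [oU U0 Uf sf jf]].
  have oV : open (setT `&` incl @^-1` U).
    by apply: (open_preimage openT _ oU) => x _; exact: linear_diff linear_incl.
  exists (setT `&` incl @^-1` U); split.
  - exact: oV.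
  - by split=> //; rewrite /preimage /= incl0.
  - by move=> z [_ /Uf].
  - move=> k; have h : diffk k (setT `&` incl @^-1` U) (fun z => (coord c1 \o f) (incl z)).
      refine (diffk_comp oV oU _ _ _); first by move=> z [].
        exact: diffk_lin linear_incl.
      exact: sf.
    exact: h.
  - move=> z [_ Uz]; split; last exact: jf.
    exact: diffoo_diff sf Uz.
split.
  by have [U [oU U0 Uf sf _]] := sg c cf; exists U.
have c0f : chart_germ (pref A (f 0)) f by exact: ((chart_germP A f).1 (chart_germ_adapted AO
  cf)).
have [U [oU U0 Uf sf jf]] := sg _ c0f.
rewrite /transverse_germ /= incl0; exists U; split=> //; first exact/smooth_onP.
move=> z Uz w; have [dz [uz gz]] := jf z Uz.
set J := jac _ (incl z) in uz gz.
have uD : drsubmx J \in unitmx.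
  by move: uz; rewrite -gz glmx_unit drsubmx_glmx => /andP[].
have DE v : dsubmx ('D_v (coord (pref A (f 0)) \o (f \o incl)) z) = drsubmx J *m v.
  rewrite [X in dsubmx X](derive_precomp (coord (pref A (f 0)) \o f) z v linear_incl).
  by rewrite (derive_jac _ dz) -/J dsubmx_mul col_mxKu col_mxKd mulmx0 add0r.
exists (invmx (drsubmx J) *m dsubmx w); split=> [|v].
  by rewrite linearB /= DE mulmxA mulmxV// mul1mx subrr.
rewrite linearB /= DE => /eqP; rewrite subr_eq0 => /eqP ->.
by rewrite mulmxA mulVmx// mul1mx.
Qed.

End NormalFrames.

Section TransverseJets.
Context {R : realType} {p q : nat} {T : pointedType} (A : charted T 'cV[R]_(p + q)).
Hypothesis AO : atlas_ok A.
Local Notation E := 'cV[R]_(p + q).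
Local Notation Eq := 'cV[R]_(0 + q).
Implicit Types (c : cidx A) (f g : Eq -> T).

Lemma smooth_germ_dom c f : smooth_germ c f -> cdom c (f 0).
Proof. by move=> [U [_ U0 + _]]; exact. Qed.

Lemma smooth_germ_change c c' f : smooth_germ c f -> cdom c' (f 0) -> smooth_germ c' f.
Proof.
move=> cf c'f; have [U [oU U0 Uf sf EU]] := smooth_germ_change_dom AO cf c'f.
have [V [oV V0 Vf _]] := cf.
exists (U `&` V); split.
- exact: openI.
- by [].
- move=> z [Uz Vz]; have [_] := Uf z Uz; rewrite /=.
  by have [_ ->] := ao_coordK AO (Vf z Vz).
- have sc k : diffk k U (fun z => trans c c' ((coord c \o f) z)).
    by apply: (diffk_comp oU (open_tdom AO c c') Uf (sf k)); exact: (trans_smooth AO).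
  move=> k; apply: diffk_sub (diffk_ext oU _ (sc k)) => [z []//|z zU].
  by rewrite EU.
Qed.

Lemma transverse_smooth_germ c f : transverse_germ A f -> cdom c (f 0) -> smooth_germ c f.
Proof.
move=> [U [oU U0 Uf sf _]] cf; apply: (smooth_germ_change (c := pref A (f 0))) cf.
by exists U; split=> //; exact/smooth_onP.
Qed.

Lemma njet_eqP c f g : smooth_germ c f -> smooth_germ c g -> f 0 = g 0 ->
  jet_eq 2 (ycoord c \o f) (ycoord c \o g) -> njet A 2 f = njet A 2 g.
Proof.
move=> sf sg fg J; apply: njet_ext => //.
exact: (njet_change AO sf sg fg (ao_pref AO (smooth_germ_dom sf)) J).
Qed.

(** [smooth_germ] forgets transversality, so that [f] itself need not belong to its class;
    nonemptiness is obtained separately in [PN_param_ne]. *)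
Lemma get_njet c f : smooth_germ c f -> njet A 2 f !=set0 -> let g := get (njet A 2 f) in
  [/\ smooth_germ c g, g 0 = f 0 & jet_eq 2 (ycoord c \o f) (ycoord c \o g)].
Proof.
move=> cf ne g; have cf0 := smooth_germ_dom cf.
have [ga g0 J] : njet A 2 f g by exact: getPex.
have cg : smooth_germ c g by apply: transverse_smooth_germ; rewrite ?g0.
split=> //; have cp := ao_pref AO cf0.
apply: (njet_change AO (smooth_germ_change cf cp) _ (esym g0) cf0 J).
by apply: (smooth_germ_change cg); rewrite g0.
Qed.

End TransverseJets.

Lemma jet_eq_precomp {R : realType} (V W X : normedModType R) r (L : V -> W)
    (F G : W -> X) : linear L -> jet_eq r F G ->
  jet_eq r (fun z => F (L z)) (fun z => G (L z)).
Proof.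
move=> lL J vs hs; have L0 : L 0 = 0.
  by have := lL (-1) 0 0; rewrite scaler0 addr0 scaleN1r addNr.
suff H (F0 : W -> X) : Defs.iterD vs (fun z => F0 (L z)) =
    (fun z => Defs.iterD (map L vs) F0 (L z)).
  by rewrite !H L0; apply: J; rewrite size_map.
elim: vs {hs} => //= v vs ->; apply/funext => z.
exact: (derive_precomp (Defs.iterD [seq L i | i <- vs] F0) z v lL).
Qed.

Lemma quadratic_dsubmx {R : realType} {p q : nat}
    (Q : 'cV[R]_(p + q) -> 'cV[R]_(p + q)) :
  quadratic Q -> quadratic (fun z : 'cV[R]_q => dsubmx (Q (col_mx 0 z))).
Proof.
move=> [g gE]; exists (fun k l => dsubmx (g (rshift p k) (rshift p l))) => Z.
rewrite gE big_split_ord /= big1 ?add0r => [|i _]; last first.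
  by apply: big1 => l _; rewrite col_mxEu mxE mul0r scale0r.
rewrite linear_sum /=; apply: eq_bigr => k _.
rewrite big_split_ord /= big1 ?add0r => [|i _]; last first.
  by rewrite [X in _ * X]col_mxEu [X in _ * X]mxE mulr0 scale0r.
rewrite linear_sum /=; apply: eq_bigr => l _.
by rewrite linearZ /= !col_mxEd.
Qed.

Section TransverseFrames.
Context {R : realType} {p q : nat} {T : pointedType} (A : charted T 'cV[R]_(p + q)).
Hypothesis AO : atlas_ok A.
Local Notation E := 'cV[R]_(p + q).
Local Notation Eq := 'cV[R]_(0 + q).
Local Notation EN := (E * gl R 0 q * 'rV[R]_q)%type.
Variable G : cidx A -> T -> E -> E.
Hypothesis CH : christ_ok G.
Variable GN : cidx A -> T -> 'cV[R]_q -> 'cV[R]_q.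
Hypothesis GNE : forall c m Z, cdom c m -> dsubmx (G c m Z) = GN c m (dsubmx Z).
Implicit Types (c : cidx A) (e : EN).

Definition nframe_model c e : Eq -> Eq :=
  model (dsubmx e.1.1 : Eq) (GN c (param c e.1.1)) (glmx e.1.2) (row_mx 0 e.2).

Definition nframe c e : Eq -> T :=
  nproj_frame GN c e.1.1 \o homography (e.1.2, e.2, 1).

Definition normal_part (e : pgl R p q) : EN := ((e.1.1, (0, 0, e.1.2.2)), e.2).

(* The leaf directions of a normal frame are completed by the coordinate fields. *)
Definition pgl_lift e : pgl R p q := ((e.1.1, (1%:M, 0, e.1.2.2)), e.2).

Lemma nframeE c e z : nframe c e z = param c (col_mx (usubmx e.1.1) (nframe_model c e z)).
Proof.
congr param; rewrite -{1}(vsubmxK e.1.1) add_col_mx addr0; congr col_mx.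
exact: addrA.
Qed.

Lemma nframe_quadratic c e : ccod c e.1.1 -> quadratic (GN c (param c e.1.1) : Eq -> Eq).
Proof.
move=> ce; have [cm _] := ao_paramK AO ce.
have := quadratic_dsubmx (ch_quad CH cm).
suff -> : (fun z => dsubmx (G c (param c e.1.1) (col_mx 0 z))) = GN c (param c e.1.1).
  exact.
by apply/funext => z; rewrite GNE// col_mxKd.
Qed.

Lemma nframe0 c e : ccod c e.1.1 -> nframe c e 0 = param c e.1.1.
Proof.
move=> ce; rewrite nframeE /nframe_model (model0 _ _ _ (nframe_quadratic ce)).
by rewrite vsubmxK.
Qed.

Lemma nframe_germ c e : PN_cod c e ->
  smooth_germ c (nframe c e) /\ forall r, jet_eq r (ycoord c \o nframe c e) (nframe_model c e).
Proof.
move=> ce; pose D := hom_dom (row_mx (0 : 'rV[R]_0) e.2).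
have oD : open D by exact: open_hom_dom.
pose F (z : Eq) : E := col_mx (usubmx e.1.1) 0 + incl (nframe_model c e z).
have FE z : F z = col_mx (usubmx e.1.1) (nframe_model c e z).
  by rewrite /F /incl add_col_mx addr0 add0r.
have sm k : diffk k D (nframe_model c e) by apply: diffk_model; exact: nframe_quadratic ce.1.
have sF k : diffk k D F.
  apply: (diffkD (F := fun=> col_mx (usubmx e.1.1) 0) oD); first exact: diffk_cst.
  exact: (diffk_linear oD linear_incl (sm k)).
pose U := D `&` F @^-1` ccod c.
have oU : open U.
  by apply: (open_preimage oD _ (ao_open AO c)) => z; exact: diffk_diff (sF 0%N).
have U0 : U 0.
  split; first exact: hom_dom0.
  rewrite /preimage /= FE /nframe_model (model0 _ _ _ (nframe_quadratic ce.1)) vsubmxK;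
    exact: ce.1.
have EU z : U z -> coord c (nframe c e z) = F z.
  by move=> [_ /(ao_paramK AO)[_]]; rewrite nframeE FE.
split.
  exists U; split=> //.
  - by move=> z [_ /(ao_paramK AO)[]]; rewrite nframeE FE.
  - move=> k; apply: (diffk_ext oU) => [z zU|]; first by rewrite /= EU//; exact: set_mem.
    by apply: diffk_sub (sF k) => z [].
move=> r; apply: (jet_eq_local oU U0) => z /set_mem zU.
by rewrite /ycoord /= EU// FE col_mxKd.
Qed.

Lemma nframe_model_normal_part c (e : pgl R p q) z : PF_cod c e ->
  dsubmx (frame_model G c e (incl z)) = nframe_model c (normal_part e) z.
Proof.
move=> ce; have [cm _] := ao_paramK AO ce.1.
have HE : dsubmx (hom (glmx e.1.2) (row_mx 0 e.2) (incl z)) =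
    hom (glmx (normal_part e).1.2) (row_mx 0 (normal_part e).2) z.
  rewrite /hom linearZ /= row0_mul dsubmx_glmx /incl col_mxKd.
  by rewrite row0mx glmx0.
rewrite /frame_model /nframe_model /model.
have dB (x y : E) : dsubmx (x - y) = dsubmx x - dsubmx y by exact: linearB.
have dD (x y : E) : dsubmx (x + y) = dsubmx x + dsubmx y by exact: linearD.
have dZ k (x : E) : dsubmx (k *: x) = k *: dsubmx x by exact: linearZ.
move: HE; rewrite dB dD; move: (hom _ _ (incl z)) => H HE.
by rewrite dZ GNE// HE.
Qed.

Lemma PN_cod_normal_part c (e : pgl R p q) : PF_cod c e -> PN_cod c (normal_part e).
Proof. by move=> [ce /andP[_ ge]]; split=> //; rewrite isGL0. Qed.

Lemma normal_part_lift e : normal_part (pgl_lift e) = e.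
Proof. by case: e => [[x a] xi]; congr (_, _, _); exact: gl0_eq. Qed.

Lemma PF_cod_lift c e : PN_cod c e -> PF_cod c (pgl_lift e).
Proof.
move=> [ce ge]; split=> //; rewrite isGL0 in ge.
by apply/andP; split=> //; exact: unitmx1.
Qed.

(** Combined with [pgl_lift], this exhibits each normal frame as the restriction of an adapted one,
    so that nonemptiness and the changes of charts of [PN] are inherited from [PF]. *)
Lemma frame_incl c (e : pgl R p q) : PF_cod c e ->
  njet A 2 (frame G c e \o incl) = PN_param GN c (normal_part e).
Proof.
move=> ce; have ce' := PN_cod_normal_part ce.
have [fg Jf] := frame_germ AO CH ce; have [ng Jn] := nframe_germ ce'.
have [sg _] := chart_germ_incl AO fg.
apply: (njet_eqP AO sg ng); first by rewrite /= incl0 (frame0 AO CH ce) (nframe0 ce'.1).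
apply: jet_eq_trans (jet_eq_sym (Jn 2)).
pose D := incl @^-1` hom_dom (row_mx (0 : 'rV[R]_p) e.2).
pose U := (setT `&` D) `&` (fun z => frame_model G c e (incl z)) @^-1` ccod c.
have oD : open (setT `&` D).
  apply: (open_preimage openT _ (@open_hom_dom _ _ _)) => x _.
  exact: linear_diff linear_incl.
have dm x : hom_dom (row_mx (0 : 'rV[R]_p) e.2) x -> differentiable (frame_model G c e) x.
  move=> hx; apply: (diffk_diff (k := 0)) hx; apply: diffk_model; exact: (frame_quadratic AO
    CH ce).
have oU : open U.
  apply: (open_preimage oD _ (ao_open AO c)) => z [_ zD].
  apply: differentiable_comp; first exact: linear_diff linear_incl.
  exact: dm.
have U0 : U 0.
  split; first by split=> //; rewrite /D /preimage /= incl0; exact: hom_dom0.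
  rewrite /preimage /= incl0 /frame_model (model0 _ _ _ (frame_quadratic AO CH ce)); exact:
    ce.1.
apply: (jet_eq_local oU U0) => z /set_mem[_ /(ao_paramK AO)[_ E1]].
by rewrite -(nframe_model_normal_part z ce) -[in RHS]E1.
Qed.

Lemma PN_param_ne c e : PN_cod c e -> PN_param GN c e !=set0.
Proof.
move=> ce; have cl := PF_cod_lift ce.
rewrite -(normal_part_lift e) -(frame_incl cl); exists (frame G c (pgl_lift e) \o incl).
split=> //; have [fg _] := frame_germ AO CH cl.
by have [] := chart_germ_incl AO fg.
Qed.

Lemma get_PN c e : PN_cod c e -> let g := get (PN_param GN c e) in
  [/\ smooth_germ c g, g 0 = param c e.1.1 & jet_eq 2 (ycoord c \o g) (nframe_model c e)].
Proof.
move=> ce g; have [ng Jn] := nframe_germ ce.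
have [h1 h2 h3] := get_njet AO ng (PN_param_ne ce).
split=> //; first by rewrite [LHS]h2 (nframe0 ce.1).
exact: jet_eq_trans (jet_eq_sym h3) (Jn 2).
Qed.

Lemma jbase_PN c e : PN_cod c e -> jbase (PN_param GN c e) = param c e.1.1.
Proof. by move=> /get_PN[]. Qed.

Lemma PN_param_inj c e e' : PN_cod c e -> PN_cod c e' ->
  PN_param GN c e = PN_param GN c e' -> e = e'.
Proof.
move=> ce ce' ee'; have [_ b1 J1] := get_PN ce; have [_ b2 J2] := get_PN ce'.
rewrite ee' in b1 J1.
have E1 : e.1.1 = e'.1.1.
  have [_ <-] := ao_paramK AO ce.1; have [_ <-] := ao_paramK AO ce'.1.
  by rewrite -b1 -b2.
have := jet_eq_trans (jet_eq_sym J1) J2.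
rewrite /nframe_model -E1 => /(model_inj (nframe_quadratic ce.1)).
rewrite glmx_unit ce.2 => /(_ isT)[_ /glmx_inj E2 /eq_row_mx[_ E3]].
by move: E1 E2 E3; case: e {ce ee' b1 J1} => [[? ?] ?];
   case: e' {ce' b2 J2} => [[? ?] ?] /= -> -> ->.
Qed.

Lemma PN_coordK c e : PN_cod c e -> @coord _ _ _ (PNc GN) c (PN_param GN c e) = e.
Proof.
move=> ce; rewrite /=.
have : [set e' | PN_cod c e' /\ PN_param GN c e' = PN_param GN c e]
    (get [set e' | PN_cod c e' /\ PN_param GN c e' = PN_param GN c e]).
  by apply: getPex; exists e.
by move=> [ce' /PN_param_inj]; exact.
Qed.

Lemma PNP u : PN GN u <-> exists c e, PN_cod c e /\ u = PN_param GN c e.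
Proof.
split=> [[c [m [h [cm hH ->]]]]|[c [e [ce ->]]]]; last first.
  have [cp E1] := ao_paramK AO ce.1.
  exists c, (param c e.1.1), (e.1.2, e.2, 1); split; first exact: cp.
    by apply/andP; split; [exact: ce.2|exact: oner_neq0].
  by rewrite E1.
have [cc _] := ao_coordK AO cm; case/andP: hH => ha h0.
exists c, ((coord c m, h.2^-1 *: h.1.1), h.2^-1 *: h.1.2); split.
  split=> //=; rewrite -glmx_unit glmxZ unitmxZ ?glmx_unit//.
  by rewrite unitfE invr_eq0.
by rewrite (homographyE h0).
Qed.

Lemma pF2_PF c (e : pgl R p q) : PF_cod c e ->
  pF2 A (PF_param G c e) = PN_param GN c (normal_part e).
Proof.
move=> ce; rewrite -(frame_incl ce); have [fg _] := frame_germ AO CH ce.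
have [gg g0 J] := get_jet AO (leqnn 2) fg.
have [s1 _] := chart_germ_incl AO gg; have [s2 _] := chart_germ_incl AO fg.
apply: (njet_eqP AO s1 s2); first by rewrite /= incl0.
have [U1 [oU1 U10 _ sf1 _]] := gg; have [U2 [oU2 U20 _ sf2 _]] := fg.
have J2 : jet_eq 2 (ycoord c \o get (PF_param G c e)) (ycoord c \o frame G c e).
  have lin : diffk 1 setT (dsubmx : E -> 'cV[R]_q).
    exact: diffk_lin (@linear_dsubmx R p q 1).
  refine (jet_eq_comp (G1 := dsubmx) (G2 := dsubmx) (leqnn 2) oU1 oU2 openT U10 U20
    _ _ (sf1 1%N) (sf2 1%N) lin lin (jet_eq_sym J) _) => //.
exact: (jet_eq_precomp (@linear_incl R p q) J2).
Qed.

End TransverseFrames.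

Arguments open_pdom {R p q T A} AO c c'.

Lemma gl_ext {R : realType} {p q : nat} (a b : gl R p q) :
  a.1.1 = b.1.1 -> a.1.2 = b.1.2 -> a.2 = b.2 -> a = b.
Proof. by move: a b => [[? ?] ?] [[? ?] ?] /= -> -> ->. Qed.

(** * Coordinate changes and derivatives on the normal frame bundle *)

Section TransverseTransitions.
Context {R : realType} {p q : nat} {T : pointedType} (A : charted T 'cV[R]_(p + q)).
Hypothesis AO : atlas_ok A.
Local Notation E := 'cV[R]_(p + q).
Local Notation Eq := 'cV[R]_(0 + q).
Local Notation EN := (E * gl R 0 q * 'rV[R]_q)%type.
Implicit Types (c : cidx A) (e X Y : EN).

(** The projection to the frame bundle of the leaf space, in coordinates; see [to_leafE]. *)
Definition leaf_part e : pgl R 0 q := ((dsubmx e.1.1 : Eq, e.1.2), e.2).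

Lemma linear_leaf_part : linear leaf_part.
Proof. by move=> a x y; apply: pgl_ext => //=; rewrite linearP. Qed.

Lemma linear_normal_part : linear (@normal_part R p q).
Proof. by move=> a x y; congr (_, _, _); exact: gl0_eq. Qed.

Lemma diffk_lift k (U : set EN) : open U -> diffk k U (@pgl_lift R p q).
Proof.
move=> oU.
pose L e : pgl R p q := ((e.1.1, (0, 0, e.1.2.2)), e.2).
have lL : linear L.
  move=> a x y; apply: pgl_ext => //=.
  by apply: gl_ext; rewrite //= scaler0 addr0.
apply: (diffk_ext (F := fun e => ((0, (1%:M, 0, 0)), 0) + L e) oU).
  move=> e _; apply: pgl_ext; rewrite //= ?add0r//.
  by apply: gl_ext; rewrite //= ?addr0 ?add0r.
apply: (diffkD oU); first exact: diffk_cst.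
exact: diffk_lin lL.
Qed.

(** The leaf block introduced by [pgl_lift] is forgotten by [normal_part]; the detour makes
    smoothness a consequence of [ptrans_smooth]. *)
Definition ntrans c c' e : EN := normal_part (ptrans c c' (pgl_lift e)).

Definition ndom c c' : set EN := [set e | PN_cod c e /\ tdom c c' e.1.1].

Lemma ndom_lift c c' e : ndom c c' e -> pdom c c' (pgl_lift e).
Proof. by move=> [/PF_cod_lift ce h]. Qed.

Lemma open_ndom c c' : open (ndom c c').
Proof.
have := open_preimage openT (fun x _ => diffk_diff (diffk_lift 0 openT) (I : setT x))
  (open_pdom AO c c').
rewrite (_ : _ `&` _ = ndom c c')//; apply/seteqP; split=> e.
  by move=> [_ [[ce ge] h]]; split=> //; split=> //; rewrite isGL0; case/andP: ge.
by move=> /ndom_lift.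
Qed.

Arguments open_ndom : clear implicits.

Lemma open_PN_cod c : open (@PN_cod R p q T A c).
Proof.
have := open_preimage openT (fun x _ => diffk_diff (diffk_lift 0 openT) (I : setT x))
  (open_PF_cod AO c).
rewrite (_ : _ `&` _ = PN_cod c)//; apply/seteqP; split=> e.
  by move=> [_ [ce ge]]; split=> //; rewrite isGL0; case/andP: ge.
by move=> /PF_cod_lift.
Qed.

Arguments open_PN_cod : clear implicits.

Lemma ntrans_smooth c c' k : diffk k (ndom c c') (ntrans c c').
Proof.
have d : diffk k (ndom c c') (fun e => ptrans c c' (pgl_lift e)).
  apply: (diffk_comp (open_ndom c c') (open_pdom AO c c') (@ndom_lift c c')).
    exact: diffk_lift (open_ndom c c').
  exact: (ptrans_smooth AO).
exact: (diffk_linear (open_ndom c c') linear_normal_part d).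
Qed.

Section Frames.
Variable G : cidx A -> T -> E -> E.
Hypothesis CH : christ_ok G.
Variable GN : cidx A -> T -> 'cV[R]_q -> 'cV[R]_q.
Hypothesis GNE : forall c m Z, cdom c m -> dsubmx (G c m Z) = GN c m (dsubmx Z).

Lemma PN_trans c c' e : ndom c c' e ->
  ndom c' c (ntrans c c' e) /\ PN_param GN c e = PN_param GN c' (ntrans c c' e).
Proof.
move=> h; have [ce cc'] := ndom_lift h; have [cl El] := PF_trans AO CH ce cc'.2.
have [cV E1 E0] := tdomV AO cc'; split.
  by split; [exact: PN_cod_normal_part cl|].
by rewrite -[in LHS](normal_part_lift e) -(pF2_PF AO CH GNE ce) El (pF2_PF AO CH GNE cl).
Qed.

Lemma coord_PN c c' e : ndom c c' e ->
  @coord _ _ _ (PNc GN) c' (PN_param GN c e) = ntrans c c' e.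
Proof.
move=> h; have [h' ->] := PN_trans h.
exact: (PN_coordK AO CH GNE h'.1).
Qed.

Lemma ntransK c c' e : ndom c c' e -> ntrans c' c (ntrans c c' e) = e.
Proof.
move=> h; have [h' E1] := PN_trans h; have [h'' E2] := PN_trans h'.
apply: (PN_param_inj AO CH GNE h''.1 h.1).
exact: (etrans (esym E2) (esym E1)).
Qed.

Lemma derive_ntransK c c' e Z : ndom c c' e ->
  'D_('D_Z (ntrans c c') e) (ntrans c' c) (ntrans c c' e) = Z.
Proof.
move=> h; have [h' _] := PN_trans h.
have d1 := diffk_diff (ntrans_smooth c c' 0) h.
have d2 := diffk_diff (ntrans_smooth c' c 0) h'.
apply: (etrans (esym (derive_comp Z d1 d2))).
apply: (etrans (derive_ext (G := id) Z (open_ndom c c') h _)); last exact: derive_id.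
by move=> y /set_mem hy; exact: ntransK.
Qed.

Lemma pref_ndom c e : PN_cod c e -> ndom c (pref A (param c e.1.1)) e.
Proof.
move=> ce; have [cp _] := ao_paramK AO ce.1; split=> //; split; first exact: ce.1.
exact: ao_pref cp.
Qed.

Lemma tcomp_PN c e X (c0 := pref A (param c e.1.1)) : PN_cod c e ->
  tcomp (C := PNc GN) c (PN_param GN c e) X = 'D_X (ntrans c0 c) (ntrans c c0 e).
Proof.
move=> ce; have h := pref_ndom ce; have [h' _] := PN_trans h.
have E1 : pref (PNc GN) (PN_param GN c e) = c0.
  by rewrite -[LHS]/(pref A (jbase _)) (jbase_PN AO CH GNE ce).
rewrite /tcomp E1 (coord_PN h).
apply: (derive_ext X (open_ndom c0 c) h') => y /set_mem hy.
exact: coord_PN.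
Qed.

(** [lie] differentiates in the preferred chart. A function that factors through [leaf_part] in [c]
    only sees the leaf space part of the vector, in the components of [c]. *)
Lemma lie_PN (W : normedModType R) c e (X : set (Eq -> T) -> EN)
    (F : set (Eq -> T) -> W) (Ft : pgl R 0 q -> W) : PN_cod c e ->
  differentiable Ft (leaf_part e) ->
  (forall e', PN_cod c e' -> F (PN_param GN c e') = Ft (leaf_part e')) ->
  lie (PNc GN) X F (PN_param GN c e) =
  'D_(leaf_part (tcomp (C := PNc GN) c (PN_param GN c e) (X (PN_param GN c e)))) Ft
    (leaf_part e).
Proof.
move=> ce dF FE; set u := PN_param GN c e; set c0 := pref A (param c e.1.1).
have h := pref_ndom ce; have [h' _] := PN_trans h.
have E1 : pref (PNc GN) u = c0.
  by rewrite -[LHS]/(pref A (jbase _)) (jbase_PN AO CH GNE ce).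
rewrite /lie E1 (coord_PN h) (tcomp_PN _ ce) -/c0.
have dn := diffk_diff (ntrans_smooth c0 c 0) h'.
have dl : differentiable (fun y => leaf_part (ntrans c0 c y)) (ntrans c c0 e).
  exact: diffk_diff (diffk_linear (open_ndom c0 c) linear_leaf_part (ntrans_smooth c0 c 0)) h'.
have eK := ntransK h.
have dF' : differentiable Ft (leaf_part (ntrans c0 c (ntrans c c0 e))) by rewrite eK.
have S1 : 'D_(X u) (F \o param (c := PNc GN) c0) (ntrans c c0 e) =
    'D_(X u) (fun y => Ft (leaf_part (ntrans c0 c y))) (ntrans c c0 e).
  apply: (derive_ext (X u) (open_ndom c0 c) h') => y /set_mem hy.
  by have [hy' Ey] := PN_trans hy; apply: (etrans (f_equal F Ey)); exact: FE hy'.1.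
apply: (etrans S1); apply: (etrans (derive_comp (G := Ft) (X u) dl dF')).
by rewrite [in RHS]/u (derive_linear (X u) linear_leaf_part dn) eK.
Qed.

End Frames.
End TransverseTransitions.

(** * The local leaf spaces *)

Section LeafSpace.
Context {R : realType} {p q : nat} {T : pointedType} (A : charted T 'cV[R]_(p + q)).
Hypothesis AO : atlas_ok A.
Local Notation E := 'cV[R]_(p + q).
Local Notation Eq := 'cV[R]_(0 + q).
Local Notation EN := (E * gl R 0 q * 'rV[R]_q)%type.
Variable G : cidx A -> T -> E -> E.
Hypothesis CH : christ_ok G.
Variable GN : cidx A -> T -> 'cV[R]_q -> 'cV[R]_q.
Hypothesis GNE : forall c m Z, cdom c m -> dsubmx (G c m Z) = GN c m (dsubmx Z).
Hypothesis GNb : forall c m m', cdom c m -> cdom c m' ->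
  dsubmx (coord c m) = dsubmx (coord c m') -> GN c m = GN c m'.
Implicit Types (c : cidx A) (e : EN).

Local Notation leafc c := (@leaf_space R p q T A c).

Definition leafG c : cidx (leafc c) -> Eq -> Eq -> Eq :=
  @leaf_space_christoffel R p q T A GN c.

Local Notation leafp c := (@PF_param R 0 q Eq (leafc c) (@leafG c) tt).

Definition leafcod c : set (pgl R 0 q) := @PF_cod R 0 q Eq (leafc c) tt.

(** The projection of an open set is the union over [u] of its preimages under the affine sections
    [y |-> (u, y)]. *)
Lemma open_leaf c : open (dsubmx @` ccod c : set Eq).
Proof.
rewrite (_ : (_ @` _) = \bigcup_u (setT `&`
  (fun y : Eq => col_mx u 0 + incl y) @^-1` ccod c)); last first.
  apply/seteqP; split=> y.
    move=> [x cx <-]; exists (usubmx x) => //; split=> //.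
    by rewrite /preimage /= /incl add_col_mx addr0 add0r vsubmxK.
  move=> [u _ [_ h]]; exists (col_mx u 0 + incl y) => //.
  by rewrite /incl add_col_mx addr0 add0r col_mxKd.
apply: bigcup_open => u _; apply: (open_preimage openT _ (ao_open AO c)) => x _.
apply: differentiableD; first exact: differentiable_cst.
exact: linear_diff linear_incl.
Qed.

Arguments open_leaf : clear implicits.

Lemma leaf_ok c : @atlas_ok R 0 q Eq (leafc c).
Proof. exact: (@open_charted_ok R 0 q _ (open_leaf c)). Qed.

(** [leaf_space_christoffel] picks a point over the transverse coordinates by [get]; by [GNb] the
    choice does not affect the value. *)
Lemma leafGE c x : ccod c x -> @leafG c tt (dsubmx x) = GN c (param c x).
Proof.
move=> cx; have [cp E0] := ao_paramK AO cx; apply/funext => z.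
rewrite /leafG /leaf_space_christoffel.
set S := [set m | _]; have [cm ym] : S (get S).
  by apply: getPex; exists (param c x); split; rewrite // E0.
by rewrite (GNb cm cp)// E0.
Qed.

Lemma leaf_christ c : @christ_ok R 0 q Eq (leafc c) (@leafG c).
Proof.
split.
- move=> [] m [x cx <-]; rewrite (leafGE cx).
  exact: (nframe_quadratic AO CH GNE (e := ((x, glid), 0)) cx).
- by move=> [] m Z Z' _; rewrite (dsubmx0 Z) (dsubmx0 Z') => ->.
- move=> [] [] e Z [h _].
  have tE : @trans R 0 q Eq (leafc c) tt tt = id by [].
  have -> : @tjac R 0 q Eq (leafc c) tt tt e = 1%:M.
    have d : differentiable (id : Eq -> Eq) e by exact: linear_diff.
    apply: mulmx_inj => v; rewrite mul1mx; apply: (etrans (esym (derive_jac v d))).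
    exact: derive_id.
  have -> : 'D_Z (fun y => 'D_Z (@trans R 0 q Eq (leafc c) tt tt) y) e = 0.
    rewrite tE; have -> : (fun y : Eq => 'D_Z id y) = (fun=> Z).
      by apply/funext => y; exact: derive_id.
    exact: derive_cst.
  by rewrite !mul1mx subr0.
Qed.

Lemma leafcod_leaf_part c e : PN_cod c e -> leafcod c (leaf_part e).
Proof. by move=> [ce ge]; split=> //; exists e.1.1. Qed.

Lemma to_leafE c e : PN_cod c e ->
  to_leaf_space (A := A) c (PN_param GN c e) = leafp c (leaf_part e).
Proof.
move=> ce; have [sg g0 J] := get_PN AO CH GNE ce.
set g := get _ in sg g0 J.
have [_ E0] := ao_paramK AO ce.1.
have FE z : proj_frame (@leafG c) tt (leaf_part e).1.1 (homography ((leaf_part e).1.2,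
  (leaf_part e).2, 1) z) =
    nframe_model GN c e z.
  by rewrite /proj_frame /= (leafGE ce.1).
apply: jet_ext; rewrite /=.
  apply: (etrans _ (esym (FE 0))); rewrite /nframe_model (model0 _ _ _ (nframe_quadratic AO
    CH GNE ce.1)).
  by apply: (etrans (f_equal (fun m => dsubmx (coord c m)) g0)); rewrite E0.
have -> : proj_frame (@leafG c) tt (leaf_part e).1.1 \o
    homography ((leaf_part e).1.2, (leaf_part e).2, 1) = nframe_model GN c e by apply/funext.
exact: J.
Qed.

End LeafSpace.

(** Smoothness is known for constant arguments, as in [smooth_form]; linearity and a basis extend it
    to a varying argument. *)
Lemma diffk_apply {R : realType} (V W X : normedModType R) {fW : findim W} {fX : findim X}
    k (U : set V) (w : V -> W -> X) (L : V -> W) : open U ->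
  (forall e, U e -> linear (w e)) -> (forall b, diffk k U (w ^~ b)) -> diffk k U L ->
  diffk k U (fun e => w e (L e)).
Proof.
move=> oU lw dw dL; have [I [b [l [lc vE]]]] := fW.
have h i : diffk k U (fun x => l i (L x) *: w x (b i)).
  apply: (diffkZ oU _ (dw (b i))).
  exact: (diffk_linear oU (linearP (l i)) dL).
apply: diffk_ext (diffk_sum (index_enum I) oU (fun i _ => h i)) => // x xU.
have [g gE] := linear_pack (lw _ (set_mem xU)).
rewrite gE [in RHS](vE (L x)) linear_sum.
by apply: eq_bigr => i _; rewrite linearZ.
Qed.

Lemma diffk_derive_field {R : realType} (V W : normedModType R) {fV : findim V}
    {fW : findim W} k (U : set V) (X : V -> V) (F : V -> W) : open U ->
  diffk k U X -> diffk k.+1 U F -> diffk k U (fun x => 'D_(X x) F x).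
Proof.
move=> oU dX [dF DF].
apply: (diffk_apply (w := fun x v => 'D_v F x) oU _ DF dX) => x Ux a u v.
by rewrite !deriveE ?linearP//; exact: dF.
Qed.

(** * Smooth horizontal fields of a Cartan connection *)

Section StandardField.
Context {R : realType} {p q : nat} {T : pointedType} (A : charted T 'cV[R]_(p + q)).
Hypothesis AO : atlas_ok A.
Local Notation E := 'cV[R]_(p + q).
Variable G : cidx A -> T -> E -> E.
Hypothesis CH : christ_ok G.
Variable w : set (E -> T) -> pgl R p q -> pgl R p q.
Hypothesis wC : cartan_connection G w.
Hypothesis wP : has_canonical_part G w.
Implicit Types (c : cidx A) (e X Y : pgl R p q) (v : E).

(* [Y] has the required solder part; the fundamental field of the other components of
   [w Y] is subtracted. *)
Definition std_field c v e : pgl R p q :=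
  let Y := ((glmx e.1.2 *m v, 0), 0) in
  let k := w (PF_param G c e) Y in
  Y - ((0, glof (glmx e.1.2 *m glmx k.1.2)), e.2 *m k.1.2.2 + k.2).

Lemma std_fieldE c v e : PF_cod c e -> c = pref A (param c e.1.1) ->
  w (PF_param G c e) (std_field c v e) = ((v, 0), 0).
Proof.
move=> ce cE; set u := PF_param G c e.
have uP : PF G u by apply/PFP => //; exists c, e.
have [_ lw _ fw] := wC; have [_ lwu] := lw _ uP.
rewrite /std_field -/u; set Y := ((_, _), _); set k := w u Y.
have [Y1 _] := theta AO CH Y wP ce.
rewrite (cvec_pref AO CH Y ce cE) -/u -/k /= in Y1.
have kv : k.1.1 = v.
  have ua : glmx e.1.2 \in unitmx by rewrite glmx_unit; exact: ce.2.
  have := congr1 (mulmx (invmx (glmx e.1.2))) Y1.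
  by rewrite !mulmxA mulVmx// !mul1mx.
have := fw u (k.1.2, k.2) uP.
rewrite (fundamental_PF AO CH (k.1.2, k.2) ce cE) /=; set Z := ((_, _), _) => wZ.
have -> : Y - Z = (-1) *: Z + Y by rewrite scaleN1r addrC.
rewrite lwu wZ -/k -kv scaleN1r.
apply: pgl_ext => /=.
- by rewrite oppr0 add0r.
- by rewrite addNr.
- by rewrite addNr.
Qed.

(** Where [c] is preferred, components of tangent vectors are components in [c]. The hypothesis
    holds for a leaf space, which has a single chart. *)
Lemma std_field_smooth c v k : (forall x, ccod c x -> c = pref A (param c x)) ->
  diffk k (PF_cod c) (std_field c v).
Proof.
move=> cE; have o := open_PF_cod AO c; have [sw lw _ _] := wC.
have wE e Y : PF_cod c e -> w (PF_param G c e) (cvec (C := PFc G) c Y (PF_param G c e)) =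
    w (PF_param G c e) Y.
  by move=> ce; rewrite (cvec_pref AO CH Y ce (cE _ ce.1)).
have dw Y : diffk k (PF_cod c) (fun e => w (PF_param G c e) Y).
  apply: (diffk_ext o (F := fun e => w (PF_param G c e)
    (cvec (C := PFc G) c Y (PF_param G c e)))).
    by move=> e /set_mem ce; exact: wE.
  have := (smooth_onP _ o).1 (sw c Y); exact.
have lwe e : PF_cod c e -> linear (w (PF_param G c e)).
  move=> ce a x y; have [|_ h] := lw (PF_param G c e); last exact: h.
  by apply/PFP => //; exists c, e.
have dgl : diffk k (PF_cod c) (fun e : pgl R p q => glmx e.1.2).
  exact: diffk_lin (@linear_fiber R p q).
have d0 (V W : normedModType R) (U : set V) (a : W) : diffk k U (fun=> a).
  exact: diffk_cst.
have dY : diffk k (PF_cod c) (fun e : pgl R p q => ((glmx e.1.2 *m v, 0), 0) : pgl R p q).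
  apply: (diffk_pair o _ (d0 _ _ _ _)); apply: (diffk_pair o _ (d0 _ _ _ _)).
  exact: diffk_mulmx o dgl (d0 _ _ _ _).
have dk : diffk k (PF_cod c) (fun e : pgl R p q =>
    w (PF_param G c e) ((glmx e.1.2 *m v, 0), 0)).
  exact: (diffk_apply o lwe dw dY).
have dk12 : diffk k (PF_cod c) (fun e : pgl R p q =>
    glmx (w (PF_param G c e) ((glmx e.1.2 *m v, 0), 0)).1.2).
  exact: (diffk_linear o (@linear_fiber R p q) dk).
have dk122 : diffk k (PF_cod c) (fun e : pgl R p q =>
    (w (PF_param G c e) ((glmx e.1.2 *m v, 0), 0)).1.2.2).
  have l : linear (fun x : pgl R p q => x.1.2.2) by [].
  exact: (diffk_linear o l dk).
have dk2 : diffk k (PF_cod c) (fun e : pgl R p q =>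
    (w (PF_param G c e) ((glmx e.1.2 *m v, 0), 0)).2).
  exact: (diffk_linear o (@linear_xi R p q) dk).
have dxi : diffk k (PF_cod c) (fun e : pgl R p q => e.2).
  exact: diffk_lin (@linear_xi R p q).
apply: (diffkD o dY); apply: (diffkN o); apply: (diffk_pair o); last first.
  exact: diffkD o (diffk_mulmx o dxi dk122) dk2.
apply: (diffk_pair o (d0 _ _ _ _)).
exact: (diffk_linear o (@linear_glof R p q) (diffk_mulmx o dgl dk12)).
Qed.

End StandardField.

(** * Derivatives of foliated functions *)

Arguments open_ndom {R p q T A} AO c c'.
Arguments open_leaf {R p q T A} AO c.

Section Descent.
Context {R : realType} {p q : nat} {T : pointedType} (A : charted T 'cV[R]_(p + q)).
Hypothesis AO : atlas_ok A.
Local Notation E := 'cV[R]_(p + q).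
Local Notation Eq := 'cV[R]_(0 + q).
Local Notation EN := (E * gl R 0 q * 'rV[R]_q)%type.
Variable G : cidx A -> T -> E -> E.
Hypothesis CH : christ_ok G.
Variable GN : cidx A -> T -> 'cV[R]_q -> 'cV[R]_q.
Hypothesis GNE : forall c m Z, cdom c m -> dsubmx (G c m Z) = GN c m (dsubmx Z).
Hypothesis GNb : forall c m m', cdom c m -> cdom c m' ->
  dsubmx (coord c m) = dsubmx (coord c m') -> GN c m = GN c m'.
Variable wN : set (Eq -> T) -> EN -> pgl R 0 q.
Hypothesis wNf : normal_foliated_form GN wN.
Implicit Types (c : cidx A) (e : EN) (F : set (Eq -> T) -> R).

Local Notation leafp c := (@PF_param R 0 q Eq (leaf_space c) (@leafG R p q T A GN c) tt).
Local Notation nablaN := (@nabla R 0 q _ _ (PNc GN) wN).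

Definition leaf_form c (wc : set (Eq -> Eq) -> pgl R 0 q -> pgl R 0 q) : Prop :=
  @normal_cartan R 0 q Eq (leaf_space c) (@leafG R p q T A GN c) wc /\
  forall e X, PN_cod c e -> wN (PN_param GN c e) X =
    wc (leafp c (leaf_part e)) (leaf_part (tcomp (C := PNc GN) c (PN_param GN c e) X)).

Lemma leaf_formP c : exists wc, leaf_form c wc.
Proof.
have [wc [wcN wE]] := wNf c; exists wc; split; first exact: wcN.
move=> e X ce; set u := PN_param GN c e.
have jE : jbase u = param c e.1.1 by exact: (jbase_PN AO CH GNE ce).
have uP : PN GN u by apply/PNP => //; exists c, e.
have cu : cdom c (jbase u) by rewrite jE; have [] := ao_paramK AO ce.1.
apply: (etrans (wE u uP cu X)).
rewrite [to_leaf_space _ u](to_leafE AO CH GNE GNb ce); congr (wc _ _).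
set c0 := pref A (param c e.1.1).
have h : ndom c c0 e by exact: (pref_ndom AO ce).
have [h' _] := PN_trans AO CH GNE h.
rewrite (tcomp_PN AO CH GNE X ce) -/c0.
have E1 : pref (PNc GN) u = c0 by rewrite /c0 -jE.
rewrite /tmap E1 (coord_PN AO CH GNE h).
have dn := diffk_diff (ntrans_smooth AO c0 c 0) h'.
apply: etrans (derive_linear X (@linear_leaf_part R p q) dn).
apply: (derive_ext X (open_ndom AO c0 c) h') => y /set_mem hy.
have [hy' Ey] := PN_trans AO CH GNE hy.
rewrite /= Ey (to_leafE AO CH GNE GNb hy'.1).
exact: (PF_coordK (leaf_ok AO c) (leaf_christ AO CH GNE GNb c) (leafcod_leaf_part hy'.1)).
Qed.

(** Smooth and constant along the leaves, in a form stable under differentiation: over each chart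
    one smooth function on the frame bundle of the leaf space. *)
Definition foliated F := forall c, exists Ft : pgl R 0 q -> R,
  diff_infty (leafcod c) Ft /\
  forall e, PN_cod c e -> F (PN_param GN c e) = Ft (leaf_part e).

Lemma leafP c e : PN_cod c e ->
  @PF R 0 q Eq (leaf_space c) (@leafG R p q T A GN c) (leafp c (leaf_part e)).
Proof.
move=> ce; apply/(PFP (leaf_ok AO c)); exists tt, (leaf_part e); split=> //.
exact: leafcod_leaf_part.
Qed.

(** The preimage picked by [wfield] does not matter: [wc] is injective, so every preimage has leaf
    space part [X], and [F] depends on that part only. *)
Lemma nabla_PN c wc e v F Ft X : leaf_form c wc -> PN_cod c e ->
  diff_infty (leafcod c) Ft ->
  (forall e', PN_cod c e' -> F (PN_param GN c e') = Ft (leaf_part e')) ->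
  wc (leafp c (leaf_part e)) X = ((v, 0), 0) ->
  nablaN v F (PN_param GN c e) = 'D_X Ft (leaf_part e).
Proof.
move=> [wcN wE] ce dF FE wX; set u := PN_param GN c e.
have [[_ lw _ _] _ _ _] := wcN; have [bw _] := lw _ (leafP ce).
have dFe : differentiable Ft (leaf_part e) := diffoo_diff dF (leafcod_leaf_part ce).
rewrite /nabla (lie_PN AO CH GNE (wfield wN v) ce dFe FE) -/u.
have : [set Y | wN u Y = ((v, 0), 0)] (wfield wN v u).
  apply: getPex; set c0 := pref A (param c e.1.1).
  have h : ndom c c0 e by exact: (pref_ndom AO ce).
  (* [X] with zero leaf coordinates, a preimage once rewritten in the preferred chart; it shows that
     [get] chooses from a nonempty set. *)
  pose Z : EN := ((col_mx 0 X.1.1, X.1.2), X.2).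
  exists ('D_Z (ntrans c c0) e); rewrite /= wE// (tcomp_PN AO CH GNE _ ce).
  rewrite (derive_ntransK AO CH GNE Z h).
  have -> : leaf_part Z = X by apply: pgl_ext; rewrite //= col_mxKd.
  exact: wX.
rewrite /= => h0.
have h := bij_inj bw (etrans (esym (wE e _ ce)) (etrans h0 (esym wX))).
exact: (f_equal (fun Y => 'D_Y Ft (leaf_part e)) h).
Qed.

Lemma nabla_PN0 F u : foliated F -> PN GN u -> nablaN 0 F u = 0.
Proof.
move=> fF /((PNP AO GN u).1) [c [e [ce ->]]]; have [Ft [dF FE]] := fF c.
have [wc [wcN wE]] := leaf_formP c; have [[_ lw _ _] _ _ _] := wcN.
have [_ lwu] := lw _ (leafP ce).
rewrite (nabla_PN (X := 0) (conj wcN wE) ce dF FE); last first.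
  have := lwu (-1) 0 0; rewrite scaler0 addr0 scaleN1r addNr; exact.
by rewrite deriveE ?linear0//; exact: diffoo_diff dF (leafcod_leaf_part ce).
Qed.

(** [wfield] need not be smooth, but by [nabla_PN] the smooth field [std_field] of the leaf space
    computes the same derivative. *)
Lemma foliated_nabla v F : foliated F -> foliated (nablaN v F).
Proof.
move=> fF c; have [Ft [dF FE]] := fF c; have [wc [wcN wE]] := leaf_formP c.
have LO := leaf_ok AO c; have LC := leaf_christ AO CH GNE GNb c.
have [wcC wcP _ _] := wcN.
pose X := std_field (@leafG R p q T A GN c) wc tt v.
exists (fun y => 'D_(X y) Ft y); split=> [k|e ce].
  apply: (diffk_derive_field (open_PF_cod LO tt)); last exact: dF.
  exact: (std_field_smooth LO LC wcC v k (fun _ _ => erefl)).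
apply: (nabla_PN (conj wcN wE) ce dF FE).
exact: (std_fieldE LO LC wcC wcP v (leafcod_leaf_part ce) erefl).
Qed.

Variable wF : set (E -> T) -> pgl R p q -> pgl R p q.
Hypothesis wFN : normal_cartan G wF.
Hypothesis q_ge2 : (2 <= q)%N.
Local Notation nablaF := (@nabla R p q _ _ (PFc G) wF).

Lemma nabla_PF v (F : set (E -> T) -> R) (H : set (Eq -> T) -> R) u :
  foliated H -> (forall u, PF G u -> F u = H (pF2 A u)) -> PF G u ->
  nablaF v F u = nablaN (dsubmx v) H (pF2 A u).
Proof.
move=> fH FH uP.
(* The frame is written in the preferred chart of its base point, as [proj_form] requires. *)
have [c [e [ce -> cE]]] : exists c (e : pgl R p q), [/\ PF_cod c e, u = PF_param G c e &
    c = pref A (param c e.1.1)].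
  have [c [e [ce ->]]] := (PFP AO G u).1 uP; set c' := pref A (param c e.1.1).
  have [cp _] := ao_paramK AO ce.1.
  have c'e : cdom c' (param c e.1.1) by exact: ao_pref cp.
  have [ce' uE] := PF_trans AO CH ce c'e; exists c', (ptrans c c' e); split=> //.
  by have [_ _ E0] := tdomV AO (conj ce.1 c'e : tdom c c' e.1.1); rewrite /= E0.
have [Ft [dF FE]] := fH c; have [wc [wcN wE]] := leaf_formP c.
have ce' := PN_cod_normal_part ce; set u0 := PF_param G c e.
have u0P : PF G u0 by apply/PFP => //; exists c, e.
rewrite (pF2_PF AO CH GNE ce).
have [[_ lw _ _] _ _ _] := wFN; have [[g gK Kg] _] := lw _ u0P.
have : [set Y | wF u0 Y = ((v, 0), 0)] (wfield wF v u0).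
  by apply: getPex; exists (g ((v, 0), 0)); exact: Kg.
set Y := wfield wF v u0 => /= wY.
have LO := leaf_ok AO c; have LC := leaf_christ AO CH GNE GNb c.
have wX : wc (leafp c (leaf_projection e)) (leaf_projection Y) = ((dsubmx v, 0), 0).
  have D1 : forall x, ccod c x -> (dsubmx @` ccod c : set Eq) (dsubmx x).
    by move=> x cx; exists x.
  have D2 : forall x Z, ccod c x -> dsubmx (G c (param c x) Z) =
      @leafG R p q T A GN c tt (dsubmx x) (dsubmx Z).
    move=> x Z cx; rewrite (leafGE AO GNb cx); apply: GNE.
    by have [] := ao_paramK AO cx.
  have := proj_form AO CH (open_leaf AO c) D1 LC D2 wFN wcN Y q_ge2 ce cE.
  by rewrite -/u0 wY => <-.
rewrite (nabla_PN (X := leaf_projection Y) (conj wcN wE) ce' dF FE); last exact: wX.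
have E1 : pref (PFc G) u0 = c by rewrite -[LHS]/(pref A (jbase u0)) (jbase_PF AO CH ce) -cE.
rewrite /nabla /lie E1 (PF_coordK AO CH ce) -/Y.
apply: etrans (derive_precomp Ft e Y (@linear_leaf_projection R p q)).
apply: (derive_ext Y (open_PF_cod AO c) ce) => y /set_mem cy.
have yP : PF G (PF_param G c y) by apply/PFP => //; exists c, y.
by rewrite /= FH// (pF2_PF AO CH GNE cy) FE//; exact: PN_cod_normal_part.
Qed.

End Descent.

(** * Symbols *)

Section Tensors.
Context {R : realType}.

Lemma sum_tuple0 {n : nat} (F : seq 'I_n -> R) : \sum_(t : 0.-tuple 'I_n) F t = F [::].
Proof.
rewrite (big_pred1 [tuple]) => [//|t].
by apply/esym/eqP; exact: tuple0.
Qed.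

Lemma sum_tuple_cons {n k : nat} (F : seq 'I_n -> R) :
  \sum_(t : k.+1.-tuple 'I_n) F t = \sum_i \sum_(t : k.-tuple 'I_n) F (i :: t).
Proof.
rewrite pair_big /= (reindex (fun it : 'I_n * k.-tuple 'I_n => [tuple of it.1 :: it.2])) //=.
exists (fun t => (thead t, behead_tuple t)) => [[i t] _|t _] /=.
  by rewrite theadE; congr pair; apply: val_inj.
by rewrite -tuple_eta.
Qed.

Lemma sum_transverse {p q k : nat} (F : seq 'I_(p + q) -> R) :
  (forall t i, size t = k -> lshift q i \in t -> F t = 0) ->
  \sum_(t : k.-tuple 'I_(p + q)) F t =
  \sum_(t : k.-tuple 'I_q) F [seq rshift p i | i <- t].
Proof.
elim: k F => [|k IH] F F0.
  by rewrite (sum_tuple0 F) (sum_tuple0 (fun t => F [seq rshift p i | i <- t])).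
rewrite sum_tuple_cons (sum_tuple_cons (fun t => F [seq rshift p i | i <- t])).
rewrite big_split_ord /= big1 ?add0r => [|i _].
  apply: eq_bigr => i _; rewrite (IH (fun t => F (rshift p i :: t)))// => t j st jt.
  by apply: (F0 _ j); rewrite /= ?st// inE jt orbT.
rewrite big1// => t _; apply: (F0 _ i); rewrite /= ?size_tuple//.
by rewrite inE eqxx.
Qed.

Lemma tensor_act_nil {n : nat} (B : 'M[R]_n) (S : seq 'I_n -> R) :
  tensor_act B S [::] = S [::].
Proof.
rewrite /tensor_act (sum_tuple0 (fun t' => (\prod_(ij <- zip [::] t') B ij.1 ij.2) * S t')).
by rewrite big_nil mul1r.
Qed.

Lemma tensor_act_cons {n : nat} (B : 'M[R]_n) (S : seq 'I_n -> R) i t :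
  tensor_act B S (i :: t) = \sum_j B i j * tensor_act B (fun t' => S (j :: t')) t.
Proof.
rewrite /tensor_act /=.
rewrite (sum_tuple_cons (fun t' => (\prod_(ij <- zip (i :: t) t') B ij.1 ij.2) * S t')).
apply: eq_bigr => j _; rewrite mulr_sumr; apply: eq_bigr => t' _.
by rewrite /= big_cons mulrA.
Qed.

Lemma tensor_act_sum {n m : nat} (B : 'M[R]_n) (a : 'I_m -> R) (S : 'I_m -> seq 'I_n -> R) t :
  tensor_act B (fun t' => \sum_l a l * S l t') t = \sum_l a l * tensor_act B (S l) t.
Proof.
rewrite /tensor_act; under eq_bigr do rewrite mulr_sumr.
rewrite exchange_big /=; apply: eq_bigr => l _; rewrite mulr_sumr.
by apply: eq_bigr => t' _; rewrite mulrCA.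
Qed.

Lemma tensor_act_eq {n : nat} (B : 'M[R]_n) (S S' : seq 'I_n -> R) t :
  (forall t, S t = S' t) -> tensor_act B S t = tensor_act B S' t.
Proof. by move=> SS; apply: eq_bigr => t' _; rewrite SS. Qed.

Lemma tensor_act_comp {n : nat} (B C : 'M[R]_n) (S : seq 'I_n -> R) t :
  tensor_act B (tensor_act C S) t = tensor_act (B *m C) S t.
Proof.
elim: t S => [|i t IH] S; first by rewrite !tensor_act_nil.
rewrite !tensor_act_cons.
under eq_bigr do rewrite (tensor_act_eq _ _ (fun t => tensor_act_cons C S _ t)).
under eq_bigr do rewrite tensor_act_sum.
under eq_bigr do (under eq_bigr do rewrite IH).
under [RHS]eq_bigr do rewrite mxE mulr_suml.
rewrite exchange_big /=; apply: eq_bigr => j _; rewrite mulr_sumr.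
by apply: eq_bigr => l _; rewrite mulrA.
Qed.

(** Without lower left block, a transverse index of the result is fed by transverse indices only. *)
Lemma tensor_act_transverse {p q : nat} (B : 'M[R]_(p + q)) (S : seq 'I_(p + q) -> R) t :
  dlsubmx B = 0 ->
  tensor_act B S [seq rshift p i | i <- t] =
  tensor_act (drsubmx B) (fun t' => S [seq rshift p i | i <- t']) t.
Proof.
move=> B0; elim: t S => [|i t IH] S; first by rewrite !tensor_act_nil.
rewrite /= !tensor_act_cons big_split_ord /= big1 ?add0r => [|j _].
  by apply: eq_bigr => j _; rewrite IH !mxE.
by move/matrixP/(_ i j): B0; rewrite !mxE => ->; rewrite mul0r.
Qed.

Lemma diffk_tensor_act {V : normedModType R} {n k : nat} (U : set V) (B : V -> 'M[R]_n)
    (S : V -> seq 'I_n -> R) t : open U -> diffk k U B ->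
  (forall t, diffk k U (S ^~ t)) -> diffk k U (fun e => tensor_act (B e) (S e) t).
Proof.
move=> oU dB dS; apply: (diffk_sumf oU) => t'.
apply: (diffkM oU _ (dS _)); apply: (diffk_prod _ oU) => ij _.
exact: diffk_mxE.
Qed.

Lemma diffk_invmx (V : normedModType R) n k (U : set V) (F : V -> 'M[R]_n) : open U ->
  (forall e, U e -> F e \in unitmx) -> diffk k U F -> diffk k U (fun e => invmx (F e)).
Proof.
move=> oU uF dF.
have d1 : diffk k U (fun e => (\det (F e))^-1).
  apply: (diffkV oU) => [e Ue|]; last exact: diffk_det.
  by rewrite -unitfE -unitmxE; exact: uF.
have d2 : diffk k U (fun e => \adj (F e)).
  apply: (diffk_mx oU) => i j.
  apply: (diffk_ext (F := fun e => (-1) ^+ (j + i) * \det (row' j (col' i (F e)))) oU).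
    by move=> e _; rewrite mxE.
  apply: (diffkM oU (diffk_cst _ _ _)); apply: (diffk_det oU).
  apply: (diffk_mx oU) => a b.
  apply: (diffk_ext (F := fun e => F e (lift j a) (lift i b)) oU).
    by move=> e _; rewrite !mxE.
  exact: diffk_mxE.
apply: (diffk_ext oU _ (diffkZ oU d1 d2)) => e /set_mem /uF ue.
by rewrite /invmx ue.
Qed.

End Tensors.

Lemma invmx_mulr {R : realType} n (J J' D : 'M[R]_n) : J' *m J = 1%:M -> D \in unitmx ->
  invmx (J *m D) = invmx D *m J'.
Proof.
move=> JJ uD; have uJD : J *m D \in unitmx by rewrite unitmx_mul (mulmx1_unit JJ).2.
by apply: (can_inj (mulmxK uJD)); rewrite mulVmx// -!mulmxA (mulmxA J') JJ mul1mx mulVmx.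
Qed.

(** * Symbols and functions on the frame bundles *)

Section Hats.
Context {R : realType} {p q : nat} (M : foliated_manifold R p q).
Local Notation E := 'cV[R]_(p + q).
Local Notation Eq := 'cV[R]_(0 + q).
Local Notation EN := (E * gl R 0 q * 'rV[R]_q)%type.
Local Notation A := (fatlas M).
Local Notation AO := (fatlas_ok M).
Variable G : cidx A -> M -> E -> E.
Hypothesis CH : christ_ok G.
Variable GN : cidx A -> M -> 'cV[R]_q -> 'cV[R]_q.
Hypothesis GNE : forall c m Z, cdom c m -> dsubmx (G c m Z) = GN c m (dsubmx Z).
Implicit Types (c : cidx A) (e : EN).

Lemma transverse_descent c (H : M -> R) : diff_infty (ccod c) (H \o param c) ->
  (forall m m', cdom c m -> cdom c m' ->
    dsubmx (coord c m) = dsubmx (coord c m') -> H m = H m') ->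
  exists Ht : Eq -> R, diff_infty (dsubmx @` ccod c) Ht /\
    forall x, ccod c x -> H (param c x) = Ht (dsubmx x).
Proof.
move=> dH Hb; have [U [B [_ UB]]] := frectangular c.
(* The chart is rectangular, so one [u0] gives a section over its whole leaf space. If [U] is empty
   so is the chart, and the default value of [get] is harmless. *)
pose u0 := get U; pose L (y : Eq) : E := col_mx u0 0 + incl y.
have LE y : L y = col_mx u0 y by rewrite /L /incl add_col_mx addr0 add0r.
have Lc x : ccod c x -> ccod c (L (dsubmx x)).
  rewrite UB /= LE col_mxKu col_mxKd => -[Ux Bx]; split=> //.
  by apply: getPex; exists (usubmx x).
have o := open_leaf AO c.
exists (fun y => (H \o param c) (L y)); split=> [k|x cx].
  apply: (diffk_comp o (ao_open AO c)); last exact: dH.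
    by move=> _ [x cx <-]; exact: Lc.
  apply: (diffkD o); first exact: diffk_cst.
  exact: diffk_lin (@linear_incl R p q).
have [c1 E1] := fparamK cx; have [c2 E2] := fparamK (Lc x cx).
by apply: (Hb _ _ c1 c2); rewrite E1 E2 LE col_mxKd.
Qed.

Lemma foliated_hat0 (f : M -> R) : basic_function f ->
  foliated GN (hat0 f).
Proof.
move=> [sf bf] c.
have df : diff_infty (ccod c) (f \o param c).
  apply/(smooth_onP _ (ao_open AO c)); have := sf c.
  by rewrite (_ : [set e | _] = ccod c)//; apply/seteqP; split=> [e []|].
have [Ht [dHt HE]] := transverse_descent df (bf c).
exists (fun y => Ht y.1.1); split=> [k|e ce].
  have o := open_PF_cod (leaf_ok AO c) tt.
  apply: (diffk_comp (F := fun y : pgl R 0 q => y.1.1) o (open_leaf AO c)).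
  - by move=> y [].
  - exact: diffk_lin (@linear_base R 0 q).
  - exact: dHt.
by rewrite /hat0 (jbase_PN AO CH GNE ce) HE//; exact: ce.1.
Qed.

Lemma hat0_pF2 (f : M -> R) u : PF G u -> hat0 f u = hat0 f (pF2 A u).
Proof.
move=> /(PFP AO G u).1[c [e [ce ->]]]; rewrite /hat0 (jbase_PF AO CH ce).
by rewrite (pF2_PF AO CH GNE ce) (jbase_PN AO CH GNE (PN_cod_normal_part ce)).
Qed.

Lemma jac_PN c c' e (g := get (PN_param GN c e)) : PN_cod c e -> cdom c' (param c e.1.1) ->
  jac ((dsubmx : E -> 'cV[R]_q) \o coord c' \o g) 0 =
  drsubmx (tjac c c' e.1.1) *m e.1.2.2 :> 'M[R]_q.
Proof.
move=> ce c'e; have [sg g0 J] := get_PN AO CH GNE ce.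
have c'g : cdom c' (g 0) by rewrite [g 0]g0.
have [U [oU U0 Ug dg gE]] := smooth_germ_change_dom AO sg c'g.
have E0 : (coord c \o g) 0 = e.1.1.
  by rewrite /= [g 0]g0; have [_ ->] := fparamK ce.1.
have h : tdom c c' e.1.1 by rewrite -E0; exact: Ug.
have d0 := diffoo_diff dg U0.
have D1 v : 'D_v (ycoord c \o g) 0 = e.1.2.2 *m v.
  have := ((jet_eq2P _ _).1 J); move=> [_ J1 _].
  rewrite (J1 v) /nframe_model (derive_model0 _ _ _ _ (nframe_quadratic AO CH GNE ce.1)).
  by rewrite glmx0.
have D2 v : 'D_v (ycoord c \o g) 0 = dsubmx ('D_v (coord c \o g) 0).
  exact: (derive_linear v (@linear_dsubmx R p q 1) d0).
have dt := diffk_diff (ytrans_diff AO c c' 0) h.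
have dt' : differentiable (fun x : E => dsubmx (trans c c' x)) ((coord c \o g) 0) by rewrite E0.
have S v : 'D_v (ycoord c' \o g) 0 = drsubmx (tjac c c' e.1.1) *m (e.1.2.2 *m v).
  apply: (etrans (derive_ext (G := fun z => dsubmx (trans c c' ((coord c \o g) z))) v oU U0 _)).
    by move=> z zU; rewrite /ycoord /= [coord c' _](gE z zU).
  apply: (etrans (derive_comp v d0 dt')); rewrite E0.
  apply: (etrans (derive_ytrans AO _ h)); congr (_ *m _).
  by rewrite -D1 D2.
have dd : differentiable (ycoord c' \o g) 0.
  have dz : differentiable (fun z => dsubmx (trans c c' ((coord c \o g) z))) 0.
    exact: (differentiable_comp (g := fun x : E => dsubmx (trans c c' x)) d0 dt').
  apply: (differentiable_ext oU U0 _ dz) => z zU.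
  by rewrite /ycoord /= [coord c' _](gE z zU).
apply: mulmx_inj => v; apply: (etrans (esym (derive_jac v dd))).
by rewrite -mulmxA; exact: S.
Qed.

Lemma drsubmx_mul (B C : 'M[R]_(p + q)) : dlsubmx B = 0 ->
  drsubmx (B *m C) = drsubmx B *m drsubmx C.
Proof.
move=> B0; rewrite -{1}(submxK B) -{1}(submxK C) mulmx_block block_mxKdr B0.
by rewrite mul0mx add0r.
Qed.

Lemma invmx_glmx (a : gl R p q) : isGL a -> invmx (glmx a) =
  glmx ((invmx a.1.1, - (invmx a.1.1 *m a.1.2 *m invmx a.2)), invmx a.2).
Proof.
move=> ga; have [u1 u2] := andP ga; have ug : glmx a \in unitmx by rewrite glmx_unit.
apply: (can_inj (mulmxK ug)); rewrite mulVmx// /glmx mulmx_block /=.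
rewrite !mulmx0 !mul0mx !addr0 !add0r mulNmx -(mulmxA _ (invmx a.2) a.2) (mulVmx u1) (mulVmx
  u2).
by rewrite mulmx1 subrr -scalar_mx_block.
Qed.

Lemma dlsubmx_tjac c c' x : tdom c c' x -> dlsubmx (tjac c c' x) = 0.
Proof. by move=> h; rewrite -(tjac_fol AO h) block_mxKdl. Qed.

(** [hatN] works in the preferred chart. The transition Jacobians turn its components into those in
    [c], which are functions of [y] by adaptedness; only the inverse of the frame matrix is left
    acting on them. *)
Lemma foliated_hatN k s t : adapted_symbol k s -> foliated GN (fun u => hatN (piF s) u t).
Proof.
move=> [_ ss bs] c.
have /(@choice (seq 'I_q) (Eq -> R))[St StP] t' : exists St : Eq -> R,
    diff_infty (dsubmx @` ccod c) St /\ forall x, ccod c x ->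
    symbol_comp c s (param c x) [seq rshift p a | a <- t'] = St (dsubmx x).
  apply: (transverse_descent (H := fun m => symbol_comp c s m [seq rshift p a | a <- t'])).
    apply/(smooth_onP _ (ao_open AO c)); exact: ss.
  exact: bs.
exists (fun y => tensor_act (invmx y.1.2.2 : 'M[R]_q) (fun t' => St t' y.1.1) t).
split=> [j|e ce].
  have o := open_PF_cod (leaf_ok AO c) tt.
  apply: (diffk_tensor_act _ o) => [|t'].
    apply: (diffk_invmx o) => [y [_]|]; first by rewrite isGL0.
    have l : linear (fun y : pgl R 0 q => y.1.2.2) by [].
    exact: diffk_lin l.
  apply: (diffk_comp (F := fun y : pgl R 0 q => y.1.1) o (open_leaf AO c)).
  - by move=> y [].
  - exact: diffk_lin (@linear_base R 0 q).
  - exact: (StP t').1.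
have [cp E0] := fparamK ce.1; set m := param c e.1.1.
set c0 := pref A m; have c0m : cdom c0 m by exact: fpref_dom.
have h : tdom c c0 e.1.1 by split; [exact: ce.1|].
have [h' _ _] := tdomV AO h.
have [_ g0 _] := get_PN AO CH GNE ce.
rewrite /hatN g0 -/m -/c0 (jac_PN ce c0m).
have uD : e.1.2.2 \in unitmx by have := ce.2; rewrite isGL0.
set J := tjac c c0 e.1.1; set J' := tjac c0 c (trans c c0 e.1.1).
have JJ : J' *m J = 1%:M.
  have hcc : tdom c c e.1.1 by split; [exact: ce.1|].
  by rewrite (tjac_comp AO h hcc) tjac_id//; exact: ce.1.
have J'0 : dlsubmx J' = 0 by exact: dlsubmx_tjac.
have DD : drsubmx J' *m drsubmx J = 1%:M :> 'M[R]_q.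
  rewrite -drsubmx_mul// JJ -(@block_mxKdr R p q p q 1%:M 0 0 1%:M).
  by rewrite -scalar_mx_block.
have -> : invmx (drsubmx J *m e.1.2.2) = invmx e.1.2.2 *m drsubmx J' :> 'M[R]_q.
  exact: (invmx_mulr DD uD).
rewrite -tensor_act_comp; apply: tensor_act_eq => t'.
rewrite -(StP t').2; last exact: ce.1.
by rewrite /symbol_comp -/m -/c0 (tensor_act_transverse _ _ J'0).
Qed.

Lemma hatF_pF2 s u t : PF G u ->
  hatF s u [seq rshift p i | i <- t] = hatN (piF s) (pF2 A u) t.
Proof.
move=> /(PFP AO G u).1[c1 [e1 [ce1 uE]]].
(* Symbols are stored by their components in the preferred chart; writing the frame there removes
   the transition Jacobians. *)
pose c := pref A (param c1 e1.1.1).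
have [cp1 _] := fparamK ce1.1.
have c1e : cdom c (param c1 e1.1.1) by exact: fpref_dom.
have [ce] := PF_trans AO CH ce1 c1e; rewrite -uE {uE} => ->.
have E1 : param c (ptrans c1 c e1).1.1 = param c1 e1.1.1.
  by have [_ _ ->] := tdomV AO (conj ce1.1 c1e : tdom c1 c e1.1.1).
set e := ptrans c1 c e1 in ce E1 *.
rewrite (pF2_PF AO CH GNE ce).
have cE : c = pref A (param c e.1.1) by rewrite E1.
have cp : cdom c (param c e.1.1) by have [] := fparamK ce.1.
have ce' := PN_cod_normal_part ce.
have [_ gn0 _] := get_PN AO CH GNE ce'.
have [fg Jm] := frame_germ AO CH ce.
have [gg gf0 J] := get_jet AO (leqnn 2) fg.
have g0 : get (PF_param G c e) 0 = param c e.1.1 by rewrite [LHS]gf0 (frame0 AO CH ce).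
have JE : jac (coord c \o get (PF_param G c e)) 0 = glmx e.1.2.
  have [U [oU U0 _ dg _]] := gg.
  apply: mulmx_inj => v; apply: (etrans (esym (derive_jac v (diffoo_diff dg U0)))).
  have [_ J1 _] := (jet_eq2P _ _).1 (jet_eq_trans (jet_eq_sym J) (Jm 2)).
  by rewrite (J1 v) /frame_model (derive_model0 _ _ _ _ (frame_quadratic AO CH ce)).
rewrite /hatF g0 -cE JE /hatN gn0 -cE (jac_PN ce' cp).
have dl0 : dlsubmx (invmx (glmx e.1.2)) = 0.
  by rewrite invmx_glmx ?block_mxKdl//; exact: ce.2.
rewrite tensor_act_transverse//; congr (tensor_act _ _ t).
  rewrite invmx_glmx; last exact: ce.2.
  rewrite block_mxKdr; congr invmx.
  rewrite [tjac _ _ _]tjac_id; last exact: ce.1.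
  by rewrite [X in drsubmx X](@scalar_mx_block R p q) block_mxKdr mul1mx.
Qed.

End Hats.

(** * Quantization commutes with reduction *)

Section Quantization.
Context {R : realType} {p q : nat} (M : foliated_manifold R p q).
Hypothesis q_ge2 : (2 <= q)%N.
Local Notation E := 'cV[R]_(p + q).
Local Notation Eq := 'cV[R]_(0 + q).
Local Notation EN := (E * gl R 0 q * 'rV[R]_q)%type.
Local Notation A := (fatlas M).
Local Notation AO := (fatlas_ok M).
Variable G : cidx A -> M -> E -> E.
Hypothesis CH : christ_ok G.
Variable GN : cidx A -> M -> 'cV[R]_q -> 'cV[R]_q.
Hypothesis GNE : forall c m Z, cdom c m -> dsubmx (G c m Z) = GN c m (dsubmx Z).
Hypothesis GNb : forall c m m', cdom c m -> cdom c m' ->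
  dsubmx (coord c m) = dsubmx (coord c m') -> GN c m = GN c m'.
Variable wF : set (E -> M) -> pgl R p q -> pgl R p q.
Hypothesis wF_normal : normal_cartan G wF.
Variable wN : set (Eq -> M) -> EN -> pgl R 0 q.
Hypothesis wN_normal : normal_foliated_form GN wN.
Local Notation nablaF := (@nabla R p q _ _ (PFc G) wF).
Local Notation nablaN := (@nabla R 0 q _ _ (PNc GN) wN).
Local Notation DivF := (@Div R p q _ _ (PFc G) wF).
Local Notation DivN := (@Div R 0 q _ _ (PNc GN) wN).

Lemma PN_pF2 u : PF G u -> PN GN (pF2 A u).
Proof.
move=> /(PFP AO G u).1[c [e [ce ->]]]; rewrite (pF2_PF AO CH GNE ce).
by apply/(PNP AO); exists c, (normal_part e); split=> //; exact: PN_cod_normal_part.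
Qed.

Lemma pF2_surj u : PN GN u -> exists2 u', PF G u' & u = pF2 A u'.
Proof.
move=> /(PNP AO GN u).1[c [e [ce ->]]]; have cl := PF_cod_lift ce.
exists (PF_param G c (pgl_lift e)); first by apply/(PFP AO); exists c, (pgl_lift e).
by rewrite (pF2_PF AO CH GNE cl) normal_part_lift.
Qed.

Lemma foliated_sum (I : finType) (F : I -> set (Eq -> M) -> R) :
  (forall i, foliated GN (F i)) -> foliated GN (fun u => \sum_i F i u).
Proof.
move=> fF c; have /choice[Ft FtP] i := fF i c.
exists (fun y => \sum_i Ft i y); split=> [k|e ce].
  apply: (diffk_sumf (open_PF_cod (leaf_ok AO c) tt)) => i; exact: (FtP i).1.
by apply: eq_bigr => i _; rewrite (FtP i).2.
Qed.

Lemma dsubmx_ev (j : 'I_q) : dsubmx (ev (rshift p j)) = ev (rshift 0 j) :> 'cV[R]_q.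
Proof.
rewrite rshift0; apply/matrixP => a b.
by rewrite !mxE (inj_eq (@rshift_inj p q)).
Qed.

(** [Div] sums over transverse directions and prepends a transverse index, so the purely transverse
    components are closed under its iteration. *)
Lemma iter_Div S SN : (forall t, foliated GN (SN ^~ t)) ->
  (forall u t, PF G u -> S u [seq rshift p i | i <- t] = SN (pF2 A u) t) ->
  forall l, (forall t, foliated GN (fun u => iter l DivN SN u t)) /\
    forall u t, PF G u -> iter l DivF S u [seq rshift p i | i <- t] =
      iter l DivN SN (pF2 A u) t.
Proof.
move=> fS SE; elim=> [|l [fl lE]]; first by split.
split=> [t|u t uP] /=.
  apply: (foliated_sum (F := fun j u => nablaN (ev (rshift 0 j))
    (fun u' => iter l DivN SN u' (rshift 0 j :: t)) u)) => j.
  apply: (foliated_nabla AO CH GNE GNb wN_normal); exact: fl.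
apply: eq_bigr => j _.
apply: (etrans (nabla_PF AO CH GNE GNb wN_normal wF_normal q_ge2 (ev (rshift p j))
  (fl (rshift 0 j :: t)) _ uP)).
  move=> u' u'P; rewrite -(lE u' _ u'P) /=; congr (iter _ _ _ _ (_ :: _)).
  by congr (rshift p _); apply/esym; exact: rshift0.
exact: (f_equal (fun v => nablaN v _ _) (dsubmx_ev j)).
Qed.

Lemma foldr_nablaN F vs : foliated GN F -> foliated GN (foldr nablaN F vs).
Proof. by move=> fF; elim: vs => //= v vs; exact: (foliated_nabla AO CH GNE GNb wN_normal). Qed.

Lemma foldr_nabla F H vs u : foliated GN H -> (forall u, PF G u -> F u = H (pF2 A u)) ->
  PF G u -> foldr nablaF F vs u = foldr nablaN H (map dsubmx vs) (pF2 A u).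
Proof.
move=> fH FH; elim: vs u => [|v vs IH] u uP /=; first exact: FH.
apply: (nabla_PF AO CH GNE GNb wN_normal wF_normal q_ge2 v _ IH uP).
exact: foldr_nablaN.
Qed.

(** At a zero direction the derivative vanishes by [nabla_PN0]; the outer ones then differentiate a
    function that is 0 on all of [PN], represented by the zero function on the leaf space. *)
Lemma foldr_nabla0 F vs u : foliated GN F -> 0 \in vs -> PN GN u ->
  foldr nablaN F vs u = 0.
Proof.
move=> fF; elim: vs u => // v vs IH u; rewrite inE => /orP[/eqP <-|v0] uP /=.
  apply: (nabla_PN0 AO CH GNE GNb wN_normal _ uP); exact: foldr_nablaN.
have [c [e [ce uE]]] := (PNP AO GN u).1 uP.
have [wc wcP] := leaf_formP AO CH GNE GNb wN_normal c.
have d0 : diff_infty (@leafcod R p q M A c) (fun=> 0 : R) by move=> k; exact: diffk_cst.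
have [[_ lw _ _] _ _ _] := wcP.1.
have [[g gK Kg] _] := lw _ (leafP AO GN ce).
have Kg' := Kg ((v, 0), 0).
rewrite uE (nabla_PN AO CH GNE wcP ce d0 _ Kg'); first exact: derive_cst.
move=> e' ce'; apply: (IH _ v0).
exact: ((PNP AO GN _).2 (ex_intro _ c (ex_intro _ e' (conj ce' erefl)))).
Qed.

Lemma nabla_iterE k F H (v : k.-tuple E) u : foliated GN H ->
  (forall u, PF G u -> F u = H (pF2 A u)) -> PF G u ->
  nabla_iter (PFc G) wF F v u =
  nabla_iter (PNc GN) wN H [tuple of map dsubmx v] (pF2 A u).
Proof.
move=> fH FH uP; congr (_ * _); apply: eq_bigr => s _.
rewrite (foldr_nabla _ fH FH uP) -map_comp.
by congr (foldr _ _ _ _); apply: eq_map => i; rewrite /= tnth_map.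
Qed.

Lemma nabla_iter0 k H (v : k.-tuple Eq) u : foliated GN H -> 0 \in v -> PN GN u ->
  nabla_iter (PNc GN) wN H v u = 0.
Proof.
move=> fH v0 uP; rewrite /nabla_iter big1 ?mulr0// => s _.
apply: foldr_nabla0 => //; have /tnthP[i iE] := v0.
apply/mapP; exists ((s^-1)%g i); first by rewrite mem_enum.
by rewrite permKV.
Qed.

Lemma div_nablaE k l S SN F H u :
  (forall t, foliated GN (SN ^~ t)) ->
  (forall u t, PF G u -> S u [seq rshift p i | i <- t] = SN (pF2 A u) t) ->
  foliated GN H -> (forall u, PF G u -> F u = H (pF2 A u)) -> PF G u ->
  div_nabla (PFc G) wF k l S F u = div_nabla (PNc GN) wN k l SN H (pF2 A u).
Proof.
move=> fS SE fH FH uP; have [_ DE] := iter_Div fS SE l.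
have uN := PN_pF2 uP.
rewrite /div_nabla /pairing; set S' := iter l _ S u.
(* [sum_transverse] speaks of functions of sequences, so the multilinear form is extended by 0 to
   the other lengths. *)
pose B (t : seq 'I_(p + q)) : R := if insub t is Some t' then
  nabla_iter (PFc G) wF F (map_tuple ev (t' : (k - l).-tuple 'I_(p + q))) u else 0.
transitivity (\sum_(t : (k - l).-tuple 'I_(p + q)) S' t * B t).
  by apply: eq_bigr => t _; rewrite /B valK.
rewrite (sum_transverse (F := fun t => S' t * B t)); last first.
  (* A leaf index contributes the basis vector [ev (lshift q i)], whose transverse part is 0; the
     iterated derivative then vanishes by [nabla_iter0]. *)
  move=> t i st ti; rewrite /B; case: insubP => [t' _ tE|]; last by rewrite mulr0.
  rewrite (nabla_iterE _ fH FH uP) nabla_iter0 ?mulr0//.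
  apply/mapP; exists (ev (lshift q i)); last first.
    by apply/matrixP => a b; rewrite !mxE eq_rlshift.
  by apply/mapP; exists (lshift q i) => //; rewrite tE.
apply: eq_bigr => t _; rewrite /S' (DE u _ uP); congr (_ * _).
rewrite /B; case: insubP => [t' _ tE|]; last by rewrite size_map size_tuple eqxx.
rewrite (nabla_iterE _ fH FH uP); congr (nabla_iter _ _ _ _ _); apply: val_inj => /=.
rewrite tE -!map_comp; apply: eq_map => i; apply/matrixP => a b; rewrite !mxE.
by rewrite (inj_eq (@rshift_inj p q)).
Qed.

End Quantization.

Theorem theorem16 (R : realType) (p q k : nat) (q_ge2 : (2 <= q)%N)
    (M : foliated_manifold R p q)
    (nablaF : (M -> 'cV[R]_(p + q)) -> (M -> 'cV[R]_(p + q)) ->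
              M -> 'cV[R]_(p + q))
    (nablaF_adapted : adapted_connection nablaF)
    (nablaN : (M -> 'cV[R]_q) -> (M -> 'cV[R]_q) -> M -> 'cV[R]_q)
    (nablaN_induced : induced_connection nablaF nablaN)
    (wF : set ('cV[R]_(p + q) -> M) -> pgl R p q -> pgl R p q)
    (wF_normal : normal_cartan (christoffel nablaF) wF)
    (wN : set ('cV[R]_(0 + q) -> M) ->
          'cV[R]_(p + q) * gl R 0 q * 'rV[R]_q -> pgl R 0 q)
    (wN_normal : normal_foliated_form (christoffelN nablaN) wN)
    (s : M -> seq 'I_(p + q) -> R) (s_adapted : adapted_symbol k s)
    (f : M -> R) (f_basic : basic_function f) :
  (forall l : nat, (l <= k)%N -> forall u, PF (christoffel nablaF) u ->
     div_nabla (PFc (christoffel nablaF)) wF k l (hatF s) (hat0 f) u =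
     div_nabla (PNc (christoffelN nablaN)) wN k l (hatN (piF s)) (hat0 f)
       (pF2 (fatlas M) u)) /\
  quantF (christoffel nablaF) wF k s f =
  quantN (christoffelN nablaN) wN k (piF s) f.
Proof.
have CH := christoffel_ok nablaF_adapted.
have GNE c m Z : cdom c m ->
    dsubmx (christoffel nablaF c m Z) = christoffelN nablaN c m (dsubmx Z).
  move=> cm; rewrite (christoffelN_E nablaN_induced _ cm).
  by apply: (christoffel_fol nablaF_adapted cm); rewrite col_mxKd.
have GNb c m m' : cdom c m -> cdom c m' -> dsubmx (coord c m) = dsubmx (coord c m') ->
    christoffelN nablaN c m = christoffelN nablaN c m'.
  move=> cm cm' mm; apply/funext => z.
  rewrite (christoffelN_E nablaN_induced z cm).
  rewrite (christoffelN_E nablaN_induced z cm').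
  have [c1 <-] := fcoordK cm; have [c2 <-] := fcoordK cm'.
  exact: (christoffel_basic nablaF_adapted _ c1 c2 mm).
have H l u (uP : PF (christoffel nablaF) u) :
    div_nabla (PFc (christoffel nablaF)) wF k l (hatF s) (hat0 f) u =
    div_nabla (PNc (christoffelN nablaN)) wN k l (hatN (piF s)) (hat0 f) (pF2 (fatlas M) u).
  apply: (div_nablaE q_ge2 CH GNE GNb wF_normal wN_normal) uP.
  - by move=> t; exact: (foliated_hatN CH GNE t s_adapted).
  - by move=> u' t u'P; exact: (hatF_pF2 CH GNE).
  - exact: (foliated_hat0 CH GNE f_basic).
  - by move=> u' u'P; exact: (hat0_pF2 CH GNE).
split=> [l _ u uP|]; first exact: H.
(* The two sets of candidate functions on [M] coincide: their conditions correspond along [pF2],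
   which is onto [PN]. *)
rewrite /quantF /quantN; congr get; apply/seteqP; split=> g /= Hg u uP.
  have [u' u'P ->] := pF2_surj CH GNE uP.
  rewrite -(hat0_pF2 CH GNE _ u'P) (Hg _ u'P).
  by apply: eq_bigr => l _; rewrite (H l u' u'P).
rewrite (hat0_pF2 CH GNE _ uP) (Hg _ (PN_pF2 CH GNE uP)).
by apply: eq_bigr => l _; rewrite (H l u uP).
Qed.
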